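(* Let $G$ be a finite simple graph of order $n$ with maximum degree $\Delta$. If $G$ is edge-$\Delta$-critical and $\Delta\geq \frac{2n}{3}+12$, then $G$ is Hamiltonian.
   Context: For a finite simple graph $G$ with maximum degree $\Delta$, the chromatic index $\chi'(G)$ is the least $k$ such that $G$ has a proper edge-coloring with $k$ colors. $G$ is called edge-$\Delta$-critical if $\chi'(G)=\Delta+1$ and $\chi'(H)\le \Delta$ for every proper subgraph $H$ of $G$. *)

(* Defs.v *)
From mathcomp Require Import all_boot.
Set Implicit Arguments. Unset Strict Implicit. Unset Printing Implicit Defensive.

Definition simple_graph (T : finType) (e : rel T) : Prop :=
  symmetric e /\ irreflexive e.

Definition deg (T : finType) (e : rel T) (x : T) : nat := #|[set y | e x y]|.

Definition max_deg (T : finType) (e : rel T) : nat := \max_(x : T) deg e x.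

Definition edge_colorable (T : finType) (f : rel T) (k : nat) : Prop :=
  exists c : T -> T -> nat,
    (forall x y, f x y -> c x y < k) /\
    (forall x y, f x y -> c x y = c y x) /\
    (forall x y z, f x y -> f x z -> y != z -> c x y != c x z).

Definition is_chromatic_index (T : finType) (f : rel T) (k : nat) : Prop :=
  edge_colorable f k /\ forall j, edge_colorable f j -> k <= j.

Definition subgraph (T : finType) (e : rel T) (V : {set T}) (f : rel T) : Prop :=
  symmetric f /\ (forall x y, f x y -> e x y) /\
  (forall x y, f x y -> (x \in V) && (y \in V)).

Definition proper_subgraph (T : finType) (e : rel T) (V : {set T}) (f : rel T) : Prop :=
  subgraph e V f /\ (V != setT \/ exists x y, e x y && ~~ f x y).

Definition edge_critical (T : finType) (e : rel T) : Prop :=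
  is_chromatic_index e (max_deg e).+1 /\
  forall (V : {set T}) (f : rel T), proper_subgraph e V f ->
    exists k, is_chromatic_index f k /\ k <= max_deg e.

Definition hamiltonian (T : finType) (e : rel T) : Prop :=
  exists s : seq T, [/\ uniq s, 3 <= size s, (forall x, x \in s) & cycle e s].

(* Main.v *)
Require Import Defs.
From mathcomp Require Import all_boot all_order all_algebra.
From mathcomp Require Import perm zify ring lra.
From Stdlib Require Import Classical_Prop.
Set Implicit Arguments. Unset Strict Implicit. Unset Printing Implicit Defensive.

(* Let [D] be the set of vertices of maximum degree and [S] the set of vertices [v]
   with [deg v + Delta < n]; by the hypothesis on [Delta], two vertices of [S] always
   miss many common colors.
   - Vizing's adjacency lemma gives a discharging bound: for [U] containing [D], the
     sum over [v] outside [U] of the proportion of neighbours of [v] lying in [U] is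
     less than [#|U|].  Applied to a minimum path cover, it shows that the complement
     of [D] is covered by at most [#|D|] paths.
   - A Woodall-type refinement of the adjacency lemma gives [2 * #|A| <= #|N(A)|] for
     every [A] contained in [S].  Hence, by rotations in the sense of Posa, the cover
     can be chosen so that every end lying in [S] can be prolonged by a private
     neighbour in [D].
   - Every vertex of [D] and every vertex outside [S] have degree sum at least [n], so
     by the Bondy-Chvatal closure they may be assumed adjacent; the prolonged paths
     and the remaining vertices of [D] then close up to a Hamiltonian cycle. *)

(** * Partial edge colorings and Kempe changes *)

(** The bound [#|D|] on the number of paths is the price of closing up: [p] paths in circular order
    have [p] junctions, and the closure supplies an edge at a junction when one side is in [D] and
    the other is outside [S]. An end in [S] is an obstacle to this. Prolonging it uses up a vertex
    of [D] but creates an end in [D], so the budget is kept. A vertex has at most two path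
    neighbours and attached vertices together, which is what the factor 2 in the expansion of [S]
    has to beat. The discharging bound must yield about one unit of weight per path. As a rule the
    two ends of a path give a half each, since by Ore-type counting in a minimum cover ends of
    different paths together have few neighbours outside the target set; strictness of the bound
    pays for the one path where this may fail. A one-vertex path has only one vertex to offer, so
    its neighbours, the middles of certain three-vertex paths, are moved into the target set. If the
    Ore bound is too weak for halves, the inner vertices of the paths are brought in as well. *)

Section PartialColoring.
Variables (T : finType) (e : rel T) (k : nat).
Implicit Types (c : T -> T -> option 'I_k) (u v w x y z : T) (i j : 'I_k).
Implicit Types (K : {set T}).

Record pcoloring c : Prop := PColoring {
  pcol_sym : forall u v, c u v = c v u;
  pcol_edge : forall u v, c u v != None -> e u v;
  pcol_proper : forall u v w i, c u v = Some i -> c u w = Some i -> v = w }.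

Definition joins x y u v := (u == x) && (v == y) || (u == y) && (v == x).

Definition miss c v : {set 'I_k} := [set i | [forall u, c v u != Some i]].

Definition upd c x y o u v := if joins x y u v then o else c u v.

Lemma joinsC x y u v : joins x y u v = joins x y v u.
Proof. by rewrite /joins orbC andbC [_ && (v == y)]andbC. Qed.

Lemma joins_pairP x y u v :
  reflect (u = x /\ v = y \/ u = y /\ v = x) (joins x y u v).
Proof.
apply: (iffP orP) => [[/andP[/eqP-> /eqP->]|/andP[/eqP-> /eqP->]]|]; [by left|by right|].
by case=> [[-> ->]|[-> ->]]; rewrite !eqxx; [left|right].
Qed.

Lemma missP c v i : reflect (forall u, c v u <> Some i) (i \in miss c v).
Proof. by rewrite inE; apply: (iffP forallP) => h u; apply/eqP; apply: h. Qed.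

Lemma missPn c v i : reflect (exists u, c v u = Some i) (i \notin miss c v).
Proof.
rewrite inE negb_forall; apply: (iffP existsP) => [] [u].
  by rewrite negbK => /eqP h; exists u.
by move=> h; exists u; rewrite h eqxx.
Qed.

Lemma updE x y c o : upd c x y o x y = o.
Proof. by rewrite /upd /joins !eqxx. Qed.

Lemma updN x y c o u v : ~~ joins x y u v -> upd c x y o u v = c u v.
Proof. by rewrite /upd => /negbTE->. Qed.

Lemma upd_other x y c o u v : u != x -> u != y -> upd c x y o u v = c u v.
Proof. by move=> /negbTE h1 /negbTE h2; rewrite /upd /joins h1 h2. Qed.

Lemma miss_upd_other c x y o v : v != x -> v != y -> miss (upd c x y o) v = miss c v.
Proof.
move=> vx vy; apply/setP => i; rewrite !inE.
by apply: eq_forallb => u; rewrite upd_other.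
Qed.

Lemma miss_upd_None c x y v i : i \in miss c v -> i \in miss (upd c x y None) v.
Proof. by move=> /missP h; apply/missP => u; rewrite /upd; case: ifP. Qed.

Lemma miss_upd_Some c x y v i j :
  i \in miss c v -> i != j -> i \in miss (upd c x y (Some j)) v.
Proof.
move=> /missP h ij; apply/missP => u; rewrite /upd; case: ifP => // _ [ji].
by rewrite ji eqxx in ij.
Qed.

Lemma pcol_upd_None c x y : pcoloring c -> pcoloring (upd c x y None).
Proof.
case=> sy ed pr; split.
- by move=> u v; rewrite /upd joinsC sy.
- by move=> u v; rewrite /upd; case: ifP => // _; apply: ed.
- by move=> u v w i; rewrite /upd; do 2 case: ifP => // _; apply: pr.
Qed.

Lemma pcol_upd_Some c x y i : x != y -> e x y -> e y x -> pcoloring c ->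
  i \in miss c x -> i \in miss c y -> pcoloring (upd c x y (Some i)).
Proof.
move=> xy exy eyx [sy ed pr] /missP mx /missP my; split.
- by move=> u v; rewrite /upd joinsC sy.
- move=> u v; rewrite /upd; case: ifP => [/joins_pairP[[-> ->]|[-> ->]] //|_].
  exact: ed.
- move=> u v w j; rewrite /upd; case: ifP => [j1|_]; case: ifP => [j2|_].
  + move=> _ _; case/joins_pairP: j1 j2 => [] [-> ->] /joins_pairP[] [] // h1 h2.
    * by rewrite h1 eqxx in xy.
    * by rewrite h1 eqxx in xy.
  + by move=> [<-]; case/joins_pairP: j1 => [] [-> _] h; [case: (mx w)|case: (my w)].
  + by move=> h [ij]; case/joins_pairP: j2 h => [] [-> _]; rewrite -ij => h; [case: (mx v)|case: (my v)].
  + exact: pr.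
Qed.

(** Only the first argument is tested. The result is symmetric because [kclosed] puts both ends of
    an edge colored [i] or [j] on the same side of [K], and [tperm i j] fixes all other colors. *)
Definition kswap c i j (K : {set T}) u v :=
  if u \in K then omap (tperm i j) (c u v) else c u v.

Definition kclosed c i j (K : {set T}) :=
  forall u v, (c u v == Some i) || (c u v == Some j) -> (u \in K) = (v \in K).

Lemma omap_tperm_id i j (o : option 'I_k) :
  ~~ ((o == Some i) || (o == Some j)) -> omap (tperm i j) o = o.
Proof.
case: o => //= l; rewrite negb_or => /andP[li lj]; congr Some.
by rewrite tpermD // eq_sym; [apply: contra li|apply: contra lj] => /eqP->.
Qed.

Lemma pcol_kswap c i j K : pcoloring c -> kclosed c i j K -> pcoloring (kswap c i j K).
Proof.
case=> sy ed pr cl; split.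
- move=> u v; rewrite /kswap sy.
  have [h|h] := boolP ((c v u == Some i) || (c v u == Some j)).
    by rewrite (cl v u h).
  by rewrite omap_tperm_id //; case: ifP; case: ifP.
- move=> u v h; apply: ed; apply: contraNN h; rewrite /kswap => /eqP->.
  by case: ifP.
- move=> u v w l; rewrite /kswap; case: ifP => _; last exact: pr.
  case h1: (c u v) => [a|] //=; case h2: (c u w) => [b|] //= [<-] [/perm_inj ab].
  by apply: (pr u v w a) => //; rewrite h2 ab.
Qed.

Lemma kswap_None c i j K u v : (kswap c i j K u v == None) = (c u v == None).
Proof. by rewrite /kswap; case: ifP => //; case: (c u v). Qed.

Lemma miss_kswap_out c i j K v : v \notin K -> miss (kswap c i j K) v = miss c v.
Proof.
move=> vK; apply/setP => l; rewrite !inE.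
by apply: eq_forallb => u; rewrite /kswap (negbTE vK).
Qed.

Lemma miss_kswap_in c i j K v l :
  v \in K -> (l \in miss (kswap c i j K) v) = (tperm i j l \in miss c v).
Proof.
move=> vK; rewrite !inE; apply: eq_forallb => u; rewrite /kswap vK.
case: (c v u) => //= a; congr (~~ _); apply/eqP/eqP => [[<-]|[->]]; rewrite ?tpermK //.
Qed.

Lemma kswap_other c i j K u v l :
  c u v = Some l -> l != i -> l != j -> kswap c i j K u v = Some l.
Proof.
move=> h li lj; rewrite /kswap h /=; case: ifP => // _.
by rewrite tpermD // eq_sym.
Qed.

Lemma miss_kswap_other c i j K v l :
  l \in miss c v -> l != i -> l != j -> l \in miss (kswap c i j K) v.
Proof.
move=> h li lj; have [vK|vK] := boolP (v \in K); last by rewrite miss_kswap_out.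
by rewrite miss_kswap_in // tpermD // eq_sym.
Qed.

Definition kr c i j u v := (c u v == Some i) || (c u v == Some j).

Definition kcomp c i j x : {set T} := [set v | connect (kr c i j) x v].

Lemma kcomp_closed c i j x : pcoloring c -> kclosed c i j (kcomp c i j x).
Proof.
move=> pc u v h; rewrite !inE; apply: same_connect_r; last exact: connect1.
by apply: sym_connect_sym => a b; rewrite /kr (pcol_sym pc).
Qed.

Lemma kcompC c i j x : kcomp c i j x = kcomp c j i x.
Proof.
by apply/setP => v; rewrite !inE; apply: eq_connect => a b; rewrite /kr orbC.
Qed.

Section Ends.
Variables (c : T -> T -> option 'I_k) (i j : 'I_k).
Hypotheses (pc : pcoloring c) (eirr : irreflexive e).

(** The default [v] makes [nb l] a total involution, and makes the walk below stationary where its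
    next color is missing. *)
Let nb l v := odflt v [pick u | c v u == Some l].

Local Lemma nbE l u v : c u v = Some l -> nb l u = v.
Proof.
move=> h; rewrite /nb; case: pickP => [w /eqP h2 /=|/(_ v)].
  exact: (pcol_proper pc h2 h).
by rewrite h eqxx.
Qed.

Local Lemma nbK l v : nb l (nb l v) = v.
Proof.
rewrite {2}/nb; case: pickP => [w /eqP h /=|h /=].
  by apply: nbE; rewrite (pcol_sym pc).
by rewrite /nb; case: pickP => // w; rewrite h.
Qed.

Local Lemma nb_miss l v : l \in miss c v -> nb l v = v.
Proof. by move/missP => h; rewrite /nb; case: pickP => // w /eqP /h. Qed.

(** The walk leaves [x] along [j], because [i] will be assumed missing at [x]. *)
Let cl n := if odd n then i else j.
Let walk x := fix w n := if n is n'.+1 then nb (cl n') (w n') else x.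

Local Lemma walk_back x n : nb (cl n) (walk x n.+1) = walk x n.
Proof. by rewrite /= nbK. Qed.

(** The walk from [x] alternating between the two colors exhausts the component before it first
    becomes stationary, and it does so at the other end. If no vertex other than [x] misses one of
    the colors, [t = x] is a dummy. *)
Local Lemma kcomp_two_ends_aux x : i \in miss c x ->
  exists t, forall v, v \in kcomp c i j x ->
    (i \in miss c v) || (j \in miss c v) -> v = x \/ v = t.
Proof.
move=> ix.
have [/existsP[y /and3P[yK yx ym]]|none] := boolP [exists v, [&& v \in kcomp c i j x,
    v != x & (i \in miss c v) || (j \in miss c v)]]; last first.
  exists x => v vK vm; left; apply/eqP; apply/negPn/negP => vx.
  by case/existsP: none; exists v; rewrite vK vx vm.
(* [P] is a set of times closed downwards, and upwards except where the walk is stationary; such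
   times already reach the whole component. *)
have cover (P : nat -> bool) : P 0 -> (forall n, P n.+1 -> P n) ->
   (forall n, P n -> P n.+1 \/ walk x n.+1 = walk x n) ->
   forall v, v \in kcomp c i j x -> exists2 n, P n & v = walk x n.
  move=> P0 Pp PS v; rewrite inE => /connectP[p]; elim/last_ind: p v => [|p w IH] v /=.
    by move=> _ ->; exists 0.
  rewrite rcons_path last_rcons => /andP[pp kw] ->.
  have {IH} [n Pn lp] := IH _ pp erefl; rewrite lp in kw.
  have [l cw lij] : exists2 l, c (walk x n) w = Some l & l = i \/ l = j.
    by case/orP: kw => /eqP h; eexists; eauto.
  have -> : w = nb l (walk x n) by rewrite (nbE cw).
  have [->|lcn] : l = cl n \/ l = cl n.+1 by rewrite /cl /=; case: (odd n); case: lij => ->; auto.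
    case: (PS n Pn) => h; [by exists n.+1|exists n => //; exact: h].
  case: n lcn {lp kw cw} Pn => [|n] lcn Pn.
    by exists 0 => //; rewrite lcn /cl /= nb_miss.
  exists n; first exact: Pp.
  rewrite lcn -[cl n.+2]/(if ~~ ~~ odd n then i else j) negbK.
  by rewrite walk_back.
(* A vertex is entered by one color and left by the other: missing the second stops the walk now,
   missing the first means that it had stopped one step earlier. *)
have stop v n : v = walk x n -> v != x -> (i \in miss c v) || (j \in miss c v) ->
    walk x n.+1 = walk x n \/ exists2 n', n = n'.+1 & walk x n'.+1 = walk x n'.
  move=> vn vx vm.
  have [h|h] : cl n \in miss c v \/ cl n.+1 \in miss c v.
    by rewrite /cl /=; case: (odd n); case/orP: vm; auto.
    by left; rewrite /= nb_miss // -vn.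
  case: n vn h => [|n] vn h; first by rewrite vn eqxx in vx.
  right; exists n => //.
  rewrite -[RHS]walk_back -vn nb_miss //.
  by move: h; rewrite -[cl n.+2]/(if ~~ ~~ odd n then i else j) negbK.
have ex : exists n, walk x n.+1 == walk x n.
  have [||n|n _ yn] := cover predT _ _ _ _ yK => //; first by left.
  by case: (stop _ _ yn yx ym) => [h|[n' _ h]]; eexists; apply/eqP; exact: h.
pose N := ex_minn ex.
have wN : walk x N.+1 = walk x N by rewrite /N; case: ex_minnP => n /eqP.
have minN n : walk x n.+1 = walk x n -> N <= n.
  by move=> h; rewrite /N; case: ex_minnP => n' _; apply; apply/eqP.
exists (walk x N) => v vK vm.
have [vx|vx] := eqVneq v x; [by left|right].
have [||n|n nN vn] := cover (leq^~ N) _ _ _ _ vK => //.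
- by move=> n; exact: ltnW.
- rewrite leq_eqVlt => /orP[/eqP->|]; [by right|by left].
case: (stop _ _ vn vx vm) => [/minN Nn|[n' nn' /minN Nn]].
  by rewrite vn; congr walk; apply/eqP; rewrite eqn_leq nN.
by move: nN Nn; rewrite nn'; lia.
Qed.

End Ends.

(* A Kempe component is a path or a cycle, so it has at most two ends. *)
Lemma kcomp_two_ends c i j x : pcoloring c -> irreflexive e ->
  (i \in miss c x) || (j \in miss c x) ->
  exists t, forall v, v \in kcomp c i j x ->
    (i \in miss c v) || (j \in miss c v) -> v = x \/ v = t.
Proof.
move=> pc ei /orP[h|h]; first exact: kcomp_two_ends_aux.
have [t ht] := kcomp_two_ends_aux i pc h; exists t => v.
by rewrite kcompC orbC; exact: ht.
Qed.

End PartialColoring.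

(** * Fans and Vizing's adjacency lemma *)

Lemma path_sub_mem (T : eqType) (r r' : rel T) x p :
  (forall a b, a \in belast x p -> b \in p -> r a b -> r' a b) ->
  path r x p -> path r' x p.
Proof.
elim: p x => //= z p IH x h /andP[rxz pz]; apply/andP; split.
  by apply: h => //; rewrite inE eqxx.
by apply: IH pz => a b ha hb; apply: h; rewrite inE ?ha ?hb orbT.
Qed.

Section NearColoring.
Variables (T : finType) (e : rel T) (k : nat).
Hypotheses (esym : symmetric e) (eirr : irreflexive e).
Hypothesis uncolorable : forall c : T -> T -> option 'I_k,
  pcoloring e c -> exists u v, e u v /\ c u v = None.
Hypothesis deg_le : forall v, deg e v <= k.
Implicit Types (c : T -> T -> option 'I_k) (u v w x y z : T) (i j : 'I_k).
Implicit Types (K : {set T}).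

Definition near c x y := [/\ pcoloring e c, e x y, c x y = None &
  forall u v, e u v -> c u v = None -> joins x y u v].

Lemma near_sym c x y : near c x y -> near c y x.
Proof.
case=> pc exy cxy h; split=> //; first by rewrite esym.
  by rewrite (pcol_sym pc).
by move=> u v euv /(h u v euv) /joins_pairP[[-> ->]|[-> ->]]; apply/joins_pairP; auto.
Qed.

Lemma near_neq c x y : near c x y -> x != y.
Proof. by case=> _ exy _ _; apply: contraTneq exy => ->; rewrite eirr. Qed.

(** A color missing at both ends of the uncolored edge would complete the coloring. *)
Lemma near_disjoint c x y i : near c x y -> i \in miss c x -> i \notin miss c y.
Proof.
move=> nc; have xy := near_neq nc; case: nc => pc exy cxy h ix; apply/negP => iy.
have eyx : e y x by rewrite esym.
have [u [v [euv]]] := uncolorable (pcol_upd_Some xy exy eyx pc ix iy).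
by rewrite /upd; case: ifP => // + /(h _ _ euv) => ->.
Qed.

Lemma near_kswap c x y i j K : near c x y -> kclosed c i j K -> near (kswap c i j K) x y.
Proof.
case=> pc exy cxy h cl; split=> //; first exact: pcol_kswap.
  by apply/eqP; rewrite kswap_None cxy.
by move=> u v euv /eqP; rewrite kswap_None => /eqP; exact: h.
Qed.

Lemma near_recolor c x y u v i : near c x y -> e u v -> ~~ joins x y u v ->
  i \in miss c u -> i \in miss c v -> near (upd c u v (Some i)) x y.
Proof.
move=> nc euv njn iu iv.
have uv : u != v by apply: contraTneq euv => ->; rewrite eirr.
case: nc => pc exy cxy h; split=> //.
- by apply: pcol_upd_Some => //; rewrite esym.
- rewrite updN //; apply: contra njn => /joins_pairP[[-> ->]|[-> ->]]; apply/joins_pairP; auto.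
- by move=> a b eab; rewrite /upd; case: ifP => // _; exact: h.
Qed.

(** Used when [yz] has color [i]: the uncolored edge rotates around [y] from [xy] to [yz]. *)
Definition shift c x y z i := upd (upd c y z None) x y (Some i).

Lemma near_shift c x y z i : near c x y -> c y z = Some i -> i \in miss c x ->
  near (shift c x y z i) z y.
Proof.
move=> nc cyz ix; have xy := near_neq nc; case: nc => pc exy cxy h.
have eyz : e y z by apply: (pcol_edge pc); rewrite cyz.
have zx : z != x by apply/eqP => zx; move: cyz; rewrite zx (pcol_sym pc) cxy.
have zy : z != y by apply: contraTneq eyz => ->; rewrite eirr.
split.
- apply: pcol_upd_Some => //; first by rewrite esym.
  + exact: pcol_upd_None.
  + exact: miss_upd_None.
  + apply/missP => u; rewrite /upd; case: ifP => // jn cyu.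
    by move: jn; rewrite (pcol_proper pc cyu cyz) /joins !eqxx.
- by rewrite esym.
- rewrite /shift updN; last by rewrite /joins negb_or !negb_and zx zy.
  by rewrite /upd /joins !eqxx orbT.
- move=> u v euv; rewrite /shift /upd; case: ifP => // nj1; case: ifP => [|_].
    by move=> /joins_pairP[[-> ->]|[-> ->]] _; apply/joins_pairP; auto.
  by move=> /(h _ _ euv); rewrite nj1.
Qed.

Lemma card_miss c v : pcoloring e c -> #|miss c v| = k - #|[set u | c v u != None]|.
Proof.
move=> pc; have ck := cardsC (miss c v); rewrite card_ord in ck.
suff -> : #|[set u | c v u != None]| = #|~: miss c v| by rewrite -[X in _ = X - _]ck addnK.
rewrite -(card_in_imset (f := c v)); last first.
  move=> u w; rewrite !inE; case cu: (c v u) => [i|] // _ _ cw.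
  by apply: (pcol_proper pc cu); rewrite -cw.
rewrite -[RHS](card_imset _ Some_inj); apply: eq_card => o.
apply/imsetP/imsetP => [[u]|[i]]; rewrite inE.
  case cu: (c v u) => [i|] // _ ->; exists i => //.
  by rewrite inE; apply/missPn; exists u.
by move=> /missPn[u cu] ->; exists u; rewrite ?inE cu.
Qed.

Lemma near_card_miss c x y v : near c x y -> v != x -> v != y ->
  #|miss c v| = k - deg e v.
Proof.
move=> [pc _ _ h] vx vy; rewrite card_miss //; congr (k - _); apply: eq_card => u.
rewrite !inE; apply/idP/idP => [/(pcol_edge pc) //|evu].
by apply/eqP => /(h _ _ evu) /joins_pairP[] [/eqP] ; rewrite ?(negbTE vx) ?(negbTE vy).
Qed.

Lemma near_card_miss_end c x y : near c x y -> #|miss c x| = (k - deg e x).+1.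
Proof.
move=> nc; have [pc exy cxy h] := nc.
have xy := near_neq nc.
rewrite card_miss // /deg (cardsD1 y [set u | e x u]) inE exy.
have -> : [set u | c x u != None] = [set u | e x u] :\ y.
  apply/setP => u; rewrite !inE; apply/idP/andP => [cu|[uy exu]].
    by split; [apply: contraNneq cu => ->; rewrite cxy|exact: pcol_edge cu].
  apply/eqP => /(h _ _ exu) /joins_pairP[[_ /eqP]|[/eqP]]; first by rewrite (negbTE uy).
  by rewrite (negbTE xy).
have := deg_le x; rewrite /deg (cardsD1 y [set u | e x u]) inE exy.
lia.
Qed.

Lemma near_miss_end c x y : near c x y -> exists i, i \in miss c x.
Proof. by move=> /near_card_miss_end h; apply/set0Pn; rewrite -card_gt0 h. Qed.

(** With [y] as center, a [fan_step] path from [x] is a Vizing fan, and the fan vertices are those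
    connected to [x]. *)
Definition fan_step c y z w := if c y w is Some i then i \in miss c z else false.

Lemma fan_stepP c y z w : fan_step c y z w -> exists2 i, c y w = Some i & i \in miss c z.
Proof. by rewrite /fan_step; case: (c y w) => // i h; exists i. Qed.

Lemma fan_path_neq c x y p : pcoloring e c -> path (fan_step c y) x p -> y \notin p.
Proof.
move=> pc; elim: p x => //= z p IH x /andP[/fan_stepP[i cyz _] /IH h].
rewrite inE negb_or h andbT; apply/eqP => yz.
have : e y z by apply: (pcol_edge pc); rewrite cyz.
by rewrite yz eirr.
Qed.

(** Shifting along the first edge leaves a shorter fan at the uncolored edge [zy]; as the fan
    vertices are distinct, the later steps and missing colors are intact. The empty fan is
    [near_disjoint]. *)
Lemma fan_center_disjoint c x y p i : near c x y -> path (fan_step c y) x p ->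
  uniq (x :: p) -> i \in miss c (last x p) -> i \notin miss c y.
Proof.
elim: p c x => [|z p IH] c x nc; first by move=> _ _; exact: near_disjoint.
move=> pth; have [pc _ _ _] := nc; have yp := fan_path_neq pc pth.
case/andP: pth => /fan_stepP[l cyz lx] pth /andP[xzp uzp] il.
apply/negP => iy.
have ns := near_shift nc cyz lx.
have nx a : a \in z :: p -> a != x by apply: contraTneq => ->.
have ny a : a \in z :: p -> a != y by apply: contraTneq => ->.
have sub a j : a \in z :: p -> j \in miss c a -> j \in miss (shift c x y z l) a.
  move=> ap ja; rewrite miss_upd_other ?nx ?ny //; exact: miss_upd_None.
suff : i \notin miss (shift c x y z l) y.
  case/negP; apply/missP => u; rewrite /shift /upd; case: ifP => _.
    by move=> [li]; move/missP: iy => /(_ z); rewrite cyz li.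
  by case: ifP => // _; move/missP: iy; apply.
apply: (IH _ z) => //; last by apply: sub; rewrite ?mem_last.
apply: path_sub_mem pth => a b ha hb /fan_stepP[j cyb ja].
have bz : b != z by apply: contraTneq hb => ->; case/andP: uzp.
have bx : b != x by apply: nx; rewrite inE hb orbT.
have by_ : b != y by apply: ny; rewrite inE hb orbT.
rewrite /fan_step /shift /upd /joins (negbTE bz) (negbTE bx) (negbTE by_) !andbF /= cyb.
by apply: sub => //; apply: mem_belast.
Qed.

(** Swapping [i] and [j] on [K] would make [j] missing both at the center and at the last fan
    vertex. The swap can break the fan only at an earlier vertex of [K] missing [i]; the fan is then
    cut at that vertex and the induction applies. *)
Lemma fan_kempe_aux c x y p i j K : near c x y -> kclosed c i j K -> y \notin K ->
  path (fan_step c y) x p -> uniq (x :: p) -> last x p \in K ->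
  i \in miss c (last x p) -> j \notin miss c y.
Proof.
have [n] := ubnP (size p); elim: n p => // n IH p pn nc cl yK pth up lK il.
apply/negP => jy.
have [/hasP[a ap /and3P[al aK ia]]|none] := boolP (has (fun a => [&& a != last x p, a \in K
    & i \in miss c a]) (x :: p)).
  case/splitPl: ap al pn pth up {lK il} => p1 p2 la.
  rewrite last_cat la size_cat cat_path -cat_cons cat_uniq => al pn /andP[pth _] /andP[up _].
  have : 0 < size p2 by case: p2 al {pn} => //=; rewrite eqxx.
  move=> p2n; suff : j \notin miss c y by rewrite jy.
  apply: (IH p1) => //; rewrite ?la //.
  by apply: leq_trans (_ : size p1 + size p2 <= n) => //; rewrite -addn1 leq_add2l.
have nk := near_kswap nc cl.
have ly : i \in miss c (last x p) by [].
suff : j \notin miss (kswap c i j K) y by rewrite miss_kswap_out // jy.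
apply: (fan_center_disjoint (p := p) nk) => //; last first.
  by rewrite miss_kswap_in // tpermR.
apply: path_sub_mem pth => a b ha hb /fan_stepP[l cyb la].
rewrite /fan_step /kswap (negbTE yK) cyb.
have lj : l != j by apply: contraTneq jy => <-; apply/missPn; exists b.
have [aK|aK] := boolP (a \in K); last by rewrite miss_kswap_out.
apply: miss_kswap_other => //; apply: contraNneq none => li.
apply/hasP; exists a; first exact: mem_belast.
rewrite aK -li la !andbT; apply: contraTneq ha => ->.
by move: up; rewrite lastI rcons_uniq => /andP[].
Qed.

Lemma fan_kempe c x y p i j : near c x y -> path (fan_step c y) x p -> uniq (x :: p) ->
  i \in miss c (last x p) -> j \in miss c y -> y \in kcomp c i j (last x p).
Proof.
move=> nc pth up il jy; apply: contraTT jy => yK.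
have [pc _ _ _] := nc.
by apply: (fan_kempe_aux nc (kcomp_closed _ pc) yK pth up _ il); rewrite inE.
Qed.

Lemma near_kempe c x y i j : near c x y -> i \in miss c x -> j \in miss c y ->
  y \in kcomp c i j x.
Proof. by move=> nc; apply: (fan_kempe (p := [::])). Qed.

Lemma kcomp_sym c i j x y : pcoloring e c -> (x \in kcomp c i j y) = (y \in kcomp c i j x).
Proof.
by move=> pc; rewrite !inE; apply: sym_connect_sym => a b; rewrite /kr (pcol_sym pc).
Qed.

(** For a color [j] missing at [y], both vertices lie in the component of [y] in the colors [i] and
    [j], which has only one end besides [y]. *)
Lemma fan_disjoint c x y z1 z2 i : near c x y ->
  connect (fan_step c y) x z1 -> connect (fan_step c y) x z2 ->
  i \in miss c z1 -> i \in miss c z2 -> z1 = z2.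
Proof.
move=> nc /connectP[p1 q1 ->] /connectP[p2 q2 ->].
case/shortenP: q1 => {}p1 q1 u1 _; case/shortenP: q2 => {}p2 q2 u2 _ i1 i2.
have [pc _ _ _] := nc.
have [j jy] := near_miss_end (near_sym nc).
have k1 := fan_kempe nc q1 u1 i1 jy; have k2 := fan_kempe nc q2 u2 i2 jy.
have iy := fan_center_disjoint nc q1 u1 i1.
have jy' : (i \in miss c y) || (j \in miss c y) by rewrite jy orbT.
have [t ht] := kcomp_two_ends pc eirr jy'.
rewrite kcomp_sym // in k1; rewrite kcomp_sym // in k2.
case: (ht _ k1) => [|h1|->]; first by rewrite i1.
  by move: i1; rewrite h1 (negbTE iy).
case: (ht _ k2) => [|h2|->] //; first by rewrite i2.
by move: i2; rewrite h2 (negbTE iy).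
Qed.

(* Vizing's adjacency lemma: the colors missing in the fan at [y] are pairwise
   distinct and each of them labels an edge of the fan. *)
Lemma vizing_adjacency c x y : near c x y ->
  k.+1 <= deg e x + #|[set z | [&& e y z, deg e z == k & z != x]]|.
Proof.
move=> nc; have [pc exy cxy h] := nc.
pose F := [set z | connect (fan_step c y) x z].
have xF : x \in F by rewrite inE.
have Fedge z : z \in F :\ x -> e y z.
  rewrite !inE => /andP[zx /connectP[p pth lz]].
  case/lastP: p pth lz => [_ /eqP|p w]; first by rewrite (negbTE zx).
  rewrite rcons_path last_rcons => /andP[_ /fan_stepP[i cyw _]] ->.
  by apply: (pcol_edge pc); rewrite cyw.
have sumle : \sum_(z in F) #|miss c z| <= #|F :\ x|.
  pose I := [set i : 'I_k | Some i \in c y @: (F :\ x)].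
  apply: (@leq_trans #|I|); last first.
    rewrite -[leqLHS](card_imset _ Some_inj).
    apply: leq_trans (leq_imset_card (c y) _); apply: subset_leq_card.
    by apply/subsetP => o /imsetP[i]; rewrite inE => hi ->.
  under eq_bigr do rewrite -sum1_card.
  rewrite (exchange_big_dep predT) //= -sum1_card [leqRHS]big_mkcond.
  apply: leq_sum => i _; rewrite sum1_card.
  case: ifP => iI.
    rewrite leqNgt; apply/negP => /card_gt1P[z1 [z2 []]].
    move=> /andP[f1 m1] /andP[f2 m2] /eqP; apply; move: f1 f2; rewrite !inE => f1 f2.
    exact: (fan_disjoint nc f1 f2 (i := i)).
  rewrite leqn0; apply/eqP; apply: eq_card0 => z.
  apply: contraFF iI => /andP[fz iz]; rewrite inE in fz; rewrite inE.
  have : i \notin miss c y.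
    case/connectP: fz iz => p pth -> iz; case/shortenP: pth iz => p' pth' u' _ iz.
    exact: (fan_center_disjoint nc pth' u').
  case/missPn => w cyw; apply/imsetP; exists w => //; rewrite !inE; apply/andP; split.
    by apply/eqP => wx; move: cyw; rewrite wx (pcol_sym pc) cxy.
  by apply: connect_trans fz (connect1 _); rewrite /fan_step cyw.
have xFx := near_card_miss_end nc.
rewrite (big_setD1 x) //= xFx in sumle.
pose D := [set z | deg e z == k].
(* A fan vertex of degree less than [k] misses some color. Since [x] alone misses [k - deg e x + 1]
   colors, at least that many vertices of [F :\ x] must have degree [k]. *)
have h1 : #|(F :\ x) :\: D| <= \sum_(z in F :\ x) #|miss c z|.
  rewrite -sum1_card [leqLHS]big_mkcond [leqRHS]big_mkcond; apply: leq_sum => z _.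
  case: ifP => //; rewrite inE => /andP[zD zF]; rewrite zF.
  have zx : z != x by move: zF; rewrite !inE => /andP[].
  have zy : z != y by apply: contraTneq (Fedge _ zF) => ->; rewrite eirr.
  rewrite (near_card_miss nc zx zy); move: zD; rewrite inE => zD.
  by rewrite subn_gt0 ltn_neqAle zD deg_le.
have h2 : #|(F :\ x) :&: D| <= #|[set z | [&& e y z, deg e z == k & z != x]]|.
  apply: subset_leq_card; apply/subsetP => z /setIP[zF zD].
  rewrite inE (Fedge _ zF); move: zF zD; rewrite !inE => /andP[-> _] -> //.
move: h1 h2 sumle (cardsID D (F :\ x)) (deg_le x).
move: (\sum_(z in _) _) #|_ :&: _| #|_ :\: _| #|F :\ x| #|finset _| (deg e x).
lia.
Qed.

End NearColoring.

(** * Vertices of small degree *)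

Section SmallVertices.
Variables (T : finType) (e : rel T) (k : nat).
Hypotheses (esym : symmetric e) (eirr : irreflexive e).
Hypothesis uncolorable : forall c : T -> T -> option 'I_k,
  pcoloring e c -> exists u v, e u v /\ c u v = None.
Hypothesis deg_le : forall v, deg e v <= k.
Hypothesis nearP : forall x y, e x y -> exists c : T -> T -> option 'I_k, near e c x y.
Variable S : {set T}.
Hypothesis small : forall u w, u \in S -> w \in S -> deg e u + deg e w + 2 <= k.
Implicit Types (c : T -> T -> option 'I_k) (u v w x y z : T) (a b i j : 'I_k).

Lemma near_card_miss_ge c x y v : near e c x y -> k - deg e v <= #|miss c v|.
Proof.
move=> nc; have [->|vx] := eqVneq v x; first by rewrite (near_card_miss_end eirr deg_le nc).
have [->|vy] := eqVneq v y; last by rewrite (near_card_miss nc).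
by rewrite (near_card_miss_end eirr deg_le (near_sym esym nc)).
Qed.

(** The two sets of missing colors have total size at least [k + 2], so they meet in two colors, one
    of which is not [b]. *)
Lemma small_share c x y u w b : near e c x y -> u \in S -> w \in S ->
  exists i, [/\ i \in miss c u, i \in miss c w & i != b].
Proof.
move=> nc uS wS; have := small uS wS.
have := near_card_miss_ge u nc; have := near_card_miss_ge w nc.
have := cardsUI (miss c u) (miss c w); have := max_card (miss c u :|: miss c w).
rewrite card_ord => h1 h2 h3 h4 h5.
have : 1 < #|miss c u :&: miss c w|.
  move: h1 h2 h3 h4 h5; move: #|_ :|: _| #|_ :&: _| #|miss c u| #|miss c w| (deg e u) (deg e w).
  lia.
case/card_gt1P => i [i' [/setIP[iu iw] /setIP[iu' iw'] ii']].
have [ib|ib] := eqVneq i b; last by exists i.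
by exists i'; split=> //; rewrite -ib eq_sym.
Qed.

(** An edge between two such vertices could be the uncolored one, and its ends would share a missing
    color. *)
Lemma small_indep u w : u \in S -> w \in S -> ~~ e u w.
Proof.
move=> uS wS; apply/negP => /nearP[c nc].
have [b _] := near_miss_end eirr deg_le nc.
have [i [iu iw _]] := small_share b nc uS wS.
by have := near_disjoint esym eirr uncolorable nc iu; rewrite iw.
Qed.

(** The component of [s] in the colors [i] and [j] is a path from [s] to [y], so it has no room for
    a third end [u]. *)
Lemma kcomp_avoid c s y u i j : near e c s y -> i \in miss c s -> j \in miss c y ->
  i \in miss c u -> u != s -> u != y -> s \notin kcomp c i j u /\ y \notin kcomp c i j u.
Proof.
move=> nc is_ jy iu us uy; have [pc _ _ _] := nc.
have ys := near_kempe esym eirr uncolorable nc is_ jy.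
have sK : s \notin kcomp c i j u.
  apply/negP; rewrite (kcomp_sym _ _ _ _ pc) => uK.
  have is' : (i \in miss c s) || (j \in miss c s) by rewrite is_.
  have [t ht] := kcomp_two_ends pc eirr is'.
  case: (ht _ uK) => [|h|h]; first by rewrite iu.
    by rewrite h eqxx in us.
  case: (ht _ ys) => [|h'|h']; first by rewrite jy orbT.
    by have := near_neq eirr nc; rewrite h' eqxx.
  by rewrite h h' eqxx in uy.
split=> //; apply: contra sK; rewrite !inE => uy'.
apply: connect_trans uy' _; move: ys; rewrite -(kcomp_sym _ _ _ _ pc) inE //.
Qed.

Section Config.
Variables (s y z w : T).
Hypotheses (sS : s \in S) (yS : y \notin S) (wS : w \in S) (ws : w != s).

(* In each of the following configurations [s z w] is a path with color [a] on
   [sz] and [b] on [zw]; Kempe changes turn them into the first one, where shifting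
   [sz] makes [w] a fan vertex sharing a missing color with [s]. *)
Lemma config_miss_miss c a b : near e c s y -> c s z = Some a -> c z w = Some b ->
  a \in miss c y -> b \in miss c s -> False.
Proof.
move=> nc csz czw ay bs; have [pc exy cxy h] := nc.
have zs : z != s.
  by apply: contraPneq csz => ->; move=> hh; have := pcol_edge pc (u := s) (v := s); rewrite hh eirr => /(_ isT).
have zy : z != y by apply: contraPneq csz => ->; rewrite cxy.
have ab : b != a by apply: contraTneq bs => ->; apply/missPn; exists z.
have ns := near_shift esym eirr (near_sym esym nc) csz ay.
set c' := shift c y s z a in ns.
have c'zw : c' z w = Some b.
  rewrite /c' /shift updN; last by rewrite /joins negb_or !negb_and zy zs.
  by rewrite updN // /joins negb_or !negb_and zs ws orbT.
have bs' : b \in miss c' s by apply: miss_upd_Some => //; apply: miss_upd_None.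
have [i [i1 i2 _]] := small_share b ns sS wS.
have := fan_disjoint esym eirr uncolorable deg_le (near_sym esym ns) (z1 := s) (z2 := w) _ _ i1 i2.
move=> /(_ (connect0 _ _)) hh; have : s = w.
  by apply: hh; apply: connect1; rewrite /fan_step c'zw.
by move=> sw; move: ws; rewrite sw eqxx.
Qed.

(** On the component of [w], [b] is exchanged with a color missing at both [s] and [w]. The edge
    [zw] thereby gets a color missing at [s], and nothing changes at [s] and [y], which lie outside
    the component. *)
Lemma swap_w c b : near e c s y -> c z w = Some b -> b \in miss c y ->
  exists c' i, [/\ near e c' s y, (forall v, c' s v = c s v), (forall v, c' y v = c y v),
    c' z w = Some i & i \in miss c' s].
Proof.
move=> nc czw by_; have [pc _ _ _] := nc.
have [i [is_ iw ib]] := small_share b nc sS wS.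
have wy : w != y by apply: contraTneq wS => ->.
have [sK yK] := kcomp_avoid nc is_ by_ iw ws wy.
exists (kswap c i b (kcomp c i b w)), i; split.
- exact: near_kswap nc (kcomp_closed _ pc).
- by move=> v; rewrite /kswap (negbTE sK).
- by move=> v; rewrite /kswap (negbTE yK).
- have wK : w \in kcomp c i b w by rewrite inE.
  rewrite /kswap -(kcomp_closed _ pc (u := w)) ?wK ?czw /= ?tpermR //.
  by rewrite (pcol_sym pc) czw eqxx orbT.
- by rewrite miss_kswap_out.
Qed.

(** A Kempe change away from [s] and [y] makes [j] missing at [u] too; recoloring [yu] with [j] then
    frees [i] at [y]. The auxiliary color is chosen different from [b] so that [zw] keeps its
    color. *)
Lemma free_u c u i j b : near e c s y -> u \in S -> u != s -> c y u = Some i ->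
  j \in miss c y -> c s z = Some i \/ c s z = Some j -> c z w = Some b -> b != j ->
  exists c', [/\ near e c' s y, i \in miss c' y, c' y u = Some j, c' s z = c s z &
    [/\ c' z w = Some b, miss c' s = miss c s & forall v, v != u -> c' y v = c y v]].
Proof.
move=> nc uS us cyu jy csz czw bj; have [pc _ csy hc] := nc.
have [l [ls lu lb]] := small_share b nc sS uS.
have uy : u != y by apply: contraTneq uS => ->.
have [sK yK] := kcomp_avoid nc ls jy lu us uy.
have ij : i != j by apply: contraTneq jy => <-; apply/missPn; exists u.
have il : i != l by apply: contraTneq lu => <-; apply/missPn; exists y; rewrite (pcol_sym pc).
have nk := near_kswap nc (kcomp_closed u pc (i := l) (j := j)).
set c1 := kswap c l j (kcomp c l j u) in nk.
have [pc1 _ _ _] := nk.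
have eyu : e y u by apply: (pcol_edge pc); rewrite cyu.
have ju : j \in miss c1 u by rewrite miss_kswap_in ?tpermR // inE.
have jy1 : j \in miss c1 y by rewrite miss_kswap_out.
have zs : z != s.
  case: csz => csz; apply: contraPneq csz => -> hh;
    by have := pcol_edge pc (u := s) (v := s); rewrite hh eirr => /(_ isT).
have zy : z != y by case: csz => csz; apply: contraPneq csz => ->; rewrite csy.
have wy : w != y by apply: contraTneq wS => ->.
have sy := near_neq eirr nc.
exists (upd c1 y u (Some j)); split.
- by apply: near_recolor => //; rewrite /joins negb_or !negb_and us uy !orbT.
- apply/missP => v; rewrite /upd; case: ifP => [_ [ji]|njn]; first by rewrite ji eqxx in ij.
  rewrite /c1 /kswap (negbTE yK) => cyv.
  by move: njn; rewrite (pcol_proper pc cyv cyu) /joins !eqxx.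
- exact: updE.
- rewrite updN; first by rewrite /c1 /kswap (negbTE sK).
  by rewrite /joins negb_or !negb_and sy (eq_sym s u) us.
- split.
  + rewrite updN; last by rewrite /joins negb_or !negb_and zy wy orbT.
    by apply: kswap_other => //; rewrite eq_sym.
  + by rewrite miss_upd_other ?miss_kswap_out // eq_sym.
  + move=> v vu; rewrite updN; first by rewrite /c1 /kswap (negbTE yK).
    by rewrite /joins negb_or !negb_and vu orbT /= (eq_sym y u) uy.
Qed.

Lemma config_edge_miss c a b u : near e c s y -> c s z = Some a -> c z w = Some b ->
  u \in S -> u != s -> c y u = Some a -> b \in miss c s -> False.
Proof.
move=> nc csz czw uS us cyu bs.
have [j jy] := near_miss_end eirr deg_le (near_sym esym nc).
have bj : b != j.
  by apply: contraTneq jy => <-; apply: near_disjoint bs.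
have [c' [nc' ay' _ csz' [czw' ms' _]]] := free_u nc uS us cyu jy (or_introl csz) czw bj.
by apply: (config_miss_miss nc' _ czw' ay'); rewrite ?csz' ?ms'.
Qed.

Lemma config_edge_center c a b u : near e c s y -> c s z = Some a -> c z w = Some b ->
  u \in S -> u != s -> c y u = Some a -> b \in miss c y -> False.
Proof.
move=> nc csz czw uS us cyu by_.
have [c' [i [nc' hs hy czw' is']]] := swap_w nc czw by_.
by apply: (config_edge_miss nc' _ czw' uS us _ is'); rewrite ?hs ?hy; eassumption.
Qed.

(** Freeing [u] trades the colors: [b] becomes missing at [y] and [a] moves to [yu]. *)
Lemma config_miss_edge c a b u : near e c s y -> c s z = Some a -> c z w = Some b ->
  u \in S -> u != s -> a \in miss c y -> c y u = Some b -> False.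
Proof.
move=> nc csz czw uS us ay cyu; have [pc _ _ _] := nc.
have ba : b != a by apply: contraTneq ay => <-; apply/missPn; exists u.
have [c' [nc' ay' cyu' csz' [czw' _ _]]] := free_u nc uS us cyu ay (or_intror csz) czw ba.
by apply: (config_edge_center nc' _ czw' uS us cyu' ay'); rewrite csz'.
Qed.

Lemma config_edge_edge c a b u u' : near e c s y -> c s z = Some a -> c z w = Some b ->
  u \in S -> u != s -> u' \in S -> u' != s -> c y u = Some a -> c y u' = Some b -> False.
Proof.
move=> nc csz czw uS us u'S us' cyu cyu'; have [pc _ _ _] := nc.
have [j jy] := near_miss_end eirr deg_le (near_sym esym nc).
have bj : b != j by apply: contraTneq jy => <-; apply/missPn; exists u'.
have [c' [nc' ay' cyu2 csz' [czw' ms' hy]]] := free_u nc uS us cyu jy (or_introl csz) czw bj.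
have uu' : u' != u.
  apply: contraPneq cyu' => ->; rewrite cyu => -[ab].
  have := pcol_proper pc (u := z) (v := w) (w := s) (i := b) czw.
  by rewrite (pcol_sym pc) csz ab => /(_ erefl) /eqP; rewrite (negbTE ws).
by apply: (config_miss_edge nc' _ czw' u'S us' ay'); rewrite ?csz' ?hy.
Qed.

Lemma config_center_center c a b : near e c s y -> c s z = Some a -> c z w = Some b ->
  a \in miss c y -> b \in miss c y -> False.
Proof.
move=> nc csz czw ay by_.
have [c' [i [nc' hs hy czw' is']]] := swap_w nc czw by_.
apply: (config_miss_miss nc' _ czw' _ is'); first by rewrite hs; exact: csz.
by apply/missP => v; rewrite hy; move/missP: ay.
Qed.

End Config.

Definition small_nb v := [set w in S | e v w].

(* A variant of Woodall's strengthening of Vizing's adjacency lemma. *)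
Lemma small_nb_tradeoff s y : s \in S -> e s y ->
  exists2 Z : {set T}, Z \subset [set z | e s z] & #|small_nb y| <= #|Z| /\
    forall z, z \in Z -> #|small_nb z| + #|small_nb y| <= deg e s.
Proof.
move=> sS esy; have [c nc] := nearP esy; have [pc _ csy hc] := nc.
have yS : y \notin S by apply: contraTN esy => /(small_indep sS).
have sy := near_neq eirr nc.
have [b0 _] := near_miss_end eirr deg_le nc.
pose A := small_nb y :\ s.
pose E := [set i | Some i \in c y @: A].
pose K := miss c y :|: E.
pose Z := [set z | [exists i in K, c s z == Some i]].
have EP i : i \in E -> exists2 u, (u \in S) && (u != s) & c y u = Some i.
  by rewrite inE => /imsetP[u]; rewrite !inE => /and3P[us uS _] ->; exists u; rewrite ?us ?uS.
(* A vertex of [S] joined to [y] by a color missing at [s] would be a fan vertex sharing a missing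
   color with [s]. *)
have EN i : i \in E -> i \notin miss c s.
  move=> /EP[u /andP[uS us] cyu]; apply/negP => is_.
  have [l [l1 l2 _]] := small_share b0 nc sS uS.
  have hfan : connect (fan_step c y) s u by apply: connect1; rewrite /fan_step cyu.
  have := fan_disjoint esym eirr uncolorable deg_le nc (connect0 _ _) hfan l1 l2.
  by move=> su; rewrite su eqxx in us.
have KN i : i \in K -> i \notin miss c s.
  case/setUP => [iy|/EN //]; apply: contraL iy => iS.
  exact: near_disjoint nc iS.
have cA : #|E| = #|A|.
  rewrite -(card_in_imset (f := c y) (D := A)); last first.
    move=> u v; rewrite !inE => /and3P[us uS eyu] /and3P[vs vS eyv] cuv.
    case cu: (c y u) => [i|]; first by apply: (pcol_proper pc cu); rewrite -cuv.
    case/joins_pairP: (hc _ _ eyu cu) => [[ys _]|[_ us']]; first by rewrite ys eqxx in sy.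
    by rewrite us' eqxx in us.
  rewrite -[LHS](card_imset _ Some_inj); apply: eq_card => o.
  apply/imsetP/imsetP => [[i]|[u uA ->]]; first by rewrite inE => /imsetP[u uA ->] ->; exists u.
  move: (uA); rewrite !inE => /and3P[us uS eyu].
  case cu: (c y u) => [i|]; first by exists i => //; rewrite inE -cu; apply: imset_f.
  case/joins_pairP: (hc _ _ eyu cu) => [[ys _]|[_ us']]; first by rewrite ys eqxx in sy.
  by rewrite us' eqxx in us.
have sA : s \in small_nb y by rewrite inE sS esym.
(* The uncolored edge [ys] is not represented in [E]; a color missing at [y] makes up for it. *)
have cK : #|small_nb y| <= #|K|.
  rewrite (cardsD1 s) sA -/A -cA /K cardsU.
  have -> : miss c y :&: E = set0.
    apply/setP => i; rewrite in_set0 in_setI; apply/negP => /andP[iy /EP[u _ cyu]].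
    by move/missP: iy => /(_ u).
  rewrite cards0 subn0 leq_add2r card_gt0; apply/set0Pn.
  by have [j jy] := near_miss_end eirr deg_le (near_sym esym nc); exists j.
exists Z; last split.
- apply/subsetP => z; rewrite !inE => /existsP[i /andP[_ /eqP csz]].
  by apply: (pcol_edge pc); rewrite csz.
- apply: leq_trans cK _; rewrite -(card_imset _ Some_inj).
  apply: leq_trans (leq_imset_card (c s) _); apply: subset_leq_card.
  apply/subsetP => o /imsetP[i iK ->]; have /missPn[z csz] := KN _ iK.
  by rewrite -csz; apply: imset_f; rewrite inE; apply/existsP; exists i; rewrite iK csz eqxx.
move=> z; rewrite inE => /existsP[a /andP[aK /eqP csz]].
have esz : e s z by apply: (pcol_edge pc); rewrite csz.
have zy : z != y by apply: contraPneq csz => ->; rewrite csy.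
have zs : z != s by apply: contraTneq esz => ->; rewrite eirr.
have sZ : s \in small_nb z by rewrite inE sS esym.
(* The edges from [z] to [S] other than [zs] avoid the colors of [miss c s] and of [K], which leaves
   [deg e s - 1 - #|K|] colors. *)
have cz : #|small_nb z :\ s| <= #|~: (miss c s :|: K)|.
  rewrite -(card_imset (~: _) Some_inj) -(card_in_imset (f := c z) (D := small_nb z :\ s)).
    apply: subset_leq_card; apply/subsetP => o /imsetP[w]; rewrite !inE => /and3P[ws wS ezw] ->.
    case czw: (c z w) => [b|]; last first.
      by case/joins_pairP: (hc _ _ ezw czw) => [[/eqP]|[/eqP]]; rewrite ?(negbTE zs) ?(negbTE zy).
    (* A color of [K] is either missing at [y] or on an edge from [y] to [S]. With two places for
       [a] and three for [b], the six configurations cover all cases. *)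
    apply: imset_f; rewrite in_setC; apply/negP => /setUP[bs|/setUP[by_|/EP[u' /andP[u'S us'] cyu']]].
    + case/setUP: aK => [ay|/EP[u /andP[uS us] cyu]].
        exact: (config_miss_miss sS wS ws nc csz czw).
      exact: (config_edge_miss sS yS wS ws nc csz czw uS us).
    + case/setUP: aK => [ay|/EP[u /andP[uS us] cyu]].
        exact: (config_center_center sS yS wS ws nc csz czw).
      exact: (config_edge_center sS yS wS ws nc csz czw uS us).
    + case/setUP: aK => [ay|/EP[u /andP[uS us] cyu]].
        exact: (config_miss_edge sS yS wS ws nc csz czw u'S us').
      exact: (config_edge_edge sS yS wS ws nc csz czw uS us u'S us').
  move=> u v; rewrite !inE => /and3P[us uS ezu] /and3P[vs vS ezv] cuv.
  case cu: (c z u) => [i|]; first by apply: (pcol_proper pc cu); rewrite -cuv.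
  by case/joins_pairP: (hc _ _ ezu cu) => [[/eqP]|[/eqP]]; rewrite ?(negbTE zs) ?(negbTE zy).
have dis : miss c s :&: K = set0.
  by apply/setP => i; rewrite in_set0 in_setI; apply/negP => /andP[is_ /KN]; rewrite is_.
have h1 := cardsC (miss c s :|: K); rewrite cardsU dis cards0 subn0 card_ord in h1.
have h2 := near_card_miss_end eirr deg_le nc.
have h3 := deg_le s.
rewrite (cardsD1 s (small_nb z)) sZ.
move: cK cz h1 h2 h3; rewrite add1n.
move: #|small_nb y| #|K| #|small_nb z :\ s| #|~: _| #|miss c s| (deg e s).
lia.
Qed.

End SmallVertices.

Import Order.TTheory GRing.Theory Num.Theory.

(** * Edge-critical graphs, and expansion of the vertices of small degree *)

Section Critical.
Variables (T : finType) (e : rel T).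
Hypotheses (esym : symmetric e) (eirr : irreflexive e) (crit : edge_critical e).
Notation Dl := (max_deg e).

Lemma deg_le_max v : deg e v <= Dl.
Proof. exact: leq_bigmax. Qed.

Lemma critical_uncolorable (c : T -> T -> option 'I_Dl) :
  pcoloring e c -> exists u v, e u v /\ c u v = None.
Proof.
move=> pc; have [/existsP[u /existsP[v /andP[euv /eqP cuv]]]|none] :=
  boolP [exists u, exists v, e u v && (c u v == None)]; first by exists u, v.
have tot u v : e u v -> exists i, c u v = Some i.
  move=> euv; case cuv: (c u v) => [i|]; first by exists i.
  by case/existsP: none; exists u; apply/existsP; exists v; rewrite euv cuv.
have [[_ min] _] := crit; suff /min : edge_colorable e Dl by rewrite ltnn.
exists (fun u v => if c u v is Some i then i : nat else 0); split; last split.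
- by move=> u v /tot[i ->].
- by move=> u v _; rewrite (pcol_sym pc).
- move=> u v w /tot[i ci] /tot[j cj] vw; rewrite ci cj; apply: contra vw.
  move=> /eqP/val_inj ij; apply/eqP; apply: (pcol_proper pc ci); by rewrite ij.
Qed.

(** The coloring comes from deleting the edge [xy]; its colors are below [Dl], so [insub] never
    fails on the remaining edges. *)
Lemma critical_near x y : e x y -> exists c : T -> T -> option 'I_Dl, near e c x y.
Proof.
move=> exy; pose f u v := e u v && ~~ joins x y u v.
have [_ /(_ setT f)[]] := crit.
  split; last by right; exists x, y; rewrite /f /joins exy !eqxx.
  by split; [move=> u v; rewrite /f esym joinsC|split=> u v; [case/andP|rewrite !inE]].
move=> k [[[c0 [clt [csy cpr]]] _] kD].
have tot u v : f u v -> exists2 i : 'I_Dl, insub (c0 u v) = Some i & val i = c0 u v.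
  by move=> /clt h; have h' := leq_trans h kD; exists (Ordinal h') => //; rewrite insubT.
exists (fun u v => if f u v then insub (c0 u v) else None).
have fs u v : f u v = f v u by rewrite /f esym joinsC.
split=> //.
- split.
  + by move=> u v; rewrite fs; case: ifP => // fvu; rewrite csy // fs.
  + by move=> u v; case: ifP => // /andP[].
  + move=> u v w i; case: ifP => // fuv; case: ifP => // fuw.
    have [i1 -> v1] := tot _ _ fuv; have [i2 -> v2] := tot _ _ fuw => -[h1] [h2].
    apply/eqP; apply: contraT => vw; have := cpr _ _ _ fuv fuw vw.
    by rewrite -v1 -v2 h1 h2 eqxx.
- by rewrite /f /joins !eqxx andbF.
- move=> u v euv; case: ifP; first by move=> /tot[i ->].
  by rewrite /f euv => /negbT; rewrite negbK.
Qed.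

(** Deleting an isolated vertex would give a proper subgraph with the same edges, hence with the
    same chromatic index. *)
Lemma critical_nbr v : exists u, e v u.
Proof.
have [/existsP //|none] := boolP [exists u, e v u].
have ev u : e v u = false by apply/negP => h; case/existsP: none; exists u.
have [[_ min] /(_ (setT :\ v) e)[]] := crit.
  split; last first.
    by left; apply/eqP => /setP/(_ v); rewrite !inE eqxx.
  split=> //; split=> // x y exy; rewrite !inE !andbT; apply/andP; split.
    by apply: contraTneq exy => ->; rewrite ev.
  by apply: contraTneq exy => ->; rewrite esym ev.
by move=> k [[/min h _] kD]; have := leq_trans h kD; rewrite ltnn.
Qed.

Lemma critical_adjacency x y : e x y ->
  Dl.+1 <= deg e x + #|[set z | [&& e y z, deg e z == Dl & z != x]]|.
Proof.
move=> /critical_near[c nc].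
exact: (vizing_adjacency esym eirr critical_uncolorable deg_le_max nc).
Qed.

Lemma critical_deg_ge2 v : 1 < deg e v.
Proof.
have [u evu] := critical_nbr v.
have := critical_adjacency (x := u) (y := v); rewrite esym evu => /(_ isT).
have := deg_le_max u.
have : #|[set z | [&& e v z, deg e z == Dl & z != u]]| < deg e v.
  rewrite /deg (cardsD1 u [set y | e v y]) inE evu add1n ltnS.
  by apply: subset_leq_card; apply/subsetP => z; rewrite !inE => /and3P[-> _ ->].
move: #|finset _| (deg e u) (deg e v); lia.
Qed.

Definition nbs (A : {set T}) := [set z | [exists s in A, e s z]].

Section Small.
Variable S : {set T}.
Hypothesis small : forall u w, u \in S -> w \in S -> deg e u + deg e w + 2 <= Dl.

Let dS v := #|small_nb e S v|.

Lemma small_vertices_indep u w : u \in S -> w \in S -> ~~ e u w.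
Proof. exact: (small_indep esym eirr critical_uncolorable deg_le_max critical_near small). Qed.

Local Open Scope ring_scope.

(** In the application [d] neighbours have reciprocal at least [1 / t], and [n] of them even at
    least [1 / (d - t)]. The excess over 2 is a square plus a nonnegative product, over a positive
    denominator. *)
Lemma inv_pair_ge2 (t d n : nat) : (0 < t)%N -> (t <= n)%N -> (t < d)%N -> (d < 2 * t)%N ->
  2 <= d%:R / t%:R + n%:R * ((d - t)%N%:R^-1 - t%:R^-1) :> rat.
Proof.
move=> t0 tn td dt; rewrite natrB ?(ltnW td) //.
have : (0 : rat) < t%:R by rewrite ltr0n.
have : (t%:R : rat) < d%:R by rewrite ltr_nat.
have : (d%:R : rat) < 2 * t%:R by rewrite -natrM ltr_nat.
have : (t%:R : rat) <= n%:R by rewrite ler_nat.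
move: (t%:R : rat) (d%:R : rat) (n%:R : rat) => {tn td dt t0}t {}d {}n tn dt td t0.
have h : 0 < d - t by lra.
rewrite -subr_ge0.
have -> : d / t + n * ((d - t)^-1 - t^-1) - 2 = ((2 * t - d) ^+ 2 + (n - t) * (2 * t - d)) / (t * (d - t)).
  by field; rewrite ?lt0r_neq0.
apply: divr_ge0; last by apply: mulr_ge0; lra.
by apply: addr_ge0; [exact: sqr_ge0|apply: mulr_ge0; lra].
Qed.

(** Let [t] be the largest [dS] among the neighbours of [s]. If [2 * t <= deg e s], the terms
    [1 / t] suffice. Otherwise [small_nb_tradeoff] gives at least [t] neighbours for which [dS] is
    at most [deg e s - t], smaller than [t]. *)
Lemma small_inv_sum s : s \in S -> 2 <= \sum_(z | e s z) (dS z)%:R^-1 :> rat.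
Proof.
move=> sS; have [y0 esy0] := critical_nbr s.
pose y := [arg max_(z > y0 | e s z) dS z]%N.
have [esy ymax] : e s y /\ forall z, e s z -> (dS z <= dS y)%N.
  by rewrite /y; case: arg_maxnP => // z.
have [Z Zs [tZ hZ]] := small_nb_tradeoff esym eirr critical_uncolorable deg_le_max
   critical_near small sS esy.
rewrite -/(dS y) in tZ hZ; set t := dS y in tZ hZ ymax *.
have dpos z : e s z -> (0 < dS z)%N.
  by move=> esz; rewrite card_gt0; apply/set0Pn; exists s; rewrite inE sS esym.
have t0 : (0 < t)%N by exact: dpos.
have cN : \sum_(z | e s z) 1 = (deg e s)%:R :> rat.
  by rewrite sumr_const /deg; congr (_%:R); apply: eq_card => z; rewrite inE.
have inv_le (a b : nat) : (0 < a)%N -> (a <= b)%N -> (b%:R^-1 : rat) <= a%:R^-1.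
  move=> a0 ab; rewrite lef_pV2 ?ler_nat // posrE ltr0n //; exact: leq_trans ab.
have td : (t < deg e s)%N.
  have [z zZ] : exists z, z \in Z by apply/set0Pn; rewrite -card_gt0; exact: leq_trans tZ.
  have := hZ z zZ; rewrite -/(dS z); have : (0 < dS z)%N.
    by apply: dpos; move/subsetP: Zs => /(_ z zZ); rewrite inE.
  by move: (dS z); lia.
have [d2t|d2t] := leqP (2 * t) (deg e s).
  apply: (@le_trans _ _ ((deg e s)%:R / t%:R)).
    by rewrite ler_pdivlMr ?ltr0n // -natrM ler_nat.
  rewrite -cN mulr_suml; apply: ler_sum => z esz; rewrite mul1r.
  by apply: inv_le; [exact: dpos|exact: ymax].
apply: le_trans (inv_pair_ge2 t0 tZ td d2t) _.
rewrite -cN mulr_suml; have -> : #|Z|%:R = \sum_(z | e s z) (z \in Z)%:R :> rat.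
  rewrite -natr_sum; congr (_%:R); rewrite -sum1_card big_mkcond [in RHS]big_mkcond /=.
  apply: eq_bigr => z _; case: (boolP (z \in Z)) => zZ; last by case: (e s z).
  by move/subsetP: Zs => /(_ z zZ); rewrite inE => ->.
rewrite mulr_suml -big_split /=; apply: ler_sum => z esz; rewrite mul1r.
have [zZ|zZ] := boolP (z \in Z); last first.
  by rewrite mul0r addr0; apply: inv_le; [exact: dpos|exact: ymax].
rewrite mul1r addrC subrK; apply: inv_le; first exact: dpos.
by have := hZ z zZ; rewrite -/(dS z); move: (dS z) (deg e s); lia.
Qed.

(* Each [s] spreads weight at least 2 over its neighbours [z], giving [1 / dS z] to
   each, and no [z] receives more than 1. *)
Lemma small_expand (A : {set T}) : A \subset S -> (2 * #|A| <= #|nbs A|)%N.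
Proof.
move=> /subsetP AS; rewrite -(@ler_nat rat) natrM.
have -> : 2 * #|A|%:R = \sum_(s in A) (2 : rat) by rewrite sumr_const mulr_natr.
apply: (@le_trans _ _ (\sum_(s in A) \sum_(z | e s z) (dS z)%:R^-1)).
  by apply: ler_sum => s /AS; exact: small_inv_sum.
rewrite (exchange_big_dep (mem (nbs A))) /=; last first.
  by move=> s z sA esz; rewrite inE; apply/existsP; exists s; rewrite sA.
rewrite -[#|nbs A|%:R]/(1 *+ #|nbs A|) -sumr_const; apply: ler_sum => z.
rewrite inE => /existsP[s /andP[sA esz]].
rewrite sumr_const -[_ *+ _]mulr_natl.
have dz : (0 < dS z)%N.
  by rewrite card_gt0; apply/set0Pn; exists s; rewrite inE (AS _ sA) esym.
rewrite ler_pdivrMr ?ltr0n // mul1r ler_nat; apply: subset_leq_card.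
apply/subsetP => u; rewrite !inE => /andP[uA euz]; by rewrite (AS _ uA) esym.
Qed.

End Small.
End Critical.

(** * Discharging *)

Section Weights.
Variables (T : finType) (e : rel T).
Hypotheses (esym : symmetric e) (eirr : irreflexive e) (crit : edge_critical e).
Notation Dl := (max_deg e).
Implicit Types (U : {set T}) (v : T).

Definition max_vertices : {set T} := [set v | deg e v == Dl].

Lemma card_max_vertices v : Dl < #|max_vertices| + deg e v.
Proof.
have [u evu] := critical_nbr esym crit v; rewrite addnC.
apply: leq_trans (critical_adjacency esym eirr crit evu) _; rewrite leq_add2l.
by apply: subset_leq_card; apply/subsetP => z; rewrite !inE => /and3P[].
Qed.

Local Open Scope ring_scope.

Definition wt (U : {set T}) (v : T) : rat :=
  #|[set y in U | e v y]|%:R / (deg e v)%:R.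

Lemma wt_ge0 U v : 0 <= wt U v.
Proof. by apply: divr_ge0; apply: ler0n. Qed.

Lemma wt_lb U v (a d : nat) : (0 < a)%N -> (a <= deg e v)%N ->
  (#|[set y in ~: U | e v y]| <= d)%N -> 1 - d%:R / a%:R <= wt U v.
Proof.
move=> a0 av hd; have dv0 : (0 : rat) < (deg e v)%:R by rewrite ltr0n; exact: leq_trans av.
have -> : wt U v = 1 - #|[set y in ~: U | e v y]|%:R / (deg e v)%:R.
  rewrite /wt; apply: (mulIf (lt0r_neq0 dv0)); rewrite mulrBl !divfK ?lt0r_neq0 // mul1r.
  rewrite /deg -(cardsID U [set y | e v y]) natrD.
  have -> : [set y | e v y] :&: U = [set y in U | e v y] by apply/setP => y; rewrite !inE andbC.
  have -> : [set y | e v y] :\: U = [set y in ~: U | e v y] by apply/setP => y; rewrite !inE.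
  by rewrite addrK.
rewrite lerD2l lerN2 ler_pdivrMr //; apply: (@le_trans _ _ d%:R); first by rewrite ler_nat.
rewrite mulrAC ler_pdivlMr ?ltr0n // ler_wpM2l ?ler0n // ler_nat //.
Qed.

Lemma wt1 U v : (forall y, e v y -> y \in U) -> wt U v = 1.
Proof.
move=> h; rewrite /wt; have -> : [set y in U | e v y] = [set y | e v y].
  by apply/setP => y; rewrite !inE; case: (boolP (e v y)) => [/h ->|]; rewrite ?andbF.
rewrite divff // pnatr_eq0 -lt0n; apply: leq_trans (critical_deg_ge2 esym eirr crit v).
by [].
Qed.

(* By Vizing's adjacency lemma a vertex [y] with a neighbour [v] has at most
   [deg e v - 1] neighbours that are not of maximum degree. *)
Lemma wt_sum_lt (U : {set T}) : max_vertices \subset U -> (0 < #|U|)%N ->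
  \sum_(v in ~: U) wt U v < #|U|%:R.
Proof.
move=> /subsetP DU U0.
have -> : \sum_(v in ~: U) wt U v = \sum_(y in U) \sum_(v in ~: U | e y v) (deg e v)%:R^-1.
  rewrite [RHS](exchange_big_dep (mem (~: U))) /=; last by move=> y v _ /andP[].
  apply: eq_bigr => v vU; rewrite sumr_const /wt -[RHS]mulr_natl; congr (_%:R * _).
  by apply: eq_card => y; rewrite !inE; move: vU; rewrite !inE => -> /=; rewrite esym.
have -> : #|U|%:R = \sum_(y in U) (1 : rat) by rewrite sumr_const.
(* For a neighbour [v] of [y] outside [U] of least degree, all terms are at most [1 / deg e v], and
   there are at most [deg e v - 1] of them. *)
have lt1 y : \sum_(v in ~: U | e y v) (deg e v)%:R^-1 < (1 : rat).
  have [/existsP[v0 hv0]|none] := boolP [exists v, (v \in ~: U) && e y v]; last first.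
    rewrite big_pred0 // => v; apply/negP => hv; case/existsP: none; by exists v.
  pose v := [arg min_(w < v0 | (w \in ~: U) && e y w) deg e w]%N.
  have [/andP[vU eyv] vmin] : (v \in ~: U) && e y v /\
      forall w, (w \in ~: U) && e y w -> (deg e v <= deg e w)%N.
    by rewrite /v; case: arg_minnP.
  have dv2 := critical_deg_ge2 esym eirr crit v.
  have dv0 : (0 : rat) < (deg e v)%:R by rewrite ltr0n; exact: ltnW.
  apply: (@le_lt_trans _ _ (\sum_(w in ~: U | e y w) (deg e v)%:R^-1)).
    apply: ler_sum => w hw; rewrite lef_pV2 ?ler_nat ?vmin // posrE // ltr0n.
    by apply: leq_trans (critical_deg_ge2 esym eirr crit w).
  rewrite sumr_const -[_ *+ _]mulr_natl ltr_pdivrMr // mul1r ltr_nat.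
  have evy : e v y by rewrite esym.
  have := critical_adjacency esym eirr crit evy.
  have := deg_le_max e y.
  rewrite [deg e y]/deg -(cardsID U [set z | e y z]).
  have h1 : (#|[set z | [&& e y z, deg e z == Dl & z != v]]| <= #|[set z | e y z] :&: U|)%N.
    apply: subset_leq_card; apply/subsetP => z; rewrite !inE => /and3P[-> dz _] /=.
    by apply: DU; rewrite inE.
  have -> : #|[pred w | (w \in ~: U) && e y w]| = #|[set z | e y z] :\: U|.
    by apply: eq_card => z; rewrite !inE.
  move: h1; set A := #|[set z | [&& _, _ & _]]|; set B := #|_ :&: _|; set C := #|_ :\: _|.
  move: A B C (deg e v) Dl; lia.
apply: ltr_sum => [|y _]; last exact: lt1.
case/card_gt0P: U0 => y yU; apply/hasP; by exists y.
Qed.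

End Weights.

(** * Path covers *)

(* [lia] would split on the boolean values. *)
Ltac bool_lia := repeat match goal with |- context [nat_of_bool ?b] =>
  let n := fresh "n" in generalize (nat_of_bool b); intro n end;
  repeat match goal with |- context [@count ?U ?f ?s] =>
    let n := fresh "n" in generalize (@count U f s); intro n end; clear; lia.

(** Regroupings of concatenated and reversed lists become linear identities between counts. *)
Ltac perm_count := apply/seq.permP => ?;
  rewrite /= ?(cats0, count_cat, count_rev) /=
    ?(cats0, count_cat, count_rev, rev_cat, rev_cons, cat_rcons) /=;
  rewrite -?cats1 ?(cats0, count_cat, count_rev) /=; bool_lia.

Section Seqs.
Variables (T : eqType) (r : rel T).
Implicit Types (x y : T) (A B P Q : seq T).

(** The successors of the [f]-positions are disjoint from the [g]-positions. The last position is
    not in [f], so no successor is lost; the first is a successor of nothing, hence the term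
    [g x]. *)
Lemma count_cross (f g : pred T) x A :
  (forall B1 a b B2, x :: A = B1 ++ a :: b :: B2 -> ~~ (f a && g b)) ->
  ~~ f (last x A) -> count f (x :: A) + count g (x :: A) <= size A + g x.
Proof.
elim: A x => [|y A IH] x /=; first by move=> _ /negbTE->; lia.
move=> h fl; have := IH y; rewrite /= => /(_ _ fl) IH'.
have {}IH' := IH' (fun B1 a b B2 E => h (x :: B1) a b B2 (congr1 (cons x) E)).
have := h [::] x y A erefl; move: IH'; case: (f x); case: (g y) => //=; lia.
Qed.

Lemma sorted_cat2 x A B : A != [::] -> B != [::] ->
  sorted r (A ++ B) = [&& sorted r A, r (last x A) (head x B) & sorted r B].
Proof.
case: A => // a A _; case: B => // b B _; by rewrite /= cat_path /=.
Qed.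

Hypothesis rsym : symmetric r.

Lemma sorted_rev A : sorted r (rev A) = sorted r A.
Proof. by rewrite rev_sorted; apply: eq_sorted => a b; rewrite rsym. Qed.

Lemma rev_nil A : (rev A == [::]) = (A == [::]).
Proof. by rewrite -!size_eq0 size_rev. Qed.

Lemma head_rev x A : head x (rev A) = last x A.
Proof. by case/lastP: A => // A y; rewrite rev_rcons last_rcons. Qed.

Lemma last_rev x A : last x (rev A) = head x A.
Proof. by case: A => // y A; rewrite rev_cons last_rcons. Qed.

End Seqs.

Section PathCovers.
Variables (T : finType) (r : rel T).
Hypotheses (rsym : symmetric r) (rirr : irreflexive r).
Implicit Types (x y u v : T) (A B P Q : seq T) (pl rest : seq (seq T)) (X : {set T}).

Definition gpath P := (P != [::]) && sorted r P.

Definition pcover X pl := all gpath pl && perm_eq (flatten pl) (enum X).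

Lemma pcover_perm X pl pl' : perm_eq pl pl' -> pcover X pl -> pcover X pl'.
Proof.
move=> pp /andP[ok pe]; apply/andP; split; first by rewrite -(perm_all _ pp).
by apply: perm_trans pe; rewrite perm_sym perm_flatten.
Qed.

Lemma pcover_replace X old new rest : pcover X (old ++ rest) ->
  all gpath new -> perm_eq (flatten new) (flatten old) -> pcover X (new ++ rest).
Proof.
move=> /andP[]; rewrite all_cat => /andP[_ ok] pe okn pf; apply/andP; split.
  by rewrite all_cat okn ok.
by apply: perm_trans pe; rewrite !flatten_cat perm_cat2r.
Qed.

Lemma pcover_mem X pl x : pcover X pl -> (x \in X) = has (fun P => x \in P) pl.
Proof.
move=> /andP[_ /perm_mem/(_ x)]; rewrite mem_enum => <-.
by apply/flattenP/hasP => [[P h1 h2]|[P h1 h2]]; exists P.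
Qed.

Lemma pcover_uniq X pl : pcover X pl -> uniq (flatten pl).
Proof. by move=> /andP[_ /perm_uniq->]; exact: enum_uniq. Qed.

Lemma pcover_card X pl : pcover X pl -> #|X| = sumn (map size pl).
Proof. by move=> /andP[_ /perm_size]; rewrite size_flatten cardE => <-. Qed.

Lemma pcover_count X pl (f : pred T) : pcover X pl ->
  #|[set x in X | f x]| = sumn (map (count f) pl).
Proof.
move=> /andP[_ /seq.permP/(_ f)]; rewrite count_flatten => ->.
rewrite -size_filter cardE; apply: perm_size; apply: uniq_perm.
- exact: enum_uniq.
- exact/filter_uniq/enum_uniq.
by move=> x; rewrite mem_filter !mem_enum inE andbC.
Qed.

Lemma gpath_rev P : gpath (rev P) = gpath P.
Proof. by rewrite /gpath rev_nil sorted_rev. Qed.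

Lemma gpath_cat x A B : gpath A -> gpath B -> r (last x A) (head x B) -> gpath (A ++ B).
Proof.
move=> /andP[nA sA] /andP[nB sB] h; apply/andP; split; first by case: A nA {sA h}.
by rewrite (sorted_cat2 r x) // sA sB h.
Qed.

Lemma gpath_catl A B : gpath (A ++ B) -> A != [::] -> gpath A.
Proof.
move=> /andP[_ s] nA; rewrite /gpath nA /=.
by case: A nA s => // a A _ /=; rewrite cat_path => /andP[].
Qed.

Lemma gpath_catr A B : gpath (A ++ B) -> B != [::] -> gpath B.
Proof.
move=> /andP[_ s] nB; rewrite /gpath nB /=.
case: A s => // a A /=; rewrite cat_path => /andP[_].
by case: B nB => //= b B _ /andP[].
Qed.

(* Joining [u :: P] to an end of another path saves one path. *)
Lemma min_end_nonadj X u P rest x Q : pcover X ((u :: P) :: rest) ->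
  (forall pl, pcover X pl -> size rest < size pl) ->
  Q \in rest -> x = head u Q \/ x = last u Q -> ~~ r u x.
Proof.
move=> pc nosm Qr xQ; apply/negP => rux.
have pr : perm_eq rest (Q :: rem Q rest) by exact: perm_to_rem.
have pc2 : pcover X ([:: u :: P; Q] ++ rem Q rest).
  by apply: pcover_perm pc; rewrite /= perm_cons.
have [okP okQ] : gpath (u :: P) /\ gpath Q by move: pc2 => /andP[/= /and3P[]].
have sr : size rest = (size (rem Q rest)).+1 by rewrite (perm_size pr).
have [new hnew] : exists new, gpath new /\ perm_eq new ((u :: P) ++ Q).
  case: xQ => xQ.
    exists (rev (u :: P) ++ Q); split; last by perm_count.
    by apply: (@gpath_cat u); rewrite ?gpath_rev // last_rev /= -xQ.
  exists (Q ++ u :: P); split; last by perm_count.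
  by apply: (@gpath_cat u) => //=; rewrite -xQ rsym.
suff : pcover X ([:: new] ++ rem Q rest) by move/nosm; rewrite sr /= ltnn.
apply: pcover_replace pc2 _ _; first by rewrite /= (proj1 hnew).
by rewrite /= cats0 cats0; case: hnew.
Qed.

(** Ore's crossing argument: consecutive vertices [a], [b] of a path, joined crosswise to [u] and
    [v], would let the cover be reconnected with one path fewer. Each path of the cover thus loses
    at least one in the count. *)
Lemma ore_paths X u P v P' rest : pcover X ((u :: P) :: (v :: P') :: rest) ->
  (forall pl, pcover X pl -> (size rest).+1 < size pl) ->
  [/\ count (r u) (u :: P) + count (r v) (u :: P) <= size P,
      count (r u) (v :: P') + count (r v) (v :: P') <= size P' &
      forall Q, Q \in rest -> count (r u) Q + count (r v) Q < size Q].
Proof.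
move=> pc nosm.
have [okP okP'] : gpath (u :: P) /\ gpath (v :: P') by move: pc => /andP[/= /and3P[]].
have pcs : pcover X ((v :: P') :: (u :: P) :: rest).
  by apply: pcover_perm pc; apply/seq.permP => a; rewrite /=; lia.
have uend x Q : Q \in (v :: P') :: rest -> x = head u Q \/ x = last u Q -> ~~ r u x.
  by move=> hQ hx; apply: (min_end_nonadj pc) hx.
have vend x Q : Q \in (u :: P) :: rest -> x = head v Q \/ x = last v Q -> ~~ r v x.
  by move=> hQ hx; apply: (min_end_nonadj pcs) hx.
have small new : gpath new -> perm_eq new ((u :: P) ++ (v :: P')) -> False.
  move=> g p; suff : pcover X ([:: new] ++ rest) by move/nosm; rewrite /= ltnn.
  by apply: (pcover_replace (old := [:: u :: P; v :: P'])) pc _ _; rewrite /= ?g // !cats0.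
split.
- rewrite addnC; apply: leq_trans (count_cross (f := r v) (g := r u) _ _) _.
  (* The single path runs backwards through [P'] to [v], then to [a], back to [u], and on from
     [b]. *)
  + move=> B1 a b B2 E; apply/negP => /andP[rva rub].
    have g0 : gpath (rcons B1 a ++ b :: B2) by rewrite cat_rcons -E.
    have hu d : head d (rcons B1 a) = u by case: B1 E {g0} => [|? ?] [].
    have n1 : rcons B1 a != [::] by case: (B1).
    have g1 := gpath_catl g0 n1; have g2 := gpath_catr g0 isT.
    apply: (small ((rev (v :: P') ++ rev (rcons B1 a)) ++ b :: B2)).
      apply: (@gpath_cat u) => //; last first.
        by rewrite last_cat last_rev hu.
      by apply: (@gpath_cat v); rewrite ?gpath_rev // last_rev head_rev last_rcons.
    rewrite E -cat_rcons; perm_count.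
  + by apply: (vend _ (u :: P)); rewrite ?inE ?eqxx //; right.
  + by rewrite rirr addn0.
- apply: leq_trans (count_cross (f := r u) (g := r v) _ _) _.
  + move=> B1 a b B2 E; apply/negP => /andP[rua rvb].
    have g0 : gpath (rcons B1 a ++ b :: B2) by rewrite cat_rcons -E.
    have hu d : head d (rcons B1 a) = v by case: B1 E {g0} => [|? ?] [].
    have n1 : rcons B1 a != [::] by case: (B1).
    have g1 := gpath_catl g0 n1; have g2 := gpath_catr g0 isT.
    apply: (small ((rev (u :: P) ++ rev (rcons B1 a)) ++ b :: B2)).
      apply: (@gpath_cat u) => //; last first.
        by rewrite last_cat last_rev hu.
      by apply: (@gpath_cat v); rewrite ?gpath_rev // last_rev head_rev last_rcons.
    rewrite E -cat_rcons; perm_count.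
  + by apply: (uend _ (v :: P')); rewrite ?inE ?eqxx //; right.
  + by rewrite rirr addn0.
move=> Q Qr; have pr : perm_eq rest (Q :: rem Q rest) by exact: perm_to_rem.
have pc3 : pcover X ([:: u :: P; v :: P'; Q] ++ rem Q rest).
  by apply: pcover_perm pc; rewrite /= !perm_cons.
have sr : size rest = (size (rem Q rest)).+1 by rewrite (perm_size pr).
have gQ : gpath Q by move: pc3 => /andP[/= /and4P[]].
have hQv : ~~ r v (head v Q) by apply: (vend _ Q); [rewrite inE Qr orbT|left].
have hQu : ~~ r u (last u Q) by apply: (uend _ Q); [rewrite inE Qr orbT|right].
case: Q Qr pr pc3 sr gQ hQv hQu => [|q Q] Qr pr pc3 sr gQ /= hQv hQu //.
rewrite ltnS; apply: leq_trans (count_cross (f := r u) (g := r v) _ _) _ => //; last first.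
  by rewrite (negbTE hQv) addn0.
(* Three paths become two: [Q] is cut between [a] and [b], its left part continues into the path of
   [u], and its right part follows the reversed path of [v]. *)
move=> B1 a b B2 E; apply/negP => /andP[rua rvb].
have g0 : gpath (rcons B1 a ++ b :: B2) by rewrite cat_rcons -E.
have n1 : rcons B1 a != [::] by case: (B1).
have g1 := gpath_catl g0 n1; have g2 := gpath_catr g0 isT.
suff : pcover X ([:: rcons B1 a ++ u :: P; rev (v :: P') ++ b :: B2] ++ rem (q :: Q) rest).
  by move/nosm; rewrite sr /= ltnn.
apply: (pcover_replace pc3); last first.
  apply/seq.permP => f; have := congr1 (count f) E.
  rewrite /= !cats0 -cats1 !(count_cat, count_rev) /= !(count_cat, count_rev) /=; bool_lia.
rewrite /= !andbT; apply/andP; split.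
  by apply: (@gpath_cat u) => //=; rewrite last_rcons rsym.
by apply: (@gpath_cat v); rewrite ?gpath_rev // last_rev.
Qed.

End PathCovers.

(** * Closures *)

Lemma ex_least (P : nat -> Prop) : (exists n, P n) ->
  exists n, P n /\ forall k, P k -> n <= k.
Proof.
case=> n; have [N] := ubnP n; elim: N n => // N IH n nN Pn.
have [[k [kn Pk]]|none] := classic (exists k, k < n /\ P k).
  by apply: IH Pk; apply: leq_trans kn _.
exists n; split=> // k Pk; rewrite leqNgt; apply/negP => kn; apply: none; by exists k.
Qed.

Section RemoveEdge.
Variables (T : finType) (e r : rel T) (a b : T).
Hypotheses (esym : symmetric e) (rsym : symmetric r) (rirr : irreflexive r).
Hypotheses (er : subrel e r) (rab : r a b) (neab : ~~ e a b).

Definition remove_edge u v := r u v && ~~ joins a b u v.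

Lemma remove_edge_sym : symmetric remove_edge.
Proof. by move=> u v; rewrite /remove_edge rsym joinsC. Qed.

Lemma remove_edge_irr : irreflexive remove_edge.
Proof. by move=> u; rewrite /remove_edge rirr. Qed.

Lemma sub_remove_edge : subrel e remove_edge.
Proof.
move=> u v euv; rewrite /remove_edge er //=; apply: contra neab.
by move=> /joins_pairP[[<- <-]|[<- <-]] //; rewrite esym.
Qed.

Definition extra (q : rel T) := #|[set p : T * T | q p.1 p.2 && ~~ e p.1 p.2]|.

Lemma extra_remove_edge : extra remove_edge < extra r.
Proof.
apply: proper_card; apply/properP; split.
  by apply/subsetP => -[u v]; rewrite !inE /= => /andP[/andP[-> _] ->].
by exists (a, b); rewrite !inE /= ?rab ?neab // /remove_edge /joins !eqxx andbF.
Qed.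

Lemma sorted_remove_edge Q : sorted r Q -> ~~ ((a \in Q) && (b \in Q)) ->
  sorted remove_edge Q.
Proof.
move=> sQ nab; apply: (@sub_in_sorted _ (mem Q)) sQ; last exact/allP.
move=> u v uQ vQ ruv; rewrite /remove_edge ruv /=; apply: contra nab.
by move=> /joins_pairP[[<- <-]|[<- <-]]; rewrite uQ vQ.
Qed.

End RemoveEdge.

Lemma sorted_fault (T : eqType) (q e : rel T) P : sorted q P -> ~~ sorted e P ->
  exists A a b B, [/\ P = A ++ a :: b :: B, q a b & ~~ e a b].
Proof.
case: P => //= x P; elim: P x => //= y P IH x /andP[qxy pth].
rewrite negb_and => /orP[nexy|np]; first by exists [::], x, y, P.
have [A [a [b [B [E h1 h2]]]]] := IH y pth np.
by exists (x :: A), a, b, B; rewrite E.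
Qed.

Section Closure.
Variable T : finType.
Implicit Types (e r : rel T) (X C : {set T}) (pl : seq (seq T)).

(** The Bondy-Chvatal closure for path covers. Dropping an added edge [ab] used by the cover cuts a
    path and gives at most [m + 1] paths; if no cover with [m] paths were left, [ore_paths] at the
    ends [a] and [b] would bound their degree sum in [X] by [#|X| - m - 1]. Added edges disappear
    one at a time, by induction on [extra]. *)
Lemma pcover_closure e r X m :
  symmetric e -> irreflexive e -> symmetric r -> irreflexive r -> subrel e r ->
  (forall u v, u \in X -> v \in X -> r u v -> ~~ e u v ->
     #|X| <= m + #|[set x in X | e u x]| + #|[set x in X | e v x]|) ->
  (exists2 pl, pcover r X pl & size pl <= m) ->
  exists2 pl, pcover e X pl & size pl <= m.
Proof.
move=> esym eirr; have [N] := ubnP (extra e r); elim: N r => // N IH r rN rsym rirr er ore [pl pc sm].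
have [|/allPn[P Ppl nP]] := boolP (all (gpath e) pl).
  by move=> ok; exists pl => //; case/andP: pc => _ pe; rewrite /pcover ok.
have pp : perm_eq pl (P :: rem P pl) by exact: perm_to_rem.
have pc1 := pcover_perm pp pc.
have gP : gpath r P by move: pc1 => /andP[/= /andP[]].
have nsP : ~~ sorted e P by apply: contra nP => sP; rewrite /gpath sP; case/andP: gP => ->.
have [A [a [b [B [PE rab neab]]]]] := sorted_fault (proj2 (andP gP)) nsP.
pose r' := remove_edge r a b.
have r'sym : symmetric r' := remove_edge_sym a b rsym.
have r'irr : irreflexive r' := remove_edge_irr a b rirr.
have er' : subrel e r' by exact: sub_remove_edge.
have lt : extra e r' < N by apply: leq_trans (extra_remove_edge rab neab) _.
have un := pcover_uniq pc1.
have un2 : uniq ((rcons A a ++ b :: B) ++ flatten (rem P pl)) by rewrite cat_rcons -PE.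
pose pl' := [:: a :: rev A; b :: B] ++ rem P pl.
have aA : a \in rcons A a by rewrite mem_rcons mem_head.
have bB : b \in b :: B by rewrite mem_head.
move: un2; rewrite !cat_uniq => /andP[/and3P[uA /hasPn dAB uB] /andP[/hasPn dR uR]].
have pc2 : pcover r' X pl'.
  apply/andP; split; last first.
    case/andP: pc1 => _; apply: perm_trans; rewrite /pl' PE /=; perm_count.
  have gsp : gpath r (rcons A a ++ b :: B) by rewrite cat_rcons -PE.
  have n1 : rcons A a != [::] by case: (A).
  have s1 := proj2 (andP (gpath_catl gsp n1)); have s2 := proj2 (andP (gpath_catr gsp isT)).
  rewrite /pl' /= -rev_rcons /gpath rev_nil n1 /= sorted_rev //; apply/and3P; split.
  - apply: sorted_remove_edge => //; apply/negP => /andP[_ bA].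
    by have := dAB b bB; rewrite bA.
  - apply: (@sorted_remove_edge _ _ _ _ (b :: B)) => //; apply/negP => /andP[aB _].
    by have := dAB a aB; rewrite aA.
  - apply/allP => Q Qr; have /andP[nQ sQ] : gpath r Q.
      by move: pc1 => /andP[/= /andP[_ /allP/(_ Q Qr)]].
    rewrite nQ; apply: sorted_remove_edge => //; apply/negP => /andP[aQ _].
    have : a \in flatten (rem P pl) by apply/flattenP; exists Q.
    by move=> /dR; rewrite mem_cat aA.
apply: (IH r') => //.
  move=> u v uX vX /andP[ruv _]; exact: ore.
apply: NNPP => none.
have nosm pl1 : pcover r' X pl1 -> m < size pl1.
  by move=> h; rewrite ltnNge; apply/negP => s1; apply: none; exists pl1.
have srm : m = (size (rem P pl)).+1.
  by have := nosm _ pc2; move: sm; rewrite (perm_size pp) /pl' /=; clear; lia.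
have [h1 h2 h3] : [/\ _, _ & _] := ore_paths r'sym r'irr pc2 (eq_ind m (fun n => forall pl, pcover r' X pl -> n < size pl) nosm _ srm).
have memX x : x \in P -> x \in X.
  by move=> xP; rewrite (pcover_mem _ pc1) /= xP.
have aX : a \in X by apply: memX; rewrite PE mem_cat mem_head orbT.
have bX : b \in X by apply: memX; rewrite PE mem_cat !inE eqxx !orbT.
have := ore a b aX bX rab neab.
have le u : #|[set x in X | e u x]| <= #|[set x in X | r' u x]|.
  by apply: subset_leq_card; apply/subsetP => x; rewrite !inE => /andP[-> /er' ->].
have := le a; have := le b.
rewrite !(pcover_count _ pc2) (pcover_card pc2) /pl' [sumn (map (count (r' a)) _)]/= [sumn (map (count (r' b)) _)]/= [sumn (map size _)]/= size_rev.
have : sumn (map (count (r' a)) (rem P pl)) + sumn (map (count (r' b)) (rem P pl)) + size (rem P pl)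
   <= sumn (map size (rem P pl)).
  elim: (rem P pl) h3 => //= Q rest IHr h3; have := h3 Q (mem_head _ _).
  have := IHr (fun Q' h => h3 Q' (mem_behead (s := Q :: rest) h)).
  clear; lia.
move: h1 h2; rewrite size_rev srm /=; clear; lia.
Qed.

(** Each vertex of [C] is inserted between two paths and merges them. When at most one path remains
    it goes in front, which leaves one path and is where [0 < m] enters. *)
Lemma pcover_universal r X C pl m : symmetric r -> C \subset X ->
  (forall c x, c \in C -> x \in X -> x != c -> r c x) -> 0 < m ->
  pcover r (X :\: C) pl -> size pl <= m + #|C| ->
  exists2 pl', pcover r X pl' & size pl' <= m.
Proof.
move=> rsym; have [N] := ubnP #|C|; elim: N C pl => // N IH C pl CN CX uni m0 pc sz.
have [C0|[c cC]] := set_0Vmem C.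
  by exists pl; move: pc sz; rewrite C0 setD0 cards0 addn0.
have cX : c \in X by move/subsetP: CX; apply.
have CS : C :\ c \subset X by apply: subset_trans CX; exact: subD1set.
have cc := cardsD1 c C; rewrite cC in cc.
suff [pl' pc' sz'] : exists2 pl', pcover r (X :\: (C :\ c)) pl' & size pl' <= m + #|C :\ c|.
  apply: (IH (C :\ c) pl') => //; first by move: CN; rewrite cc; clear; lia.
  by move=> d x; rewrite inE => /andP[_ dC]; exact: uni.
have pe : perm_eq (enum (X :\: (C :\ c))) (c :: enum (X :\: C)).
  apply: uniq_perm; first exact: enum_uniq.
    by rewrite /= mem_enum inE cC enum_uniq.
  by move=> x; rewrite in_cons !mem_enum !inE; case: eqVneq => [->|] //=; rewrite cX.
have memX Q x : Q \in pl -> x \in Q -> r c x.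
  move=> Qpl xQ; have : x \in X :\: C by rewrite (pcover_mem _ pc); apply/hasP; exists Q.
  rewrite inE => /andP[xC xX]; apply: uni => //; by apply: contraNneq xC => ->.
case: pl pc sz memX => [|P [|Q rest]] /andP[ok pf] sz memX.
- exists [:: [:: c]]; last by move: m0; rewrite /=; clear; lia.
  by rewrite /pcover /= perm_sym; apply: perm_trans pe _; rewrite perm_cons perm_sym.
- exists [:: c :: P]; last by move: m0; rewrite /=; clear; lia.
  rewrite /pcover /= andbT; apply/andP; split.
    move: ok => /= /andP[/andP[nP sP] _]; rewrite /gpath /=.
    by case: P nP sP memX {pf sz} => //= x P _ -> memX; rewrite (memX _ x (mem_head _ _)) ?mem_head.
  rewrite perm_sym; apply: perm_trans pe _; rewrite perm_cons perm_sym.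
  by move: pf; rewrite /=.
- exists ((P ++ c :: Q) :: rest); last by move: sz; rewrite cc /=; clear; lia.
  apply/andP; split; last first.
    rewrite perm_sym; apply: perm_trans pe _; rewrite perm_sym.
    apply: (@perm_trans _ (c :: flatten [:: P, Q & rest])); last by rewrite perm_cons.
    by rewrite /=; perm_count.
  move: ok => /= /and3P[gP gQ ->]; rewrite andbT.
  have [nP sP] := andP gP; have [nQ sQ] := andP gQ.
  apply: (@gpath_cat _ _ c) => //; last first.
    rewrite /= rsym; apply: (memX P); first exact: mem_head.
    by case: P nP {gP sP pf sz memX} => //= x P _; exact: mem_last.
  rewrite /gpath /=; case: Q nQ sQ memX {pf sz gQ} => //= x Q _ -> memX; rewrite andbT.
  by apply: (memX (x :: Q)); rewrite ?inE ?eqxx ?orbT.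
Qed.

Lemma prev_at_last (x z : T) p : x \notin p -> prev_at x x z p = last z p.
Proof.
elim: p z => [|w p IH] z /=; first by rewrite eqxx.
rewrite inE negb_or => /andP[/negbTE-> xp]; exact: IH.
Qed.

Lemma path_remove_edge r b (s : seq T) : uniq (b :: s) -> 2 < size (b :: s) ->
  path r b s -> path (remove_edge r (last b s) b) b s.
Proof.
case: s => //= d s /andP[bs us] s3 /andP[rbd pr]; apply/andP; split.
  rewrite /remove_edge rbd /=; apply/negP => /joins_pairP[[bl _]|[_ dl]].
    by move: bs; rewrite bl mem_last.
  by case: s s3 us dl {pr bs} => //= f s _ /andP[+ _] dl; rewrite {1}dl mem_last.
apply: (@sub_in_path _ (predC1 b)) pr => [u v ub vb ruv|].
  rewrite /remove_edge ruv /=; apply/negP => /joins_pairP[[_ vb']|[ub' _]].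
    by rewrite inE vb' eqxx in vb.
  by rewrite inE ub' eqxx in ub.
by apply/allP => u uin; apply: contraNneq bs => <-.
Qed.

(** Deleting an added edge of the cycle leaves a Hamiltonian path between its ends [b] and [a];
    their degree sum forces a crossing pair of edges, which closes the path up again. *)
Lemma hamiltonian_closure e r :
  symmetric e -> irreflexive e -> symmetric r -> irreflexive r -> subrel e r ->
  (forall u v, r u v -> ~~ e u v -> #|T| <= deg e u + deg e v) ->
  hamiltonian r -> hamiltonian e.
Proof.
move=> esym eirr; have [N] := ubnP (extra e r); elim: N r => // N IH r rN rsym rirr er ore [s [us s3 ms cs]].
have [ce|nce] := boolP (cycle e s); first by exists s.
have [b bs] : exists2 b, b \in s & ~~ e (prev s b) b.
  apply/allPn; apply: contra nce => /allP h; exact: cycle_from_prev.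
have [i s' rs] := rot_to bs.
have us' : uniq (b :: s') by rewrite -rs rot_uniq.
have bs' : b \notin s' by case/andP: us'.
have -> : prev s b = last b s'.
  by rewrite -(prev_rot i us) rs /= prev_at_last.
have ms' x : x \in b :: s' by rewrite -rs mem_rot.
have s3' : 2 < size (b :: s') by rewrite -rs size_rot.
have : cycle r (b :: s') by rewrite -rs rot_cycle.
rewrite /= rcons_path => /andP[pr rab]; set a := last b s' in rab *; move=> neab.
pose r' := remove_edge r a b.
have r'sym : symmetric r' := remove_edge_sym a b rsym.
have r'irr : irreflexive r' := remove_edge_irr a b rirr.
have er' : subrel e r' by exact: sub_remove_edge.
have lt : extra e r' < N by apply: leq_trans (extra_remove_edge rab neab) _.
have pr' : path r' b s' by exact: path_remove_edge.
apply: (IH r') => //; first by move=> u v /andP[ruv _]; exact: ore.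
have cnt (f : pred T) : count f (b :: s') = #|[set x | f x]|.
  rewrite -size_filter cardE; apply: perm_size; apply: uniq_perm.
  - exact: filter_uniq.
  - exact: enum_uniq.
  by move=> x; rewrite mem_filter ms' mem_enum inE andbT.
have [[A [c [d [B [E rac rbd]]]]]|none] := classic (exists A c d B,
    [/\ b :: s' = A ++ c :: d :: B, r' a c & r' b d]).
  exists (rcons A c ++ rev (d :: B)); split.
  - have : uniq (b :: s') by []. rewrite E -cat_rcons => u1.
    by apply: etrans u1; apply: perm_uniq; rewrite perm_cat2l perm_rev.
  - by rewrite size_cat size_rev -size_cat cat_rcons -E.
  - by move=> x; rewrite mem_cat mem_rev -mem_cat cat_rcons -E.
  have hb : forall z, head z (rcons A c) = b by case: A E => [|? ?] [].
  have la : forall z, last z (d :: B) = a.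
    move=> z; rewrite /a -[last b s']/(last b (b :: s')) E last_cat /=; by [].
  have sE : sorted r' (rcons A c ++ d :: B) by rewrite cat_rcons -E.
  have n1 : rcons A c != [::] by case: (A).
  rewrite (sorted_cat2 r' b) // in sE; case/and3P: sE => s1 _ s2.
  have nr : rev (d :: B) != [::] by rewrite rev_nil.
  have : sorted r' (rcons A c ++ rev (d :: B)).
    by rewrite (sorted_cat2 r' b) // s1 sorted_rev // s2 last_rcons head_rev la r'sym rac.
  case EA: (rcons A c) => [|z Z]; first by rewrite EA in n1.
  have zb : z = b by have := hb b; rewrite EA.
  rewrite /= rcons_path => -> /=; rewrite last_cat rev_cons last_rcons zb r'sym //.
have cr := count_cross (f := r' a) (g := r' b) (x := b) (A := s').
have : count (r' a) (b :: s') + count (r' b) (b :: s') <= size s'.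
  apply: leq_trans (cr _ _) _; [|by rewrite -/a r'irr|by rewrite r'irr addn0].
  move=> B1 c d B2 E; apply/negP => /andP[h1 h2]; apply: none; by exists B1, c, d, B2.
rewrite !cnt.
have := ore a b rab neab.
have le u : deg e u <= #|[set x | r' u x]|.
  by apply: subset_leq_card; apply/subsetP => x; rewrite !inE => /er'.
have cT : #|T| = (size s').+1.
  by rewrite -cardsT -[[set: T]]/([set: T]) -[RHS](count_predT (b :: s')) cnt; apply: eq_card => x; rewrite !inE.
move: (le a) (le b); rewrite cT; move: #|[set x | r' a x]| #|[set x | r' b x]| (deg e a) (deg e b) (size s'); clear; lia.
Qed.

End Closure.

(** * Minimum path covers *)

Lemma uniq_flatten_inj (T : eqType) (pl : seq (seq T)) x P Q :
  uniq (flatten pl) -> P \in pl -> Q \in pl -> x \in P -> x \in Q -> P = Q.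
Proof.
elim: pl => // A pl IH; rewrite /= cat_uniq => /and3P[_ /hasPn dis un].
have no B : B \in pl -> x \in A -> x \in B -> False.
  by move=> Bpl xA xB; have /dis : x \in flatten pl by [apply/flattenP; exists B]; rewrite xA.
rewrite !inE => /orP[/eqP->|Ppl] /orP[/eqP->|Qpl] xP xQ //.
- by case: (no Q).
- by case: (no P).
- exact: IH.
Qed.

(** Turns predicates such as reachability by a sequence of exchanges into finite sets. *)
Lemma ex_fset (T : finType) (P : T -> Prop) : exists A : {set T}, forall x, x \in A <-> P x.
Proof.
have h x : exists b : bool, b <-> P x.
  by case: (classic (P x)) => Px; [exists true|exists false].
have [f hf] := fin_all_exists h; exists [set x | f x] => x; rewrite inE; exact: hf.
Qed.

Section MinCover.
Variables (T : finType) (e : rel T) (X : {set T}).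
Hypotheses (esym : symmetric e) (eirr : irreflexive e).
Implicit Types (x y u v w z : T) (P Q : seq T) (pl : seq (seq T)).

Definition endof x P := (P != [::]) && ((x == head x P) || (x == last x P)).

Definition min_cover pl := pcover e X pl /\ forall pl', pcover e X pl' -> size pl <= size pl'.

Lemma endof_mem x P : endof x P -> x \in P.
Proof.
case: P => // a P /andP[_ /orP[/eqP->|/eqP->]]; rewrite /= ?mem_head // mem_last //.
Qed.

Lemma endof_orient x P : endof x P -> exists P1, perm_eq (x :: P1) P /\ (gpath e P -> gpath e (x :: P1)).
Proof.
case: P => // a P /andP[_ /orP[/eqP E|/eqP E]].
  by exists P; rewrite {1}E /=; split=> //; rewrite E.
case/lastP: P E => [|P b] /=; first by move=> E; exists [::]; rewrite E.
rewrite last_rcons => <-; exists (rev (a :: P)); rewrite -rev_rcons; split.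
  by rewrite perm_rev.
by rewrite gpath_rev.
Qed.

Lemma min_cover_uniq pl : min_cover pl -> uniq pl.
Proof.
move=> [pc _]; have un := pcover_uniq pc.
have ne : all (fun P => P != [::]) pl.
  by case/andP: pc => /allP ok _; apply/allP => P /ok /andP[].
elim: pl un ne {pc} => //= P pl IH; rewrite cat_uniq => /and3P[_ /hasPn dis un] /andP[nP ne].
rewrite IH // andbT; apply/negP => Ppl; case: P nP dis Ppl => // a P _ dis Ppl.
have /dis : a \in flatten pl by apply/flattenP; exists (a :: P); rewrite ?mem_head.
by rewrite mem_head.
Qed.

Lemma endof_nonadj pl P Q x y : min_cover pl -> P \in pl -> Q \in pl -> P != Q ->
  endof x P -> endof y Q -> ~~ e x y.
Proof.
move=> mc Ppl Qpl PQ xP yQ; have [pc mn] := mc; have un := min_cover_uniq mc.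
have [P1 [pP gP]] := endof_orient xP.
have p1 : perm_eq pl ([:: P] ++ rem P pl) by exact: perm_to_rem.
have g1 : gpath e P by case/andP: pc => /allP ok _; exact: ok.
have pc1 : pcover e X ((x :: P1) :: rem P pl).
  apply: (pcover_replace (new := [:: x :: P1]) (pcover_perm p1 pc)); first by rewrite /= gP.
  by rewrite /= !cats0.
apply: (min_end_nonadj (Q := Q) esym pc1).
- by move=> pl' /mn; rewrite (perm_size p1).
- by rewrite mem_rem_uniq // !inE eq_sym PQ.
case/andP: yQ; case: Q {Qpl PQ} => // a Q _ /orP[/eqP->|/eqP->]; [left|right] => //.
Qed.

Lemma ore_ends pl P P' x x' : min_cover pl -> P \in pl -> P' \in pl -> P != P' ->
  endof x P -> endof x' P' ->
  forall Q, Q \in pl -> count (e x) Q + count (e x') Q < size Q.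
Proof.
move=> mc Ppl P'pl PP' xP xP'; have [pc mn] := mc; have un := min_cover_uniq mc.
have [P1 [pP gP]] := endof_orient xP; have [P1' [pP' gP']] := endof_orient xP'.
pose rest := rem P' (rem P pl).
have p1 : perm_eq pl ([:: P; P'] ++ rest).
  apply: perm_trans (perm_to_rem Ppl) _; rewrite perm_cons; apply: perm_to_rem.
  by rewrite mem_rem_uniq // !inE eq_sym PP'.
have okQ Q : Q \in pl -> gpath e Q by case/andP: pc => /allP ok _; exact: ok.
have pc1 : pcover e X ((x :: P1) :: (x' :: P1') :: rest).
  apply: (pcover_replace (new := [:: x :: P1; x' :: P1']) (pcover_perm p1 pc)).
    by rewrite /= gP ?gP' // okQ.
  by rewrite /= !cats0 -cat_cons; apply: perm_cat.
have nosm pl' : pcover e X pl' -> (size rest).+1 < size pl'.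
  by move=> /mn; rewrite (perm_size p1).
have [h1 h2 h3] := ore_paths esym eirr pc1 nosm.
move=> Q; rewrite (perm_mem p1) !inE => /or3P[/eqP->|/eqP->|/h3 //].
- by rewrite -!(seq.permP pP) -(perm_size pP) /= ltnS.
- by rewrite -!(seq.permP pP') -(perm_size pP') /= ltnS.
Qed.

End MinCover.

(** * One-vertex paths in a minimum cover *)

Section SingletonPaths.
Variables (T : finType) (e : rel T) (X : {set T}).
Hypotheses (esym : symmetric e) (eirr : irreflexive e).
Implicit Types (x y u v w z : T) (P Q : seq T) (pl : seq (seq T)).

Definition nsing pl := count (fun P : seq T => size P == 1) pl.

Variable pl0 : seq (seq T).
Hypothesis mc0 : min_cover e X pl0.
Hypothesis nsing_min : forall pl, pcover e X pl -> size pl = size pl0 -> nsing pl0 <= nsing pl.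

Let good pl := [/\ pcover e X pl, size pl = size pl0 & nsing pl = nsing pl0].

(* Otherwise rerouting through [x z] would produce a minimum cover with fewer
   one-vertex paths. *)
Local Lemma single_nbr pl x z : good pl -> [:: x] \in pl -> z \in X -> e x z ->
  exists u w rest, perm_eq pl ([:: x] :: [:: u; z; w] :: rest).
Proof.
move=> [pc sz ns] xpl zX exz.
have p1 : perm_eq pl ([:: x] :: rem [:: x] pl) by exact: perm_to_rem.
have pc1 := pcover_perm p1 pc.
have [Q Qr zQ] : exists2 Q, Q \in rem [:: x] pl & z \in Q.
  move: zX; rewrite (pcover_mem _ pc1) /= inE; case: eqVneq => [zx|_ /hasP //].
  by rewrite zx eirr in exz.
have p2 : perm_eq (rem [:: x] pl) (Q :: rem Q (rem [:: x] pl)) by exact: perm_to_rem.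
set rest := rem Q _ in p2.
have p3 : perm_eq pl ([:: [:: x]; Q] ++ rest) by apply: perm_trans p1 _; rewrite /= perm_cons.
have pc3 := pcover_perm p3 pc.
have gQ : gpath e Q by move: pc3 => /andP[/allP ok _]; apply: ok; rewrite !inE eqxx orbT.
have nosm pl' : pcover e X pl' -> size (rem [:: x] pl) < size pl'.
  by case: mc0 => _ mn /mn; rewrite -sz (perm_size p1).
have szr : size pl0 = (size rest).+2 by rewrite -sz (perm_size p3).
have nsr : nsing pl0 = (size Q == 1) + nsing rest + 1.
  by rewrite -ns /nsing (seq.permP p3) /= addnC.
have [Q1 [Q2 QE]] : exists Q1 Q2, Q = Q1 ++ z :: Q2.
  by case/splitPr: zQ => Q1 Q2; exists Q1, Q2.
have nQ1 : Q1 != [::].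
  apply/eqP => Q10; have := min_end_nonadj esym pc1 nosm Qr (x := z).
  by rewrite QE Q10 exz => /(_ (or_introl erefl)).
have nQ2 : Q2 != [::].
  apply/eqP => Q20; have := min_end_nonadj esym pc1 nosm Qr (x := z).
  by rewrite QE Q20 last_cat exz => /(_ (or_intror erefl)).
have g1 : gpath e Q1 by apply: (@gpath_catl _ _ Q1 (z :: Q2)); rewrite -?QE.
have g2 : gpath e (z :: Q2) by apply: (@gpath_catr _ _ Q1); rewrite -?QE.
have g1' : gpath e (rcons Q1 z).
  by apply: (@gpath_catl _ _ _ Q2); rewrite ?cat_rcons -?QE //; case: (Q1).
have g2' : gpath e Q2 by apply: (@gpath_catr _ _ (rcons Q1 z)); rewrite ?cat_rcons -?QE.
(* If [A] is longer, the paths [A] and [x :: z :: B] may replace [[:: x]] and [A ++ z :: B]: as many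
   paths, but fewer one-vertex paths. *)
have try (A B : seq T) : gpath e A -> gpath e (z :: B) -> B != [::] -> perm_eq (A ++ z :: B) Q -> size A = 1.
  move=> gA gB nB pAB; apply/eqP; apply: contraT => sA.
  pose new := [:: A; x :: z :: B].
  have pn : pcover e X (new ++ rest).
    apply: (pcover_replace pc3).
      by rewrite /= gA /gpath /= exz; case/andP: gB => _ /= ->.
    rewrite /= !cats0; apply/seq.permP => f; have := seq.permP pAB f; rewrite !count_cat /=.
    by bool_lia.
  have := nsing_min pn; rewrite szr /= => /(_ erefl).
  rewrite nsr /nsing /= (negbTE sA) -(perm_size pAB) size_cat /=.
  by case: (B) nB => // b B' _ /=; rewrite !addnS /= ?addn0 ?add0n ltnn.
have s1 : size Q1 = 1 by apply: (try Q1 Q2) => //; rewrite QE.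
have s2 : size Q2 = 1.
  apply: (try Q2 (rev Q1)) => //.
  - by rewrite -rev_rcons gpath_rev.
  - by rewrite rev_nil.
  - by rewrite QE -rev_rcons; perm_count.
case: Q1 s1 QE {nQ1 g1 g1'} => [|u [|? ?]] // _ QE; case: Q2 s2 QE {nQ2 g2 g2'} => [|w [|? ?]] // _ QE.
by exists u, w, rest; rewrite -[[:: u; z; w]]QE.
Qed.

(** An exchange puts [x] in place of an end of the three-vertex path. It preserves the number of
    paths and of one-vertex paths, so [single_nbr] still applies afterwards. *)
Inductive reach : seq (seq T) -> Prop :=
| reach_base : reach pl0
| reach_left pl x u z w rest : reach pl -> perm_eq pl ([:: x] :: [:: u; z; w] :: rest) ->
    e x z -> reach ([:: u] :: [:: x; z; w] :: rest)
| reach_right pl x u z w rest : reach pl -> perm_eq pl ([:: x] :: [:: u; z; w] :: rest) ->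
    e x z -> reach ([:: w] :: [:: u; z; x] :: rest).

Local Lemma reach_good pl : reach pl -> good pl.
Proof.
elim=> [|{}pl x u z w rest _ [pc sz ns] pp exz|{}pl x u z w rest _ [pc sz ns] pp exz].
- by split=> //; case: mc0.
- have pc1 := pcover_perm pp pc; split.
  + apply: (pcover_replace (new := [:: [:: u]; [:: x; z; w]]) (old := [:: [:: x]; [:: u; z; w]]) pc1).
      have : gpath e [:: u; z; w] by move: pc1 => /andP[/allP ok _]; apply: ok; rewrite !inE eqxx orbT.
      by rewrite /gpath /= exz !andbT => /andP[].
    by apply/seq.permP => f /=; bool_lia.
  + by rewrite -sz (perm_size pp).
  + by rewrite -ns /nsing (seq.permP pp).
- have pc1 := pcover_perm pp pc; split.
  + apply: (pcover_replace (new := [:: [:: w]; [:: u; z; x]]) (old := [:: [:: x]; [:: u; z; w]]) pc1).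
      have : gpath e [:: u; z; w] by move: pc1 => /andP[/allP ok _]; apply: ok; rewrite !inE eqxx orbT.
      by rewrite /gpath /= (esym z x) exz !andbT => /andP[].
    by apply/seq.permP => f /=; bool_lia.
  + by rewrite -sz (perm_size pp).
  + by rewrite -ns /nsing (seq.permP pp).
Qed.

Let singleable v := exists2 pl, reach pl & [:: v] \in pl.

(** Middles never move. Once the path around [z] is touched, both of its initial ends are
    [singleable], because the exchange could have released either of them. *)
Local Lemma reach_triple pl a z b : reach pl -> [:: a; z; b] \in pl ->
  exists u w, [:: u; z; w] \in pl0 /\
    ([:: a; z; b] = [:: u; z; w] \/ (singleable u /\ singleable w)).
Proof.
move=> rp; elim: rp a z b => [a z b h|{}pl x u z w rest rp IH pp exz a z' b|{}pl x u z w rest rp IH pp exz a z' b].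
- by exists a, b; split=> //; left.
- rewrite !inE => /orP[/eqP //|/orP[/eqP[_ -> _]|h]]; last first.
    by apply: IH; rewrite (perm_mem pp) !inE h !orbT.
  have /IH[u0 [w0 [h0 h1]]] : [:: u; z; w] \in pl by rewrite (perm_mem pp) !inE eqxx orbT.
  exists u0, w0; split=> //; right; case: h1 => // -[<- <-]; split.
    by exists ([:: u] :: [:: x; z; w] :: rest); [exact: reach_left pp exz|rewrite mem_head].
  by exists ([:: w] :: [:: u; z; x] :: rest); [exact: reach_right pp exz|rewrite mem_head].
- rewrite !inE => /orP[/eqP //|/orP[/eqP[_ -> _]|h]]; last first.
    by apply: IH; rewrite (perm_mem pp) !inE h !orbT.
  have /IH[u0 [w0 [h0 h1]]] : [:: u; z; w] \in pl by rewrite (perm_mem pp) !inE eqxx orbT.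
  exists u0, w0; split=> //; right; case: h1 => // -[<- <-]; split.
    by exists ([:: u] :: [:: x; z; w] :: rest); [exact: reach_left pp exz|rewrite mem_head].
  by exists ([:: w] :: [:: u; z; x] :: rest); [exact: reach_right pp exz|rewrite mem_head].
Qed.

(* [R] collects the vertices that can be turned into one-vertex paths by exchanging
   one-vertex paths with end vertices of three-vertex paths. *)
Lemma singletons_closure : exists R : {set T},
  (forall x, [:: x] \in pl0 -> x \in R) /\
  forall v z, v \in R -> z \in X -> e v z ->
    exists u w, [/\ [:: u; z; w] \in pl0, u \in R & w \in R].
Proof.
have [R RP] := ex_fset singleable; exists R; split.
  by move=> x h; apply/RP; exists pl0 => //; exact: reach_base.
move=> v z /RP[pl rp vpl] zX evz.
have [u [w [rest pp]]] := single_nbr (reach_good rp) vpl zX evz.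
have /(reach_triple rp)[u0 [w0 [h0 h1]]] : [:: u; z; w] \in pl by rewrite (perm_mem pp) !inE eqxx orbT.
exists u0, w0; split=> //; apply/RP; case: h1 => [[E1 E2]|[]] //; rewrite -?E1 -?E2.
  by exists ([:: u] :: [:: v; z; w] :: rest); [exact: reach_left pp evz|rewrite mem_head].
by exists ([:: w] :: [:: u; z; v] :: rest); [exact: reach_right pp evz|rewrite mem_head].
Qed.

End SingletonPaths.

(** * A path cover of the vertices of non-maximum degree *)

Lemma count_le1 (A : eqType) (b : pred A) (s : seq A) : uniq s ->
  (forall x y, x \in s -> y \in s -> b x -> b y -> x = y) -> count b s <= 1.
Proof.
move=> us h; rewrite -size_filter.
have : {subset filter b s <= s} by exact: mem_subseq (filter_subseq _ _).
have : all b (filter b s) by exact: filter_all.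
have := filter_uniq b us; case: (filter b s) => [|x [|y l]] //= /andP[xyl _] /and3P[bx by_ _] sub.
by move: xyl; rewrite (h x y) ?mem_head // sub ?inE ?eqxx ?orbT.
Qed.

Lemma count_subpred (A : Type) (b o : pred A) (s : seq A) : subpred b o ->
  count o s = count b s + count (fun x => o x && ~~ b x) s.
Proof.
move=> bo; elim: s => //= x s ->; rewrite addnACA; congr (_ + _).
by have := bo x; case: (b x) => [->|]; case: (o x).
Qed.

Lemma half_le_sub_div (d a : nat) : 0 < a -> 2 * d <= a -> (2^-1 <= 1 - d%:R / a%:R :> rat)%R.
Proof.
move=> a0 h; have : (d%:R / a%:R <= 2^-1 :> rat)%R; last by lra.
by rewrite ler_pdivrMr ?ltr0n //; move: h; rewrite -(@ler_nat rat) natrM; lra.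
Qed.

Lemma halves_le (x y z : rat) : (2^-1 <= x -> 2^-1 <= y -> x + y <= z -> 1 <= z)%R.
Proof. lra. Qed.

Lemma two_ends_le (x y : rat) (a K d d' : nat) : 0 < a -> 2 * d <= K -> 2 * d' <= K ->
  (1 - d%:R / a%:R <= x -> 1 - d'%:R / a%:R <= y -> 2 - K%:R / a%:R <= x + y)%R.
Proof.
move=> a0 hd hd' hx hy.
have : (d%:R / a%:R + d'%:R / a%:R <= K%:R / a%:R :> rat)%R; last by lra.
rewrite -mulrDl ler_pM2r ?invr_gt0 ?ltr0n // -natrD ler_nat; lia.
Qed.

(** For many inner vertices: [I] of them weigh at least [1 - t / a] each, and the ends of [p - nb]
    paths at least [2 - K / a] per path. Both counts are at least [b], and by [K + t <= 2 * a] the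
    two weights add up to at least 1. *)
Lemma inner_arith (a t K I p nb b : nat) : 0 < a -> K + t <= 2 * a -> t <= a -> p <= I + 1 ->
  nb <= 1 -> b < p ->
  (b%:R <= (1 - t%:R / a%:R) * I%:R + (2 - K%:R / a%:R) * (p - nb)%N%:R :> rat)%R.
Proof.
move=> a0 Kt ta pI nb1 bp.
have a0' : (0 < a%:R :> rat)%R by rewrite ltr0n.
have t1 : (0 <= 1 - t%:R / a%:R :> rat)%R by rewrite subr_ge0 ler_pdivrMr // mul1r ler_nat.
have K2 : (0 <= 2 - K%:R / a%:R :> rat)%R.
  rewrite subr_ge0 ler_pdivrMr // -natrM ler_nat; lia.
have s1 : (1 <= (1 - t%:R / a%:R) + (2 - K%:R / a%:R) :> rat)%R.
  have : (K%:R / a%:R + t%:R / a%:R <= 2 :> rat)%R; last by lra.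
  by rewrite -mulrDl ler_pdivrMr // -natrD -natrM ler_nat.
have hI : (b%:R <= I%:R :> rat)%R by rewrite ler_nat; lia.
have hp : (b%:R <= (p - nb)%N%:R :> rat)%R by rewrite ler_nat; lia.
have b0 : (0 <= b%:R :> rat)%R by exact: ler0n.
apply: (@le_trans _ _ ((1 - t%:R / a%:R) * b%:R + (2 - K%:R / a%:R) * b%:R)%R).
  by rewrite -mulrDl ler_peMl.
by apply: lerD; apply: ler_wpM2l.
Qed.

(** For few inner vertices: the [2 * p] ends weigh at least [1 - 1 / a] each, against a target set
    of size [u] that contains the [I] inner vertices. *)
Lemma outer_arith (a u b I p n : nat) : 0 < a -> u <= b + I -> b < p -> I + 2 <= p ->
  n <= 3 * a -> I + 2 * p <= n -> (u%:R <= 2 * (1 - 1%:R / a%:R) * p%:R :> rat)%R.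
Proof.
move=> a0 ub bp Ip n3a In.
have a0' : (0 < a%:R :> rat)%R by rewrite ltr0n.
have key : u * a + 2 * p <= 2 * p * a.
  have [g gE] : exists g, p = I + 2 + g by exists (p - I - 2); lia.
  have h : u + (g + 3) <= 2 * p by lia.
  have : 2 * p <= (g + 3) * a by nia.
  nia.
have -> : (2 * (1 - 1%:R / a%:R) * p%:R = (2 * p%:R * a%:R - 2 * p%:R) / a%:R :> rat)%R.
  by field; rewrite lt0r_neq0.
rewrite ler_pdivlMr // lerBrDr; move: key; rewrite -(@ler_nat rat) natrD !natrM //.
Qed.

Section CoverBound.
Variables (T : finType) (e : rel T).
Hypotheses (esym : symmetric e) (eirr : irreflexive e) (crit : edge_critical e).
Notation Dl := (max_deg e).
Notation D := (max_vertices e).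
Variables (B : {set T}) (a : nat).
Hypotheses (DB : D \subset B) (B0 : 0 < #|B|).
Hypotheses (a_le : forall v, a <= deg e v) (a2 : 1 < a).
Notation X := (~: B).
Implicit Types (U : {set T}) (P Q : seq T) (x y v : T).

Definition dout U v := #|[set y in ~: U | e v y]|.
Definition pwt U P : rat := (\sum_(v <- P | v \notin U) wt e U v)%R.

Lemma pwt_ge0 U P : (0 <= pwt U P)%R.
Proof. by apply: sumr_ge0 => v _; exact: wt_ge0. Qed.

Lemma pwt_sum_lt U pl : B \subset U -> pcover e X pl ->
  (\sum_(P <- pl) pwt U P < #|U|%:R)%R.
Proof.
move=> BU /andP[_ pe]; rewrite /pwt -big_flatten (perm_big _ pe) /= big_enum_cond /=.
have -> : (\sum_(v in X | v \notin U) wt e U v = \sum_(v in ~: U) wt e U v)%R.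
  apply: eq_bigl => v; rewrite !inE andb_idl // => vU; apply: contra vU.
  by move/subsetP: BU; apply.
apply: wt_sum_lt => //; first exact: subset_trans BU.
exact: leq_trans (subset_leq_card BU).
Qed.

Lemma dout_count U pl v : B \subset U -> pcover e X pl ->
  dout U v = \sum_(P <- pl) count (fun y => (y \notin U) && e v y) P.
Proof.
move=> BU pc; have := pcover_count (fun y => (y \notin U) && e v y) pc.
rewrite sumnE big_map => <-; apply: eq_card => y; rewrite !inE.
by rewrite andbA; congr (_ && _); rewrite andb_idl //; apply: contra; move/subsetP: BU; apply.
Qed.

Lemma pwt_ends U x Q y : x \notin U -> y \notin U ->
  (wt e U x + wt e U y <= pwt U (x :: rcons Q y))%R.
Proof.
move=> xU yU; rewrite /pwt big_cons xU big_rcons /= yU lerD2l lerDr.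
by apply: sumr_ge0 => v _; exact: wt_ge0.
Qed.

Lemma wt_half U v K : dout U v <= K -> (1 - K%:R / a%:R <= wt e U v)%R.
Proof. by move=> h; apply: wt_lb => //; exact: ltnW. Qed.

Lemma size_ge2_ends P : 1 < size P -> exists x Q y, P = x :: rcons Q y.
Proof. by case: P => // x P; case/lastP: P => // Q y _; exists x, Q, y. Qed.

Lemma endof_first x Q : endof x (x :: Q).
Proof. by rewrite /endof /= eqxx. Qed.

Lemma endof_last x Q y : endof y (x :: rcons Q y).
Proof. by rewrite /endof /= last_rcons eqxx orbT. Qed.

Section MinimumCover.
Variable pl : seq (seq T).
Hypothesis mc : min_cover e X pl.

Let pc : pcover e X pl := proj1 mc.
Let un : uniq (flatten pl) := pcover_uniq pc.

Lemma cover_mem P v : P \in pl -> v \in P -> v \notin B.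
Proof.
move=> Ppl vP; have : v \in X by rewrite (pcover_mem _ pc); apply/hasP; exists P.
by rewrite inE.
Qed.

Lemma cover_gpath P : P \in pl -> gpath e P.
Proof. by move=> Ppl; move: pc => /andP[/allP ok _]; exact: ok. Qed.

Lemma cover_path_uniq P : P \in pl -> uniq P.
Proof.
move=> Ppl; move: un; have /perm_flatten/perm_uniq-> := perm_to_rem Ppl.
by rewrite /= cat_uniq => /and3P[].
Qed.

Variable R : {set T}.
Hypothesis R1 : forall x, [:: x] \in pl -> x \in R.
Hypothesis R2 : forall v z, v \in R -> z \in X -> e v z ->
    exists u w, [/\ [:: u; z; w] \in pl, u \in R & w \in R].

(** By [R2], the neighbours in [X] of a vertex of [R] are middles of hubs. Adding these middles to
    [B] gives every vertex of [R] full weight 1. *)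
Definition hub P := if P is [:: u; z; w] then (u \in R) && (w \in R) else false.
Definition hubs := [set z | has (fun P => hub P && (nth z P 1 == z)) pl].
Definition other P := (size P != 1) && ~~ hub P.
(** This is the bound of [ore_ends] for the neighbours of two ends on such a path. *)
Definition kst P := if other P then (size P).-1 else 0.
Definition excess := \sum_(P <- pl) kst P.
Definition hubU := B :|: hubs.

Local Lemma hub3 P : hub P -> exists u z w, [/\ P = [:: u; z; w], u \in R & w \in R].
Proof. by case: P => [|u [|z [|w [|? ?]]]] //= /andP[uR wR]; exists u, z, w. Qed.

Local Lemma hub_J u z w : [:: u; z; w] \in pl -> u \in R -> w \in R -> z \in hubs.
Proof.
by move=> h uR wR; rewrite inE; apply/hasP; exists [:: u; z; w] => //=; rewrite uR wR eqxx.
Qed.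

Local Lemma J_hub z : z \in hubs -> exists u w, [/\ [:: u; z; w] \in pl, u \in R & w \in R].
Proof.
rewrite inE => /hasP[P Ppl /andP[/hub3[u [z' [w [E uR wR]]]]]].
by rewrite {}E in Ppl *; rewrite /= => /eqP z'z; exists u, w; rewrite -z'z.
Qed.

Local Lemma J_path z P : z \in hubs -> P \in pl -> z \in P -> exists u w, P = [:: u; z; w] /\ hub P.
Proof.
move=> /J_hub[u [w [h uR wR]]] Ppl zP; exists u, w.
have -> : P = [:: u; z; w] by apply: (uniq_flatten_inj (x := z) un) => //; rewrite !inE eqxx orbT.
by rewrite /= uR wR.
Qed.

Local Lemma card_J : #|hubs| <= count hub pl.
Proof.
rewrite -size_filter; set s := filter hub pl.
pose f P := if P is [:: u; z; w] then Some z else None.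
have /leq_trans-> // : #|hubs| <= size (pmap f s); last first.
  by rewrite size_pmap count_size.
apply: leq_trans (card_size _); apply: subset_leq_card; apply/subsetP => z /J_hub[u [w [h uR wR]]].
by rewrite mem_pmap; apply/mapP; exists [:: u; z; w] => //; rewrite mem_filter h /= uR wR.
Qed.

Local Lemma wt_R v : v \in R -> wt e hubU v = 1%R.
Proof.
move=> vR; apply: wt1 => // y evy; rewrite inE; case: (boolP (y \in B)) => //= yB.
have yX : y \in X by rewrite inE.
by have [u [w [h uR wR]]] := R2 vR yX evy; exact: hub_J h uR wR.
Qed.

Local Lemma sizes : #|X| = count (fun P => size P == 1) pl + 3 * count hub pl + count other pl + excess.
Proof.
rewrite (pcover_card pc) sumnE big_map -!sum1_count [in RHS]big_mkcond.
rewrite [\sum_(_ <- _ | hub _) 1]big_mkcond [\sum_(_ <- _ | other _) 1]big_mkcond /=.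
rewrite big_distrr -!big_split /=; apply: eq_big_seq => P Ppl.
have /andP[nP _] := cover_gpath Ppl.
rewrite /kst /other; have [/hub3[u [z [w [-> _ _]]]]|nh] := boolP (hub P); first by [].
by case: P nP {nh Ppl} => // x [|y P].
Qed.

Local Lemma numbers : size pl = count (fun P => size P == 1) pl + count hub pl + count other pl.
Proof.
rewrite -[LHS](count_predT pl) -!sum1_count [in RHS]big_mkcond [in LHS]big_mkcond /=.
rewrite [\sum_(_ <- _ | hub _) 1]big_mkcond [\sum_(_ <- _ | other _) 1]big_mkcond /=.
rewrite -!big_split /=; apply: eq_big_seq => P Ppl.
rewrite /other; have [/hub3[u [z [w [-> _ _]]]]|nh] := boolP (hub P); first by [].
by case: (size P == 1).
Qed.

(** One-vertex paths and hubs contribute nothing: their ends are not adjacent to ends of different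
    paths, and the middle of a hub lies in [hubU]. *)
Local Lemma dout_pair P P' x x' : P \in pl -> P' \in pl -> other P -> other P' -> P != P' ->
  endof x P -> endof x' P' -> dout hubU x + dout hubU x' <= excess.
Proof.
move=> Ppl P'pl oP oP' PP' xP xP'; have BU : B \subset hubU by exact: subsetUl.
rewrite !(dout_count _ BU pc) -big_split /= big_seq [leqRHS]big_seq; apply: leq_sum => Q Qpl.
rewrite /kst; case: ifP => oQ.
  have lt := ore_ends esym eirr mc Ppl P'pl PP' xP xP' Qpl.
  have : count (e x) Q + count (e x') Q <= (size Q).-1 by move: lt; case: (size Q).
  by apply: leq_trans; apply: leq_add; apply: sub_count => y /andP[].
have none P0 x0 : P0 \in pl -> other P0 -> endof x0 P0 -> count (fun y => (y \notin hubU) && e x0 y) Q = 0.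
  move=> P0pl oP0 x0P0; have P0Q : P0 != Q by apply: contraTneq oP0 => ->; rewrite oQ.
  have nadj y : endof y Q -> ~~ e x0 y by exact: endof_nonadj mc P0pl Qpl P0Q x0P0.
  apply/eqP; rewrite -leqn0 leqNgt -has_count; apply/hasPn => y yQ; rewrite negb_and.
  move/negbT: oQ; rewrite /other negb_and !negbK => /orP[sQ|hQ].
    by rewrite orbC nadj //; case: Q sQ yQ {Qpl P0Q nadj} => [|q [|? ?]] //= _; rewrite inE => /eqP->; rewrite /endof /= eqxx.
  have [u [z [w [QE uR wR]]]] := hub3 hQ.
  have : [|| y == u, y == z | y == w] by move: yQ; rewrite QE !inE.
  case/or3P => /eqP->.
  - by rewrite orbC nadj // QE endof_first.
  - by rewrite in_setU (hub_J (u := u) (w := w)) ?orbT // -QE.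
  - by rewrite orbC nadj // QE (endof_last u [:: z]).
by rewrite (none P) // (none P').
Qed.

(** One-vertex paths weigh 1, hubs at least 2, and other paths at least 1 through their two ends,
    with at most one bad exception. The second unit of a hub pays for its middle in [hubU], and
    strictness in [pwt_sum_lt] pays for the bad path. *)
Lemma cover_bound_small : excess <= a -> size pl <= #|B|.
Proof.
move=> Ka; have BU : B \subset hubU by exact: subsetUl.
pose bad P := other P && has (fun v => endof v P && (excess < 2 * dout hubU v)) P.
have bad1 : count bad pl <= 1.
  apply: count_le1; first exact: (min_cover_uniq mc).
  move=> P P' Ppl P'pl /andP[oP /hasP[v vP /andP[eP lt]]] /andP[oP' /hasP[v' vP' /andP[eP' lt']]].
  apply/eqP; apply: contraT => PP'.
  have := dout_pair Ppl P'pl oP oP' PP' eP eP'; move: lt lt'.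
  move: (dout hubU v) (dout hubU v') excess; clear; lia.
pose g P := (size P == 1) + 2 * hub P + (other P && ~~ bad P).
have notJ v P : P \in pl -> v \in P -> (forall u w, P = [:: u; v; w] -> ~~ hub P) -> v \notin hubU.
  move=> Ppl vP h; rewrite inE negb_or (cover_mem Ppl vP) /=.
  apply/negP => vJ; have [u [w [E hP]]] := J_path vJ Ppl vP.
  by have := h u w E; rewrite hP.
have gle P : P \in pl -> ((g P)%:R <= pwt hubU P)%R.
  move=> Ppl; have up := cover_path_uniq Ppl; have /andP[nP _] := cover_gpath Ppl.
  have [hP|nh] := boolP (hub P).
    have [u [z [w [PE uR wR]]]] := hub3 hP.
    have -> : g P = 2 by rewrite /g /other hP PE.
    move: up; rewrite PE /= !inE negb_or => /andP[/andP[uz uw] /andP[zw _]].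
    have uU : u \notin hubU.
      by apply: (notJ u P) => //; rewrite PE ?mem_head // => u' w' [_ zu]; rewrite zu eqxx in uz.
    have wU : w \notin hubU.
      by apply: (notJ w P) => //; rewrite PE ?inE ?eqxx ?orbT // => u' w' [_ zw']; rewrite zw' eqxx in zw.
    by have := pwt_ends [:: z] uU wU; rewrite /= !wt_R.
  have [s1|s1] := boolP (size P == 1).
    have -> : g P = 1 by rewrite /g s1 (negbTE nh) /other s1.
    case: P s1 Ppl {up nP nh} => [|x [|? ?]] // _ Ppl.
    have xU : x \notin hubU by apply: (notJ x [:: x]) => //; rewrite mem_head.
    by rewrite /pwt big_cons big_nil xU addr0 wt_R // R1.
  have oP : other P by rewrite /other s1 nh.
  have -> : g P = ~~ bad P by rewrite /g (negbTE s1) (negbTE nh) oP.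
  have [bP|nb] := boolP (bad P); first by rewrite /= pwt_ge0.
  have sP : 1 < size P by case: P nP s1 {up nh oP nb Ppl} => // x [|].
  have [x [Q [y PE]]] := size_ge2_ends sP.
  have good v : v \in P -> endof v P -> (2^-1 <= wt e hubU v)%R.
    move=> vP ev; have dv : 2 * dout hubU v <= a.
      apply: leq_trans Ka; rewrite leqNgt; apply: contra nb => lt.
      by rewrite /bad oP; apply/hasP; exists v => //; rewrite ev lt.
    apply: le_trans (wt_half (leqnn _)).
    by apply: half_le_sub_div => //; exact: ltnW.
  have xP : x \in P by rewrite PE mem_head.
  have yP : y \in P by rewrite PE inE mem_rcons mem_head orbT.
  have eU v : v \in P -> v \notin hubU by move=> vP; apply: (notJ v P).
  have ex : endof x P by rewrite PE endof_first.
  have ey : endof y P by rewrite PE endof_last.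
  apply: halves_le (good _ xP ex) (good _ yP ey) _.
  by have := pwt_ends Q (eU _ xP) (eU _ yP); rewrite -PE.
have := pwt_sum_lt BU pc.
have le1 : ((\sum_(P <- pl) g P)%:R <= \sum_(P <- pl) pwt hubU P)%R.
  by rewrite natr_sum big_seq [leRHS]big_seq; apply: ler_sum.
move=> /(le_lt_trans le1); rewrite ltr_nat /hubU cardsU.
have -> : \sum_(P <- pl) g P = count (fun P => size P == 1) pl + 2 * count hub pl
     + (count other pl - count bad pl).
  have -> : count other pl - count bad pl = count (fun P => other P && ~~ bad P) pl.
    by rewrite (@count_subpred _ bad other) ?addKn // => P /andP[].
  rewrite -!sum1_count [in RHS]big_mkcond.
  rewrite [\sum_(_ <- _ | hub _) 1]big_mkcond [\sum_(_ <- _ | _ && _) 1]big_mkcond /=.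
  rewrite big_distrr -!big_split /=; apply: eq_bigr => P _; rewrite /g.
  by case: (size P == 1); case: (hub P); case: (other P && ~~ bad P).
have := card_J; have := numbers; move: bad1.
move: #|hubs| #|B| #|B :&: hubs| (count _ _) (count hub pl) (count other pl) (count bad pl) (size pl).
clear; lia.
Qed.

Lemma cover_singleton x : [:: x] \in pl -> a <= #|B| + count hub pl.
Proof.
move=> xpl; apply: leq_trans (a_le x) _; apply: leq_trans (_ : #|hubU| <= _); last first.
  by rewrite /hubU cardsU; apply: leq_trans (leq_subr _ _) _; rewrite leq_add2l card_J.
apply: subset_leq_card; apply/subsetP => y; rewrite inE => exy; rewrite inE.
case: (boolP (y \in B)) => //= yB.
have yX : y \in X by rewrite inE.
by have [u [w [h uR wR]]] := R2 (R1 xpl) yX exy; exact: hub_J h uR wR.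
Qed.

Lemma cover_K : excess + size pl + 2 * count hub pl = #|X|.
Proof. rewrite sizes numbers; move: excess (count _ _) (count hub pl) (count other pl); clear; lia. Qed.

End MinimumCover.

Lemma endof_two x Q y v : endof v (x :: rcons Q y) -> v = x \/ v = y.
Proof. by rewrite /endof /= last_rcons => /orP[/eqP|/eqP]; auto. Qed.

Section NoSingleton.
Variable pl : seq (seq T).
Hypotheses (mc : min_cover e X pl) (ns : nsing pl = 0).

Let pc : pcover e X pl := proj1 mc.

Lemma long_path P : P \in pl -> exists x Q y, P = x :: rcons Q y.
Proof.
move=> Ppl; apply: size_ge2_ends; have /andP[nP _] := cover_gpath mc Ppl.
have : size P != 1.
  apply/negP => s1; suff : 0 < nsing pl by rewrite ns.
  by rewrite -has_count; apply/hasP; exists P.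
by case: P nP {Ppl} => // x [|].
Qed.

Lemma sum_inner : #|X| = \sum_(P <- pl) (size P - 2) + 2 * size pl.
Proof.
rewrite (pcover_card pc) sumnE big_map -[size pl]count_predT -sum1_count big_distrr /= -big_split /=.
by apply: eq_big_seq => P /long_path[x [Q [y ->]]]; rewrite /= size_rcons; clear; lia.
Qed.

(** Discharging to [B] alone, with inner vertices contributing as well. [K] is the number of
    consecutive pairs in the cover, hence the Ore bound for two ends of different paths. *)
Lemma cover_bound_inner (t K : nat) : (forall v, v \notin B -> dout B v <= t) ->
  K + size pl = #|X| -> K + t <= 2 * a -> t <= a ->
  size pl <= \sum_(P <- pl) (size P - 2) + 1 -> size pl <= #|B|.
Proof.
move=> ht KX Kt ta pI; rewrite leqNgt; apply/negP => Bp.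
pose bad P := has (fun v => endof v P && (K < 2 * dout B v)) P.
have bad1 : count bad pl <= 1.
  apply: count_le1; first exact: (min_cover_uniq mc).
  move=> P P' Ppl P'pl /hasP[v vP /andP[eP lt]] /hasP[v' vP' /andP[eP' lt']].
  apply/eqP; apply: contraT => PP'.
  suff : dout B v + dout B v' <= K by move: lt lt'; move: (dout B v) (dout B v'); clear; lia.
  have leS : dout B v + dout B v' <= \sum_(Q <- pl) (size Q - 1).
    rewrite !(dout_count _ (subxx B) pc) -big_split /= big_seq [leqRHS]big_seq; apply: leq_sum => Q Qpl.
    have lt2 := ore_ends esym eirr mc Ppl P'pl PP' eP eP' Qpl.
    have : count (e v) Q + count (e v') Q <= size Q - 1 by move: lt2; move: (size Q); clear; lia.
    by apply: leq_trans; apply: leq_add; apply: sub_count => y /andP[].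
  apply: leq_trans leS _; rewrite -(leq_add2r (size pl)) KX (pcover_card pc) sumnE big_map.
  rewrite -[size pl]count_predT -sum1_count -big_split /= big_seq [leqRHS]big_seq.
  by apply: leq_sum => Q /long_path[x [Q' [y ->]]]; rewrite /= size_rcons; clear; lia.
have a0 : 0 < a by exact: ltnW.
have le1 P : P \in pl ->
   ((1 - t%:R / a%:R) * (size P - 2)%N%:R + (2 - K%:R / a%:R) * (~~ bad P)%:R <= pwt B P)%R.
  move=> Ppl; have [x [Q [y PE]]] := long_path Ppl.
  have vB v : v \in P -> v \notin B by exact: (cover_mem mc Ppl).
  have xP : x \in P by rewrite PE mem_head.
  have yP : y \in P by rewrite PE inE mem_rcons mem_head orbT.
  have -> : size P - 2 = size Q by rewrite PE /= size_rcons; clear; lia.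
  have -> : (pwt B P = (wt e B x + wt e B y) + \sum_(v <- Q) wt e B v)%R.
    have EQ : (\sum_(v <- Q | v \notin B) wt e B v = \sum_(v <- Q) wt e B v)%R.
      rewrite big_seq_cond [RHS]big_seq; apply: eq_bigl => v; rewrite andb_idr // => vQ.
      by apply: vB; rewrite PE inE mem_rcons inE vQ !orbT.
    rewrite /pwt PE big_cons vB // big_rcons /= vB // EQ; ring.
  rewrite addrC; apply: lerD; last first.
    have -> : ((1 - t%:R / a%:R) * (size Q)%:R = \sum_(v <- Q) (1 - t%:R / a%:R) :> rat)%R.
      by rewrite big_const_seq count_predT iter_addr addr0 mulr_natr.
    rewrite big_seq [leRHS]big_seq; apply: ler_sum => v vQ; apply: wt_half => //.
    by apply: ht; apply: vB; rewrite PE inE mem_rcons inE vQ !orbT.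
  have [bP|nb] := boolP (bad P); first by rewrite mulr0 addr_ge0 // wt_ge0.
  rewrite mulr1.
  have good v : v \in P -> endof v P -> 2 * dout B v <= K.
    move=> vP ev; rewrite leqNgt; apply: contra nb => lt.
    by apply/hasP; exists v => //; rewrite ev.
  have gx : 2 * dout B x <= K by apply: good; rewrite // PE endof_first.
  have gy : 2 * dout B y <= K by apply: good; rewrite // PE endof_last.
  apply: two_ends_le a0 gx gy _ _; exact: wt_half.
have := pwt_sum_lt (subxx B) pc; apply/negP; rewrite -leNgt.
apply: (@le_trans _ _ ((1 - t%:R / a%:R) * (\sum_(P <- pl) (size P - 2))%N%:R
    + (2 - K%:R / a%:R) * (size pl - count bad pl)%N%:R)%R); last first.
  have -> : size pl - count bad pl = \sum_(P <- pl) ~~ bad P.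
    rewrite -(count_predC bad) addKn -sum1_count big_mkcond /=; apply: eq_bigr => P _.
    by case: (bad P).
  rewrite !natr_sum !mulr_sumr -big_split /= big_seq [leRHS]big_seq.
  by apply: ler_sum => P /le1.
exact: inner_arith.
Qed.

(** Inner vertices join the target set. An end then has at most one neighbour outside it, the other
    end of its own path, as ends of different paths are nonadjacent. *)
Lemma cover_bound_outer (n : nat) : #|X| <= n -> n <= 3 * a ->
  \sum_(P <- pl) (size P - 2) + 2 <= size pl -> size pl <= #|B|.
Proof.
move=> Xn n3a Ip; rewrite leqNgt; apply/negP => Bp.
pose U := B :|: [set v in X | ~~ has (endof v) pl].
have BU : B \subset U by exact: subsetUl.
have cU : #|U| <= #|B| + \sum_(P <- pl) (size P - 2).
  rewrite cardsU; apply: leq_trans (leq_subr _ _) _; rewrite leq_add2l.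
  rewrite (pcover_count (fun v => ~~ has (endof v) pl) pc) sumnE big_map big_seq [leqRHS]big_seq.
  apply: leq_sum => P Ppl; have [x [Q [y PE]]] := long_path Ppl.
  have hx : has (endof x) pl by apply/hasP; exists P; rewrite // PE endof_first.
  have hy : has (endof y) pl by apply/hasP; exists P; rewrite // PE endof_last.
  rewrite PE /= size_rcons -cats1 count_cat /= hx hy /= !addn0 add0n subSS subn1 /=.
  exact: count_size.
have a0 : 0 < a by exact: ltnW.
have le1 P : P \in pl -> (2 * (1 - 1%:R / a%:R) <= pwt U P)%R.
  move=> Ppl; have [x [Q [y PE]]] := long_path Ppl.
  have xP : x \in P by rewrite PE mem_head.
  have yP : y \in P by rewrite PE inE mem_rcons mem_head orbT.
  have ex : endof x P by rewrite PE endof_first.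
  have ey : endof y P by rewrite PE endof_last.
  have vU v : v \in P -> endof v P -> v \notin U.
    move=> vP ev; rewrite !inE (negbTE (cover_mem mc Ppl vP)) /= negbK.
    by apply/hasP; exists P.
  have nb v w : endof v P -> w \in [set w in ~: U | e v w] -> endof w P.
    move=> ev; rewrite !inE negb_or negb_and !negbK => /andP[/andP[wB]].
    rewrite (negbTE wB) /= => /hasP[Q' Q'pl ew] evw.
    have [-> //|PQ] := eqVneq P Q'.
    by have := endof_nonadj esym mc Ppl Q'pl PQ ev ew; rewrite evw.
  have dx : dout U x <= 1.
    rewrite -(cards1 y); apply: subset_leq_card; apply/subsetP => w hw; rewrite inE.
    have := nb x w ex hw; rewrite PE => /endof_two[wx|->//].
    by move: hw; rewrite wx inE eirr andbF.
  have dy : dout U y <= 1.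
    rewrite -(cards1 x); apply: subset_leq_card; apply/subsetP => w hw; rewrite inE.
    have := nb y w ey hw; rewrite PE => /endof_two[->//|wy].
    by move: hw; rewrite wy inE eirr andbF.
  have := pwt_ends Q (vU _ xP ex) (vU _ yP ey); rewrite -PE; apply: le_trans.
  by rewrite mulr2n mulrDl mul1r; apply: lerD; exact: wt_half.
have := pwt_sum_lt BU pc; apply/negP; rewrite -leNgt.
apply: (@le_trans _ _ ((2 * (1 - 1%:R / a%:R)) * (size pl)%:R)%R); last first.
  have -> : ((2 * (1 - 1%:R / a%:R)) * (size pl)%:R = \sum_(P <- pl) (2 * (1 - 1%:R / a%:R)) :> rat)%R.
    by rewrite big_const_seq count_predT iter_addr addr0 mulr_natr.
  by rewrite big_seq [leRHS]big_seq; apply: ler_sum.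
apply: (outer_arith a0 cU Bp Ip n3a); move: Xn; rewrite sum_inner; exact.
Qed.

End NoSingleton.

Hypotheses (h1 : Dl < #|D| + a) (h3 : 2 * #|T| <= 3 * Dl).
Hypothesis hint : forall v, v \notin B -> dout B v + a + #|D| < #|T|.

(** Suppose there are more than [#|B|] paths. If a one-vertex path occurs, [cover_singleton] forces
    [excess <= a]. Otherwise [R] is taken empty, and [a < excess] forces [#|D| < a], hence
    [#|T| <= 3 * a], as the two remaining bounds require. *)
Lemma exists_cover : exists2 pl, pcover e X pl & size pl <= #|B|.
Proof.
have [p [[pl1 [pc1 sp1]] pmin]] : exists p, (exists pl, pcover e X pl /\ size pl = p) /\
    forall k, (exists pl, pcover e X pl /\ size pl = k) -> p <= k.
  apply: ex_least; exists (size [seq [:: x] | x <- enum X]); eexists; split; last by [].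
  apply/andP; split; first by apply/allP => P /mapP[x _ ->].
  by have -> : flatten [seq [:: x] | x <- enum X] = enum X by elim: (enum X) => //= x s ->.
have [q [[pl [pc [sp sq]]] qmin]] : exists q, (exists pl, pcover e X pl /\ size pl = p /\ nsing pl = q) /\
    forall k, (exists pl, pcover e X pl /\ size pl = p /\ nsing pl = k) -> q <= k.
  by apply: ex_least; exists (nsing pl1), pl1.
have mc : min_cover e X pl.
  by split=> // pl' pc'; rewrite sp; apply: pmin; exists pl'.
have nmin pl' : pcover e X pl' -> size pl' = size pl -> nsing pl <= nsing pl'.
  by move=> pc' s'; rewrite sq; apply: qmin; exists pl'; split=> //; rewrite s'.
have [//|Bp] := leqP (size pl) #|B|; first by exists pl.
exfalso; suff : size pl <= #|B| by rewrite leqNgt Bp.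
have mB : #|D| <= #|B| by exact: subset_leq_card.
have cX : #|X| + #|B| = #|T| by rewrite addnC cardsC.
have [s0|s1] := posnP (nsing pl); last first.
  have [R [R1 R2]] := singletons_closure esym eirr mc nmin.
  have [x xpl] : exists x, [:: x] \in pl.
    by move: s1; rewrite -has_count => /hasP[[|x [|? ?]] // Ppl _]; exists x.
  apply: (cover_bound_small mc R1 R2).
  have := cover_K mc R; have := cover_singleton R1 R2 xpl.
  move: mB cX Bp h1 h3; move: (excess _ _) (count _ _) (size pl) #|D| #|X| #|B| #|T| Dl; clear; lia.
have R1 x : [:: x] \in pl -> x \in (set0 : {set T}).
  move=> xpl; move: s0; rewrite /nsing => /eqP; rewrite -leqn0 leqNgt -has_count => /hasPn/(_ _ xpl).
  by [].
have R2 v z : v \in (set0 : {set T}) -> z \in X -> e v z ->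
    exists u w, [/\ [:: u; z; w] \in pl, u \in (set0 : {set T}) & w \in (set0 : {set T})].
  by rewrite inE.
have [Ka|Ka] := leqP (excess pl set0) a; first exact: (cover_bound_small mc R1 R2).
have hub0 : count (hub set0) pl = 0.
  by apply/eqP; rewrite -leqn0 leqNgt -has_count; apply/hasPn => -[|u [|z [|w [|? ?]]]] //=; rewrite inE.
have := cover_K mc set0; rewrite hub0 muln0 addn0 => KX.
have [pI|Ip] := leqP (size pl) (\sum_(P <- pl) (size P - 2) + 1).
  apply: (cover_bound_inner mc s0 (t := #|T| - a - #|D| - 1) _ KX _ _ pI).
  - move=> v /hint; move: (dout B v) #|D| #|T|; clear; lia.
  - move: mB cX Bp h1 h3 KX Ka; move: (excess _ _) (size pl) #|D| #|X| #|B| #|T| Dl; clear; lia.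
  - move: mB cX Bp h1 h3 KX Ka; move: (excess _ _) (size pl) #|D| #|X| #|B| #|T| Dl; clear; lia.
apply: (cover_bound_outer mc s0 (n := #|T|)).
- move: cX; move: #|X| #|B| #|T|; clear; lia.
- move: mB cX Bp h1 h3 KX Ka; move: (excess _ _) (size pl) #|D| #|X| #|B| #|T| Dl; clear; lia.
- by move: Ip; rewrite addn1 addn2.
Qed.

End CoverBound.

(* Vertices with many neighbours of non-maximum degree may be joined to everything
   (set [C]), so that the remaining ones have few of them. *)
Lemma critical_path_cover (T : finType) (e : rel T) :
  symmetric e -> irreflexive e -> edge_critical e -> 2 * #|T| <= 3 * max_deg e ->
  0 < max_deg e ->
  exists2 pl, pcover e (~: max_vertices e) pl & size pl <= #|max_vertices e|.
Proof.
move=> esym eirr crit h3 Dl0; set D := max_vertices e; set X := ~: D.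
have [v0 _] : exists v, 0 < deg e v.
  apply/existsP; apply: contraTT Dl0; rewrite negb_exists => /forallP h.
  rewrite -leqNgt; apply/bigmax_leqP => v _; rewrite leqNgt; exact: h.
pose x0 := [arg min_(v < v0) deg e v]; pose a := deg e x0.
have a_le v : a <= deg e v by rewrite /a /x0; case: arg_minnP => // i _; apply.
have a2 : 1 < a by exact: critical_deg_ge2.
have h1 : max_deg e < #|D| + a by exact: card_max_vertices.
have D0 : 0 < #|D|.
  by have := deg_le_max e x0; rewrite -/a; move: h1; clear; lia.
(* The threshold is that of [pcover_closure] with [m = #|D|]: any vertex has at least [a - #|D|]
   neighbours in [X], and [#|D| + (#|T| - a - #|D|) + (a - #|D|) = #|X|]. *)
pose C := [set v in X | #|T| <= dout e D v + a + #|D|].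
pose B := D :|: C.
have DB : D \subset B by exact: subsetUl.
have CX : C \subset X by apply/subsetP => v; rewrite inE => /andP[].
have dis : D :&: C = set0.
  by apply/setP => v; rewrite !inE; case: (deg e v == _).
have cB : #|B| = #|D| + #|C| by rewrite cardsU dis cards0 subn0.
have B0 : 0 < #|B| by apply: leq_trans D0 _; exact: subset_leq_card.
have hint v : v \notin B -> dout e B v + a + #|D| < #|T|.
  move=> vB; have : v \notin C by apply: contra vB => vC; rewrite inE vC orbT.
  have vX : v \in X by rewrite inE; apply: contra vB; apply/subsetP.
  rewrite inE vX /= -ltnNge; apply: leq_ltn_trans; rewrite !leq_add2r; apply: subset_leq_card.
  apply/subsetP => y; rewrite inE => /andP[yB evy]; rewrite inE evy andbT.
  by move: yB; rewrite !in_setC; apply: contra => yD; rewrite inE yD.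
have [pl pc sz] := exists_cover esym eirr crit DB B0 a_le a2 h1 h3 hint.
pose r u v := e u v || (u != v) && ((u \in C) || (v \in C)).
have er : subrel e r by move=> u v euv; rewrite /r euv.
have rsym : symmetric r by move=> u v; rewrite /r esym eq_sym orbC [(u \in C) || _]orbC orbC.
have rirr : irreflexive r by move=> u; rewrite /r eirr eqxx.
have cX : #|X| + #|D| = #|T| by rewrite addnC cardsC.
have dX v : #|[set x in X | e v x]| = dout e D v by [].
have dXa v : a <= #|[set x in X | e v x]| + #|D|.
  apply: leq_trans (a_le v) _; rewrite /deg -(cardsID D [set y | e v y]) addnC leq_add //.
    by apply: subset_leq_card; apply/subsetP => y; rewrite !inE => /andP[-> ->].
  by apply: subset_leq_card; exact: subsetIr.
apply: (@pcover_closure _ e r X #|D|) => //.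
- move=> u v uX vX ruv neuv; move: ruv; rewrite /r (negbTE neuv) /= => /andP[_ /orP[]].
  + rewrite inE -dX => /andP[_ hu]; have := dXa v; move: hu cX.
    move: #|[set x in X | e u x]| #|[set x in X | e v x]| #|X| #|D| #|T| (a); clear; lia.
  + rewrite inE -dX => /andP[_ hu]; have := dXa u; move: hu cX.
    move: #|[set x in X | e u x]| #|[set x in X | e v x]| #|X| #|D| #|T| (a); clear; lia.
apply: (@pcover_universal _ r X C pl #|D|) => //.
- by move=> c x cC xX xc; rewrite /r cC eq_sym xc orbT.
- have -> : X :\: C = ~: B by rewrite /X /B setCU setDE.
  move/andP: pc => [/allP ok pe]; apply/andP; split=> //; apply/allP => P /ok /andP[nP sP].
  by rewrite /gpath nP; apply: sub_sorted sP.
- by rewrite -cB.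
Qed.

(** * Rotations and private neighbours *)

Section Rotation.
Variables (T : finType) (e : rel T) (X : {set T}).
Hypotheses (esym : symmetric e) (eirr : irreflexive e).
Implicit Types (x y s v w z : T) (P Q A B : seq T) (pl : seq (seq T)).

Fixpoint adj1 P a b := if P is x :: Q then
  (if Q is y :: _ then joins x y a b else false) || adj1 Q a b else false.

Definition adj pl a b := has (fun P => adj1 P a b) pl.

(* A one-vertex path counts as two ends. *)
Definition ends1 P s := (ohead P == Some s) + (ohead (rev P) == Some s).

Definition slots pl s := \sum_(P <- pl) ends1 P s.

Lemma adj1_cat A x y B a b :
  adj1 (rcons A x ++ y :: B) a b = [|| adj1 (rcons A x) a b, joins x y a b | adj1 (y :: B) a b].
Proof.
elim: A => [|c A IH]; first by [].
rewrite /= IH; case: A {IH} => [|d A]; rewrite /= ?orbA ?orbF //.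
Qed.

Lemma adj1C P a b : adj1 P a b = adj1 P b a.
Proof. by elim: P => //= x [|y P] -> //; rewrite joinsC. Qed.

Lemma joins_swap x y a b : joins x y a b = joins y x a b.
Proof. by rewrite /joins orbC. Qed.

Lemma adj1_rev P a b : adj1 (rev P) a b = adj1 P a b.
Proof.
elim: P => // x P IH; rewrite rev_cons; case: P IH => [|y P] //= IH.
by rewrite rev_cons -cats1 adj1_cat -rev_cons IH /= orbF orbC joins_swap.
Qed.

Lemma adj1_mem P a b : adj1 P a b -> (a \in P) && (b \in P).
Proof.
elim: P => // x P IH /= /orP[|/IH /andP[aP bP]]; last by rewrite !inE aP bP !orbT.
by case: P {IH} => // y P /joins_pairP[[-> ->]|[-> ->]]; rewrite !inE !eqxx !orbT.
Qed.

Lemma ends1_rev P s : ends1 (rev P) s = ends1 P s.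
Proof. by rewrite /ends1 revK addnC. Qed.

Lemma ends1_cons x P s : ends1 (x :: P) s = (x == s) + (last x P == s).
Proof.
rewrite /ends1 /=; congr (_ + _); rewrite lastI rev_rcons /=.
by [].
Qed.

Lemma ends1_cat x A y B s : ends1 (rcons A x ++ y :: B) s = (head x A == s) + (last y B == s).
Proof.
case: A => [|c A] /=; first by rewrite ends1_cons.
by rewrite ends1_cons last_cat.
Qed.

Lemma ends1_gt0 P s : 0 < ends1 P s -> endof s P.
Proof.
case: P => [|x P]; first by rewrite /ends1.
rewrite ends1_cons /endof /=; rewrite [s == x]eq_sym [s == last _ _]eq_sym.
by case: (x == s); case: (last x P == s).
Qed.

Lemma slots_perm pl pl' s : perm_eq pl pl' -> slots pl s = slots pl' s.
Proof. exact: perm_big. Qed.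

Lemma adj_perm pl pl' a b : perm_eq pl pl' -> adj pl a b = adj pl' a b.
Proof. by move=> pp; apply: perm_has. Qed.

Lemma adj_cons P pl a b : adj (P :: pl) a b = adj1 P a b || adj pl a b.
Proof. by []. Qed.

Lemma slots_cons P pl s : slots (P :: pl) s = ends1 P s + slots pl s.
Proof. exact: big_cons. Qed.

Lemma adjC pl a b : adj pl a b = adj pl b a.
Proof. by apply: eq_has => P; rewrite adj1C. Qed.

Lemma slots_gt0 pl s : 0 < slots pl s -> exists2 P, P \in pl & endof s P.
Proof.
move=> h; have [/hasP[P Ppl eP]|/hasPn none] := boolP (has (endof s) pl); first by exists P.
move: h; rewrite /slots big_seq big1 // => P Ppl; apply/eqP; rewrite -leqn0 leqNgt.
by apply: contra (none P Ppl); exact: ends1_gt0.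
Qed.

Lemma endof_orient_rev v P : endof v P -> exists P1, v :: P1 = P \/ v :: P1 = rev P.
Proof.
case: P => // a P /andP[_ /orP[/eqP E|/eqP E]]; first by exists P; left; rewrite E.
case/lastP: P E => [|P b] /=; first by move=> E; exists [::]; left; rewrite E.
rewrite last_rcons => <-; exists (rev (a :: P)); right.
by rewrite -rev_rcons.
Qed.

(* Adding the edge [vz] at an end [v] either merges two paths or frees a path
   neighbour [w] of [z]. *)
Lemma rotate pl v z : pcover e X pl -> 0 < slots pl v -> z \in X -> e v z -> ~~ adj pl v z ->
  exists pl', [/\ pcover e X pl', size pl' <= size pl &
   (forall s, s != z -> slots pl' s + (v == s) = slots pl s) \/
   exists w, [/\ adj pl z w, (forall s, slots pl' s + (v == s) = slots pl s + (w == s)) &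
      forall a b, ~~ joins v z a b -> ~~ joins z w a b -> adj pl' a b = adj pl a b]].
Proof.
move=> pc0 /slots_gt0[P Ppl vP] zX evz nadj0.
have [P1 P1E] := endof_orient_rev vP.
have pp : perm_eq pl ([:: P] ++ rem P pl) by exact: perm_to_rem.
set rest := rem P pl in pp.
have slE s : slots pl s = slots ((v :: P1) :: rest) s.
  rewrite (slots_perm s pp) /slots !big_cons; congr (_ + _).
  by case: P1E => ->; rewrite ?ends1_rev.
have adE a b : adj pl a b = adj ((v :: P1) :: rest) a b.
  have h : adj1 (v :: P1) a b = adj1 P a b by case: P1E => ->; rewrite ?adj1_rev.
  by rewrite (adj_perm a b pp) /adj [LHS]/= -h.
have gP : gpath e P by move: pc0 => /andP[/allP ok _]; exact: ok.
have pc : pcover e X ([:: v :: P1] ++ rest).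
  apply: (pcover_replace (pcover_perm pp pc0)).
    by case: P1E => ->; rewrite /= ?gpath_rev // gP.
  by rewrite /= !cats0; case: P1E => ->; rewrite ?perm_rev.
have nadj : ~~ adj ((v :: P1) :: rest) v z by rewrite -adE.
have szE : size pl = (size rest).+1 by rewrite (perm_size pp).
have gP1 : gpath e (v :: P1) by move: pc => /andP[/= /andP[]].
have un := pcover_uniq pc.
rewrite szE {pc0 pp nadj0 gP vP Ppl P1E}.
(* If [z] is on the path of [v], the rotation drops the edge from [z] to its predecessor [w], which
   becomes an end in place of [v]. *)
have [zP1|zP1] := boolP (z \in P1).
  case/splitPr: zP1 pc gP1 slE adE nadj un => A B pc gP1 slE adE nadj un.
  case/lastP: A pc gP1 slE adE nadj un => [|A w] pc gP1 slE adE nadj un.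
    by move: nadj; rewrite /adj /= /joins !eqxx.
  have gA : gpath e (v :: rcons A w) by apply: (@gpath_catl _ _ _ (z :: B)).
  have gB : gpath e (z :: B) by apply: (@gpath_catr _ _ (v :: rcons A w)).
  exists ((rev (v :: rcons A w) ++ z :: B) :: rest); split=> //.
    apply: (pcover_replace (new := [:: rev (v :: rcons A w) ++ z :: B]) pc).
      rewrite /= andbT; apply: (@gpath_cat _ _ v) => //; rewrite ?gpath_rev //.
      by rewrite last_rev.
    by rewrite /=; perm_count.
  have E0 : v :: rcons A w ++ z :: B = rcons (v :: A) w ++ z :: B by [].
  right; exists w; split.
  - by rewrite adE E0 adj_cons adj1_cat joins_swap /joins !eqxx !orbT.
  - move=> s; rewrite slE E0 !slots_cons rev_cons !ends1_cat rev_rcons /=.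
    by bool_lia.
  - move=> a b n1 n2; rewrite adE E0 !adj_cons; congr (_ || _).
    rewrite rev_cons adj1_cat -rev_cons adj1_rev adj1_cat (negbTE n1).
    by rewrite (joins_swap w z) (negbTE n2).
(* If [z] is the first vertex of another path, the two paths merge; otherwise that path is cut just
   before [z] and its left part ends in [w]. *)
have [Q Qr zQ] : exists2 Q, Q \in rest & z \in Q.
  move: zX; rewrite (pcover_mem _ pc) /= inE (negbTE zP1) orbF; case: eqVneq => [zv|_ /hasP //].
  by rewrite zv eirr in evz.
have [rest' pr] : exists r', perm_eq rest (Q :: r').
  by exists (rem Q rest); exact: perm_to_rem.
have sr : size rest = (size rest').+1 by rewrite (perm_size pr).
have pc2 : pcover e X ([:: v :: P1; Q] ++ rest') by apply: pcover_perm pc; rewrite /= perm_cons.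
have gQ : gpath e Q by move: pc2 => /andP[/= /and3P[]].
case/splitPr: zQ pr pc2 gQ {Qr} => Q1 Q2 pr pc2 gQ.
have gQ2 : gpath e (z :: Q2) by apply: (@gpath_catr _ _ Q1).
have slE2 s : slots pl s = ends1 (v :: P1) s + (ends1 (Q1 ++ z :: Q2) s + slots rest' s).
  by rewrite slE slots_cons (slots_perm s pr) slots_cons.
have adE2 a b : adj pl a b = [|| adj1 (v :: P1) a b, adj1 (Q1 ++ z :: Q2) a b | adj rest' a b].
  by rewrite adE adj_cons (adj_perm a b pr) adj_cons.
have gm : gpath e (rev (v :: P1) ++ z :: Q2).
  by apply: (@gpath_cat _ _ v); rewrite ?gpath_rev // last_rev.
case/lastP: Q1 pr pc2 gQ sr slE2 adE2 => [|Q1 w] pr pc2 gQ sr slE2 adE2.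
  exists ((rev (v :: P1) ++ z :: Q2) :: rest'); split; first 2 last.
  - left=> s sz; rewrite slE2 slots_cons rev_cons ends1_cat !ends1_cons /=.
    rewrite [z == s]eq_sym (negbTE sz) head_rev /=.
    by bool_lia.
  - apply: (pcover_replace (new := [:: rev (v :: P1) ++ z :: Q2]) pc2); first by rewrite /= gm.
    by rewrite /=; perm_count.
  - by rewrite sr.
exists (rcons Q1 w :: (rev (v :: P1) ++ z :: Q2) :: rest'); split.
- apply: (pcover_replace (new := [:: rcons Q1 w; rev (v :: P1) ++ z :: Q2]) pc2).
    rewrite /= gm !andbT; apply: (@gpath_catl _ _ _ (z :: Q2)) => //; by case: (Q1).
  by rewrite /=; perm_count.
- by rewrite sr.
right; exists w; split.
- by rewrite adE2 adj1_cat joins_swap /joins !eqxx !orbT.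
- move=> s; rewrite slE2 !slots_cons rev_cons !ends1_cat !ends1_cons /=.
  rewrite head_rev -[rcons Q1 w]cats1.
  have -> : ends1 (Q1 ++ [:: w]) s = (head w Q1 == s) + (w == s).
    by case: (Q1) => [|q Q'] /=; rewrite ends1_cons ?last_cat.
  move: (nat_of_bool (head w Q1 == s)) (nat_of_bool (w == s)) (nat_of_bool (last v P1 == s))
    (nat_of_bool (last z Q2 == s)) (nat_of_bool (v == s)) (slots rest' s); clear; lia.
move=> a b n1 n2; rewrite adE2 !adj_cons rev_cons !adj1_cat -rev_cons adj1_rev.
rewrite (negbTE n1) (joins_swap w z) (negbTE n2).
by move: (adj1 (v :: P1) a b) (adj1 (rcons Q1 w) a b) (adj1 (z :: Q2) a b) => [] [] [].
Qed.

(** A vertex has at most one path neighbour on each side, and on a side where it has none it is an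
    end counted by [slots]. *)
Lemma adj_slots pl s : pcover e X pl -> s \in X -> #|[set z | adj pl s z]| + slots pl s <= 2.
Proof.
move=> pc sX; have un := pcover_uniq pc.
have [P Ppl sP] : exists2 P, P \in pl & s \in P.
  by move: sX; rewrite (pcover_mem _ pc) => /hasP.
have pp : perm_eq pl (P :: rem P pl) by exact: perm_to_rem.
have un2 : uniq (P ++ flatten (rem P pl)) by rewrite -(perm_uniq (perm_flatten pp)).
have no Q : Q \in rem P pl -> s \notin Q.
  move=> Qr; apply/negP => sQ; move: un2; rewrite cat_uniq => /and3P[_ /hasPn/(_ s)].
  by rewrite sP => h _; have : s \in flatten (rem P pl) by [apply/flattenP; exists Q]; move/h.
have adE z : adj pl s z = adj1 P s z.
  rewrite (adj_perm s z pp) /adj /=; case: (adj1 P s z) => //=; apply/hasPn => Q /no nQ.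
  by apply: contra nQ => /adj1_mem /andP[].
have -> : slots pl s = ends1 P s.
  rewrite (slots_perm s pp) /slots big_cons big_seq big1 ?addn0 // => Q /no nQ.
  by apply/eqP; rewrite -leqn0 leqNgt; apply: contra nQ => /ends1_gt0 /endof_mem.
have -> : [set z | adj pl s z] = [set z | adj1 P s z] by apply/setP => z; rewrite !inE adE.
have uP : uniq P by move: un2; rewrite cat_uniq => /and3P[].
case/splitPr: sP uP {adE no un2 pp Ppl} => A B; rewrite cat_uniq => /and3P[uA /= /norP[sA _] /andP[sB uB]].
have h1 (C : seq T) : s \notin C -> #|[set z | adj1 (s :: C) s z]| <= (C != [::]).
  case: C => [|c C] sC; first by rewrite leqn0 cards_eq0; apply/eqP/setP => z; rewrite !inE.
  rewrite [nat_of_bool _]/= -(cards1 c); apply: subset_leq_card; apply/subsetP => z; rewrite !inE => h.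
  have {h} : joins s c s z || adj1 (c :: C) s z by [].
  case/orP => [/joins_pairP[[_ ->]|[sc _]]|/adj1_mem /andP[sC' _]]; last by rewrite sC' in sC.
    by rewrite eqxx.
  by rewrite sc mem_head in sC.
have hB := h1 B sB.
have lB : (last s B == s) = (B == [::]).
  case: B sB {uB hB} => [|b B] sB /=; first by rewrite eqxx.
  by apply/negbTE; apply: contraNneq sB => <-; exact: mem_last.
case/lastP: A sA uA => [|A c] sA uA.
  rewrite [[::] ++ _]/= ends1_cons eqxx lB; move: hB.
  by move: #|_|; case: (B == [::]); clear; lia.
have -> : ends1 (rcons A c ++ s :: B) s = (B == [::]).
  rewrite ends1_cat; have -> : (head c A == s) = false.
    apply/negbTE; apply: contraNneq sA => <-; rewrite mem_rcons inE.
    by case: (A) => [|q Q] /=; rewrite ?eqxx // mem_head orbT.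
  by rewrite lB.
have : #|[set z | adj1 (rcons A c ++ s :: B) s z]| <= #|[set z | adj1 (s :: B) s z]| + 1.
  rewrite -(cards1 c); apply: leq_trans (leq_card_setU _ _) => //.
  apply: subset_leq_card; apply/subsetP => z; rewrite !inE adj1_cat => /or3P[|/joins_pairP[[sc _]|[_ ->]]|->] //.
  - by move=> /adj1_mem /andP[h _]; rewrite h in sA.
  - by rewrite sc mem_rcons mem_head in sA.
  - by rewrite eqxx orbT.
move: hB; case: (B == [::]); move: #|_| #|_|; clear; lia.
Qed.

End Rotation.

Lemma sum_shift (T : finType) (S : {set T}) (f f' : T -> nat) v w : v \in S ->
  (forall s, s \in S -> f' s + (v == s) = f s + (w == s)) ->
  \sum_(s in S) f' s + 1 = \sum_(s in S) f s + (w \in S).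
Proof.
have sum1 x : \sum_(s in S) (x == s : nat) = (x \in S).
  have [xS|xS] := boolP (x \in S).
    by rewrite (bigD1 x) //= eqxx big1 // => s /andP[_ /negbTE]; rewrite eq_sym => ->.
  by rewrite big1 // => s sS; case: eqVneq => // xs; rewrite xs sS in xS.
move=> vS h; have := sum1 v; rewrite vS /= => <-; rewrite -(sum1 w) -!big_split /=.
exact: eq_bigr.
Qed.

Lemma card_bigcup_le (I T : finType) (A : {set I}) (F : I -> {set T}) :
  #|\bigcup_(i in A) F i| <= \sum_(i in A) #|F i|.
Proof.
elim/big_rec2: _ => [|i n B _ le]; first by rewrite cards0.
by apply: leq_trans (leq_card_setU _ _) _; rewrite leq_add2l.
Qed.

Section Attach.
Variables (T : finType) (e : rel T) (D S : {set T}) (m : nat).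
Hypotheses (esym : symmetric e) (eirr : irreflexive e).
Notation X := (~: D).
Hypotheses (SX : S \subset X) (indep : forall u v, u \in S -> v \in S -> ~~ e u v).
Hypothesis expand : forall A : {set T}, A \subset S -> 2 * #|A| <= #|nbs e A|.
Hypothesis cov : exists2 pl, pcover e X pl & size pl <= m.
Implicit Types (mu : T -> T) (pl : seq (seq T)) (s v w y z : T).

Definition att mu s := #|[set y in D | mu y == s]|.

(* [y] in [D] is attached to [mu y] if this lies in [S], and unattached otherwise. *)
Definition attachment pl mu := [/\ pcover e X pl, size pl <= m,
  (forall y, y \in D -> mu y \in S -> e (mu y) y) &
  forall s, s \in S -> att mu s <= slots pl s].

Definition deficit pl mu := \sum_(s in S) (slots pl s - att mu s).

Definition redirect mu y v x := if x == y then v else mu x.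

Lemma att_redirect mu y v s : y \in D ->
  att (redirect mu y v) s + (mu y == s) = att mu s + (v == s).
Proof.
move=> yD; rewrite /att (cardsD1 y [set x in D | mu x == s]).
rewrite (cardsD1 y [set x in D | redirect mu y v x == s]) !inE yD /= /redirect eqxx.
rewrite [_ + #|_|]addnC [(mu y == s) + _]addnC addnAC; congr (_ + _ + _).
by apply: eq_card => x; rewrite !inE; case: eqVneq.
Qed.

Section Minimal.
Variables (d : nat) (pl0 : seq (seq T)) (mu0 : T -> T).
Hypotheses (st0 : attachment pl0 mu0) (df0 : deficit pl0 mu0 = d).
Hypothesis dmin : forall pl mu, attachment pl mu -> d <= deficit pl mu.

Definition lack pl mu v := att mu v < slots pl v.

(** The lack moves to another vertex, by a rotation or by redirecting an attached vertex. The
    clauses on what stays unchanged serve to trace adjacencies and attachments back to the initial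
    state. *)
Definition step pl mu pl' mu' :=
  [/\ attachment pl' mu', deficit pl' mu' = d &
   (exists w z, [/\ w \in S, z \notin S, z \in X, adj pl z w &
      [/\ lack pl' mu' w, mu' =1 mu &
       forall z' s, z' \notin S -> s \in S -> z' != z -> adj pl' z' s = adj pl z' s]]) \/
   (exists y, [/\ y \in D, mu y \in S, lack pl' mu' (mu y), pl' = pl &
      forall x, x != y -> mu' x = mu x])].

(** The slot of [v] is filled or removed, so by minimality of the deficit the loss must reappear in
    [S]: at the freed path neighbour [w], or at the vertex from which [z] was taken. *)
Lemma step_exists pl mu v z : attachment pl mu -> deficit pl mu = d -> v \in S ->
  lack pl mu v -> e v z ->
  (z \in X -> ~~ adj pl v z ->
    exists pl' w, [/\ step pl mu pl' mu, w \in S, adj pl z w & lack pl' mu w]) /\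
  (z \in D -> mu z != v ->
    exists mu', [/\ step pl mu pl mu', mu z \in S & lack pl mu' (mu z)]).
Proof.
move=> st df vS lv evz; have [pc sz me ms] := st.
have zS : z \notin S by apply: contraTN evz => zS; exact: indep.
split=> [zX nadj|zD muv].
  have [|pl' [pc' sz' hh]] := rotate esym eirr pc _ zX evz nadj.
    by apply: leq_trans lv.
  have attle s (c : nat) : slots pl' s + (v == s) = slots pl s + c -> s \in S ->
      att mu s <= slots pl' s /\ (slots pl' s - att mu s) + (v == s) = (slots pl s - att mu s) + c.
    move=> E sS; have := ms s sS; move: E; case: eqVneq => [<-|_]; move: lv; rewrite /lack.
      by move: (att mu v) (slots pl v) (slots pl' v); clear; lia.
    by move: (att mu s) (slots pl s) (slots pl' s); clear; lia.
  case: hh => [h|[w [adw h hadj]]].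
    have h' s : s \in S -> slots pl' s + (v == s) = slots pl s + 0.
      by move=> sS; rewrite addn0; apply: h; apply: contraTneq sS => ->.
    have st' : attachment pl' mu.
      by split=> //; [exact: leq_trans sz|move=> s sS; case: (attle s 0 (h' s sS) sS)].
    have : deficit pl' mu + 1 = deficit pl mu + (z \in S).
      by apply: (sum_shift vS) => s sS; case: (attle s 0 (h' s sS) sS) => _ ->; case: eqVneq zS => // ->; rewrite sS.
    have : d <= deficit pl' mu by exact: dmin.
    by rewrite (negbTE zS) df; move: (deficit pl' mu); clear; lia.
  have st' : attachment pl' mu.
    by split=> //; [exact: leq_trans sz|move=> s sS; case: (attle s _ (h s) sS)].
  have dE : deficit pl' mu + 1 = deficit pl mu + (w \in S).
    by apply: (sum_shift vS) => s sS; case: (attle s _ (h s) sS).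
  have dle : d <= deficit pl' mu by exact: dmin.
  have wS : w \in S by move: dE dle; rewrite df; case: (w \in S) => //; move: (deficit pl' mu); clear; lia.
  have lw : lack pl' mu w.
    have := h w; have := ms w wS; move: lv; rewrite /lack eqxx; case: eqVneq => [->|_]; first by move: (att mu w) (slots pl w) (slots pl' w); clear; lia.
    by move: (att mu v) (slots pl v) (att mu w) (slots pl w) (slots pl' w); clear; lia.
  exists pl', w; split=> //; split=> //.
    by move: dE; rewrite wS df => /addIn.
  left; exists w, z; split=> //; split=> // z' s z'S sS z'z; apply: hadj.
    apply/negP => /joins_pairP[[z'v _]|[/eqP]]; last by rewrite (negbTE z'z).
    by move: z'S; rewrite z'v vS.
  apply/negP => /joins_pairP[[/eqP]|[z'w _]]; first by rewrite (negbTE z'z).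
  by move: z'S; rewrite z'w wS.
pose mu' := redirect mu z v.
have attE s : att mu' s + (mu z == s) = att mu s + (v == s) by exact: att_redirect.
have attle s : s \in S -> att mu' s <= slots pl s /\
    (slots pl s - att mu' s) + (v == s) = (slots pl s - att mu s) + (mu z == s).
  move=> sS; have := ms s sS; have := attE s; move: lv; rewrite /lack.
  case: (eqVneq v s) => [vs|_].
    rewrite -vs (negbTE muv); move: (att mu' v) (att mu v) (slots pl v); clear; lia.
  case: (mu z == s); move: (att mu' s) (att mu s) (slots pl s) (att mu v) (slots pl v); clear; lia.
have st' : attachment pl mu'.
  split=> //; last by move=> s /attle[].
  by move=> y yD; rewrite /mu' /redirect; case: eqVneq => [->|_] //; exact: me.
have dE : deficit pl mu' + 1 = deficit pl mu + (mu z \in S).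
  by apply: (sum_shift vS) => s /attle[].
have dle : d <= deficit pl mu' by exact: dmin.
have wS : mu z \in S by move: dE dle; rewrite df; case: (mu z \in S) => //; move: (deficit pl mu'); clear; lia.
have lw : lack pl mu' (mu z).
  have := attE (mu z); have := ms _ wS; rewrite /lack eqxx [v == _]eq_sym (negbTE muv).
  by move: (att mu' _) (att mu _) (slots pl _); clear; lia.
exists mu'; split=> //; split=> //; first by move: dE; rewrite wS df => /addIn.
right; exists z; split=> // x xz; by rewrite /mu' /redirect (negbTE xz).
Qed.

Inductive reachable : seq (seq T) -> (T -> T) -> Prop :=
| reachable_base : reachable pl0 mu0
| reachable_step pl mu pl' mu' : reachable pl mu -> step pl mu pl' mu' -> reachable pl' mu'.

Lemma reachable_attachment pl mu : reachable pl mu -> attachment pl mu /\ deficit pl mu = d.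
Proof. by case=> [//|pl1 mu1 pl2 mu2 _ []]. Qed.

(* In the spirit of Posa's rotation lemma: the set [R] of vertices that may become
   deficient has its neighbours among its neighbours in the initial paths and the
   initially attached vertices, fewer than [2 * #|R|] in total. *)
Lemma no_lack v : v \in S -> ~~ lack pl0 mu0 v.
Proof.
move=> vS; apply/negP => lv.
have [R RP] := ex_fset (fun x => x \in S /\ exists pl mu, reachable pl mu /\ lack pl mu x).
have RS : R \subset S by apply/subsetP => x /RP[].
(* A path neighbour in [S] of [z], or the attachment of [y] to a vertex of [S], is lost only by a
   vertex of [R]. At the first loss, that vertex still was an initial neighbour or the initial
   attachment. *)
have inv pl mu : reachable pl mu ->
   (forall z, z \notin S -> (forall s, s \in S -> adj pl z s = adj pl0 z s) \/
      exists2 w, w \in R & adj pl0 z w) /\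
   (forall y, y \in D -> mu y = mu0 y \/ mu0 y \in R).
  elim=> [|{}pl {}mu pl' mu' rp [IH1 IH2] stp]; first by split=> *; left.
  have rp' := reachable_step rp stp.
  case: stp => st df [[w [z [wS zS zX adw [lw muE hadj]]]]|[y [yD yS ly -> muE]]].
    have wR : w \in R by apply/RP; split=> //; exists pl', mu'.
    split=> [z' z'S|y yD]; last by rewrite muE; exact: IH2.
    case: (IH1 z' z'S) => [h|h]; last by right.
    have [z'z|z'z] := eqVneq z' z; last by left=> s sS; rewrite hadj // h.
    by right; exists w => //; rewrite -h // z'z.
  have wR : mu y \in R by apply/RP; split=> //; exists pl', mu'.
  split=> // x xD; have [->|xy] := eqVneq x y; last by rewrite muE //; exact: IH2.
  by case: (IH2 y yD) => [<-|h]; right.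
have nb z : z \in nbs e R -> (z \in X /\ exists2 w, w \in R & adj pl0 z w) \/ (z \in D /\ mu0 z \in R).
  rewrite inE => /existsP[x /andP[xR exz]]; have [xS [pl [mu [rp lx]]]] := proj1 (RP x) xR.
  have [st df] := reachable_attachment rp; have [i1 i2] := inv _ _ rp.
  have zS : z \notin S by apply: contraTN exz => zS; exact: indep.
  have [sX sD] := step_exists st df xS lx exz.
  have [zD|zD] := boolP (z \in D); [right|left]; split=> //.
  - case: (i2 z zD) => // E; have [mzx|mzx] := eqVneq (mu z) x; first by rewrite -E mzx.
    have [mu' [stp wS lw]] := sD zD mzx; rewrite -E; apply/RP; split=> //.
    by exists pl, mu'; split=> //; exact: reachable_step rp stp.
  - by rewrite inE.
  - case: (i1 z zS) => // h.
    have [ad|nad] := boolP (adj pl x z); first by exists x => //; rewrite -h // adjC.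
    have zX : z \in X by rewrite inE.
    have [pl' [w [stp wS adw lw]]] := sX zX nad; exists w; last by rewrite -h.
    by apply/RP; split=> //; exists pl', mu; split=> //; exact: reachable_step rp stp.
have [pc _ _ ms] := st0.
have vR : v \in R by apply/RP; split=> //; exists pl0, mu0; split=> //; exact: reachable_base.
have le1 : #|nbs e R| <= \sum_(s in R) (#|[set z | adj pl0 s z]| + att mu0 s).
  rewrite big_split /=.
  apply: leq_trans (_ : #|(\bigcup_(s in R) [set z | adj pl0 s z]) :|: (\bigcup_(s in R) [set y in D | mu0 y == s])| <= _).
    apply: subset_leq_card; apply/subsetP => z /nb[[_ [w wR ad]]|[zD mR]]; rewrite inE.
      by apply/orP; left; apply/bigcupP; exists w => //; rewrite inE adjC.
    by apply/orP; right; apply/bigcupP; exists (mu0 z) => //; rewrite inE zD eqxx.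
  apply: leq_trans (leq_card_setU _ _) _; apply: leq_add; exact: card_bigcup_le.
(* Each vertex of [R] has at most two path neighbours and attached vertices together, and the
   lacking [v] has at most one. *)
have le2 : \sum_(s in R) (#|[set z | adj pl0 s z]| + att mu0 s) + 1 <= 2 * #|R|.
  have -> : 2 * #|R| = \sum_(s in R) 2 by rewrite sum_nat_const mulnC.
  rewrite (bigD1 v) //= [leqRHS](bigD1 v) //= addnAC; apply: leq_add.
    have vX : v \in X by move/subsetP: SX; apply.
    have := adj_slots pc vX; move: lv; rewrite /lack.
    by move: #|_| (att mu0 v) (slots pl0 v); clear; lia.
  apply: leq_sum => s /andP[sR _]; have sS : s \in S by move/subsetP: RS; apply.
  have sX : s \in X by move/subsetP: SX; apply.
  have := adj_slots pc sX; have := ms s sS.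
  by move: #|_| (att mu0 s) (slots pl0 s); clear; lia.
have := leq_trans (expand RS) le1; move: le2; move: (\sum_(_ in R) _) #|R|; clear; lia.
Qed.

End Minimal.

Lemma attach_paths : exists pl mu, attachment pl mu /\ forall s, s \in S -> att mu s = slots pl s.
Proof.
have [d [[pl0 [mu0 [st0 df0]]] dmin]] : exists d,
    (exists pl mu, attachment pl mu /\ deficit pl mu = d) /\
    forall k, (exists pl mu, attachment pl mu /\ deficit pl mu = k) -> d <= k.
  (* The identity attaches nothing, as it keeps [D] outside [S]. *)
  apply: ex_least; have [pl pc sz] := cov; exists (deficit pl id), pl, id; split=> //; split=> //.
    by move=> y yD yS; move/subsetP: SX => /(_ _ yS); rewrite inE yD.
  move=> s sS; rewrite /att; have -> : [set y in D | y == s] = set0; last by rewrite cards0.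
  apply/setP => y; rewrite !inE; apply/negP => /andP[yD /eqP ys].
  by move/subsetP: SX => /(_ _ sS); rewrite inE -ys yD.
have dmin' pl mu : attachment pl mu -> d <= deficit pl mu.
  by move=> st; apply: dmin; exists pl, mu.
exists pl0, mu0; split=> // s sS; apply/eqP; rewrite eqn_leq; case: (st0) => _ _ _ -> //=.
by rewrite leqNgt; exact: (no_lack st0 df0 dmin').
Qed.

End Attach.

(** * Hamiltonian cycle *)

Section Assembly.
Variables (T : finType) (D S : {set T}).
Implicit Types (r : rel T) (s x y : T) (P Q A B : seq T) (pl ql : seq (seq T)).

(* As for [ends1], a one-vertex path has two ends. *)
Definition dends P := if P is x :: Q then (x \in D) + (last x Q \in D) else 0.

Lemma dends_le2 P : dends P <= 2.
Proof. by case: P => //= x P; case: (x \in D); case: (last x P \in D). Qed.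

Lemma dends_rev P : dends (rev P) = dends P.
Proof.
case: P => // x P; rewrite rev_cons; have [->|[y [A ->]]] :
  P = [::] \/ exists y A, P = rcons A y by case/lastP: P => [|A y]; [left|right; exists y, A].
  by [].
rewrite rev_rcons /= !last_rcons addnC //.
Qed.

Lemma orient_last P : 0 < dends P -> exists x A,
  [/\ perm_eq (x :: A) P, last x A \in D & x :: A = P \/ x :: A = rev P].
Proof.
case: P => // x P; have [l|l] := boolP (last x P \in D).
  by move=> _; exists x, P; split=> //; left.
rewrite /= (negbTE l) addn0 lt0b => xD.
have : ~~ nilp (rev (x :: P)) by rewrite /nilp size_rev.
case E : (rev (x :: P)) => [//|y A] _; exists y, A; split; last by right.
  by rewrite -E perm_rev.
by rewrite -(last_cons x) -E last_rev.
Qed.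

Lemma slots0_head ql x A : (forall s, s \in S -> slots ql s = 0) -> x :: A \in ql ->
  x \notin S /\ last x A \notin S.
Proof.
move=> sl0 h; have e0 s : s \in S -> ends1 (x :: A) s = 0.
  move=> sS; apply/eqP; rewrite -leqn0 -(sl0 s sS) (slots_perm s (perm_to_rem h)) slots_cons.
  exact: leq_addr.
split; apply/negP => /e0; rewrite ends1_cons eqxx; lia.
Qed.

Section Join.
Variable r : rel T.
Hypotheses (rsym : symmetric r).
Hypothesis rDS : forall x y, x \in D -> y \notin S -> x != y -> r x y.

Lemma pcover_orient X P P' rest : pcover r X (P :: rest) -> P' = P \/ P' = rev P ->
  pcover r X (P' :: rest).
Proof.
move=> pc h; apply: (pcover_replace (old := [:: P]) (new := [:: P']) pc).
  by move: pc => /andP[/= /andP[gP _] _]; case: h => ->; rewrite ?gpath_rev // gP.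
by rewrite /= !cats0; case: h => ->; rewrite ?perm_rev.
Qed.

Lemma pcover_join X x A y B rest : pcover r X ((x :: A) :: (y :: B) :: rest) ->
  last x A \in D -> y \notin S -> pcover r X ((x :: A ++ y :: B) :: rest).
Proof.
move=> pc xD yS; have un := pcover_uniq pc.
apply: (pcover_replace (old := [:: x :: A; y :: B]) (new := [:: x :: A ++ y :: B]) pc).
  move: pc => /andP[/= /and3P[gA gB _] _]; rewrite andbT.
  apply: (@gpath_cat _ _ x (x :: A)) => //=; apply: rDS => //.
  have : uniq ((x :: A) ++ (y :: B) ++ flatten rest) by [].
  rewrite cat_uniq => /and3P[_ /hasPn/(_ y) h _]; apply/eqP => E; move: h.
  by rewrite mem_cat mem_head -E mem_last => /(_ isT).
by rewrite /= !cats0.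
Qed.

Lemma dends_ex2 ql P : size ql <= \sum_(P <- ql) dends P -> P \in ql -> dends P = 0 ->
  exists2 Q, Q \in rem P ql & dends Q = 2.
Proof.
move=> le Pql d0; have pp := perm_to_rem Pql.
have [/hasP[Q Q1 /eqP Q2]|/hasPn none] := boolP (has (fun Q => dends Q == 2) (rem P ql)).
  by exists Q.
move: le; rewrite (perm_big _ pp) big_cons d0 (perm_size pp) /= add0n ltnNge => /negP[].
rewrite -sum1_size big_seq [leqRHS]big_seq; apply: leq_sum => Q /none.
by have := dends_le2 Q; move: (dends Q); clear; lia.
Qed.

(** The inequality between paths and ends in [D] survives suitable joins: a path without such an end
    is joined to one with two, which must then exist; if every path has one, any two paths will
    do. *)
Lemma join_all k ql : size ql = k.+1 -> pcover r setT ql ->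
  (forall s, s \in S -> slots ql s = 0) -> size ql <= \sum_(P <- ql) dends P ->
  exists x A, [/\ pcover r setT [:: x :: A], x \notin S & last x A \in D].
Proof.
elim: k ql => [|k IH] ql sz pc sl0 le.
  case: ql sz pc sl0 le => [//|P [|//]] _ pc sl0.
  rewrite big_cons big_nil addn0 => dP; have [x [A [pA lA o]]] := orient_last dP.
  exists x, A; split=> //; first exact: pcover_orient pc o.
  have sl0' s : s \in S -> slots [:: x :: A] s = 0.
    move=> sS; rewrite -(sl0 s sS) !slots_cons; congr (_ + _).
    by case: o => ->; rewrite ?ends1_rev.
  by case: (slots0_head sl0' (mem_head _ _)).
suff [x [A [y [B [rest [pc' lA yS szr]]]]]] : exists x A y B rest,
   [/\ pcover r setT ((x :: A) :: (y :: B) :: rest), last x A \in D, y \notin S,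
    size rest = k & (forall s, s \in S -> slots ((x :: A ++ y :: B) :: rest) s = 0) /\
     k < \sum_(P <- (x :: A ++ y :: B) :: rest) dends P].
  by move=> [sl0' le']; apply: (IH ((x :: A ++ y :: B) :: rest)) => //=;
    rewrite ?szr //; exact: pcover_join.
have [/hasP[P Pql /eqP d0]|/hasPn all1] := boolP (has (fun P => dends P == 0) ql).
  have [Q Qr d2] := dends_ex2 le Pql d0.
  have [rest pp] : exists rest, perm_eq ql (Q :: P :: rest).
    exists (rem Q (rem P ql)); apply: perm_trans (perm_to_rem Pql) _.
    rewrite perm_sym -[Q :: _]/([:: Q] ++ [:: P] ++ _) perm_catCA /= perm_cons perm_sym.
    exact: perm_to_rem.
  have {sz} szr : size rest = k by move: sz; rewrite (perm_size pp) /=; case.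
  have pc1 := pcover_perm pp pc.
  have sl1 s : s \in S -> slots (Q :: P :: rest) s = 0.
    by move=> /sl0; rewrite (slots_perm s pp).
  move: le; rewrite (perm_big _ pp) /= !big_cons (perm_size pp) /= szr d0 d2 => le.
  move: pc1 (pc1) => /andP[/= /and3P[/andP[nQ _] /andP[nP _] _] _].
  case: Q P nQ nP d2 d0 sl1 {Pql Qr pp} => [//|x A] [//|y B] _ _ d2 d0 sl1 pc1.
  have [xD lA] : x \in D /\ last x A \in D.
    by move: d2 => /=; case: (x \in D); case: (last x A \in D).
  exists x, A, y, B, rest; split=> //.
    by case: (slots0_head sl1 (_ : y :: B \in _)) => //; rewrite !inE eqxx orbT.
  split; last by rewrite big_cons /= xD; move: le; clear; lia.
  move=> s sS; move: (sl1 s sS); rewrite !slots_cons -cat_cons !ends1_cons last_cat /=.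
  by bool_lia.
case: ql sz pc sl0 le all1 => [//|P [//|Q rest]] [szr] pc sl0 le all1.
have dP : 0 < dends P by rewrite lt0n; apply: all1; rewrite mem_head.
have dQ : 0 < dends Q by rewrite lt0n; apply: all1; rewrite !inE eqxx orbT.
have [x [A [_ lA oA]]] := orient_last dP; have [y [B [_ lB oB]]] := orient_last dQ.
have pc1 : pcover r setT ((x :: A) :: (y :: B) :: rest).
  apply: pcover_orient oA; apply: (pcover_perm (pl := (y :: B) :: P :: rest)).
    by rewrite -[_ :: _]/([:: y :: B] ++ [:: P] ++ _) perm_catCA.
  apply: pcover_orient oB; apply: pcover_perm pc.
  by rewrite -[_ :: _]/([:: P] ++ [:: Q] ++ _) perm_catCA.
have sl1 s : s \in S -> slots ((x :: A) :: (y :: B) :: rest) s = 0.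
  move=> sS; rewrite -(sl0 s sS) !slots_cons; congr (_ + (_ + _)).
    by case: oA => ->; rewrite ?ends1_rev.
  by case: oB => ->; rewrite ?ends1_rev.
exists x, A, y, B, rest; split=> //.
  by case: (slots0_head sl1 (_ : y :: B \in _)) => //; rewrite !inE eqxx orbT.
split.
  move=> s sS; move: (sl1 s sS); rewrite !slots_cons -cat_cons !ends1_cons last_cat /=.
  by bool_lia.
rewrite big_cons /= last_cat /= lB addnAC addn1 -addSn ltnS -szr.
apply: leq_trans (leq_addl _ _); rewrite -sum1_size big_seq [leqRHS]big_seq.
by apply: leq_sum => R Rr; rewrite lt0n; apply: all1; rewrite !inE Rr !orbT.
Qed.
End Join.

Lemma pcover_add (e : rel T) (Y : {set T}) y P rest : y \in Y -> gpath e (y :: P) ->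
  pcover e (~: Y) (P :: rest) -> pcover e (~: (Y :\ y)) ((y :: P) :: rest).
Proof.
move=> yY gy /andP[/= /andP[_ ok] pe]; apply/andP; split; first by rewrite /= gy.
rewrite /=; apply: (@perm_trans _ (y :: enum (~: Y))); first by rewrite perm_cons.
apply: uniq_perm; rewrite ?enum_uniq //= ?enum_uniq ?mem_enum ?inE ?yY //.
by move=> x; rewrite !(inE, mem_enum) negb_and negbK.
Qed.

Variables (e : rel T) (mu : T -> T).
Hypotheses (esym : symmetric e) (SD : S \subset ~: D).
Hypothesis mu_edge : forall y, y \in D -> mu y \in S -> e (mu y) y.

(** Prolonging an end in [S] by [y] replaces an end outside [D] by one in [D] while [y] leaves the
    stock [Y], so the sum is invariant. A one-vertex path in [S] is treated twice. *)
Lemma extend_ends k (Y : {set T}) ql : #|Y| = k -> Y \subset D -> pcover e (~: Y) ql ->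
  (forall s, s \in S -> #|[set y in Y | mu y == s]| = slots ql s) ->
  \sum_(P <- ql) dends P + #|Y| = #|D| ->
  exists (Y' : {set T}) ql', [/\ size ql' = size ql, Y' \subset D, pcover e (~: Y') ql',
    (forall s, s \in S -> slots ql' s = 0) & \sum_(P <- ql') dends P + #|Y'| = #|D|].
Proof.
have SnD s : s \in S -> s \notin D by move/(subsetP SD); rewrite inE.
elim: k Y ql => [|k IH] Y ql Yk YD pc muE dE.
  exists Y, ql; split=> // s /muE <-; apply/eqP; rewrite cards_eq0 -subset0.
  move/eqP: Yk; rewrite cards_eq0 => /eqP->; by apply/subsetP => y; rewrite !inE.
have [/existsP[s /andP[sS sl]]|none] := boolP [exists s, (s \in S) && (0 < slots ql s)]; last first.
  exists Y, ql; split=> // s sS; apply/eqP; rewrite -leqn0 leqNgt; apply: contra none => h.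
  by apply/existsP; exists s; rewrite sS.
have [y] : exists y, y \in [set y in Y | mu y == s].
  by apply/set0Pn; rewrite -card_gt0 muE.
rewrite inE => /andP[yY /eqP ys].
have [P Pql sP] := slots_gt0 sl; have [P1 P1E] := endof_orient_rev sP.
have pp := perm_to_rem Pql; set rest := rem P ql in pp.
have pc1 : pcover e (~: Y) ((s :: P1) :: rest).
  exact: (pcover_orient esym (pcover_perm pp pc) P1E).
have yD : y \in D by move/subsetP: YD; apply.
have esy : e s y by rewrite -ys mu_edge // ys.
have gy : gpath e (y :: s :: P1).
  by move: pc1 => /andP[/= /andP[/andP[_ g1] _] _]; rewrite /gpath /= esym esy.
have slE t : slots ql t = slots ((s :: P1) :: rest) t.
  by rewrite (slots_perm t pp) !slots_cons; case: P1E => ->; rewrite ?ends1_rev.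
have [|||||Y' [ql' [h1 h2 h3 h4 h5]]] := IH (Y :\ y) ((y :: s :: P1) :: rest).
- by move: Yk; rewrite (cardsD1 y) yY => -[].
- exact: subset_trans (subsetDl _ _) YD.
- exact: pcover_add.
- move=> t tS; have := muE t tS; rewrite slE !slots_cons !ends1_cons /=.
  have -> : (y == t) = false by apply/negbTE; apply: contraTneq yD => ->; exact: SnD.
  rewrite (cardsD1 y) inE yY ys /=.
  have -> : [set y in Y | mu y == t] :\ y = [set y0 in Y :\ y | mu y0 == t].
    by apply/setP => z; rewrite !inE andbA.
  by move: #|_|; bool_lia.
- move: dE; rewrite (perm_big _ pp) /= !big_cons (cardsD1 y) yY /= yD.
  have -> : dends P = (last s P1 \in D).
    have -> : dends P = dends (s :: P1) by case: P1E => ->; rewrite ?dends_rev.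
    by rewrite /= (negbTE (SnD _ sS)).
  move: (nat_of_bool (last s P1 \in D)) (\sum_(_ <- _) _) #|D| #|_| => a b c d /=.
  by clear; lia.
exists Y', ql'; split=> //; by rewrite h1 (perm_size pp).
Qed.

Hypothesis eirr : irreflexive e.
Hypothesis degD : forall y x, y \in D -> x \notin S -> #|T| <= deg e y + deg e x.

Lemma hamiltonian_assembly ql : 2 < #|T| -> pcover e (~: D) ql -> size ql <= #|D| ->
  (forall s, s \in S -> #|[set y in D | mu y == s]| = slots ql s) -> hamiltonian e.
Proof.
move=> T3 pc0 sz0 muE0.
have d0 : \sum_(P <- ql) dends P + #|D| = #|D|.
  rewrite big_seq big1 // => P Pql; have inX x : x \in P -> x \notin D.
    by move=> xP; rewrite -in_setC (pcover_mem _ pc0); apply/hasP; exists P.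
  case: P Pql inX => //= x P _ inX; rewrite (negbTE (inX x _)) ?mem_head //.
  by rewrite (negbTE (inX _ _)) ?mem_last.
have [Y [ql1 [szE YD pc1 sl1 dE]]] := extend_ends erefl (subxx D) pc0 muE0 d0.
pose r u v := e u v || (u != v) && ((u \in D) && (v \notin S) || (v \in D) && (u \notin S)).
have rsym : symmetric r by move=> u v; rewrite /r esym [u == v]eq_sym [X in _ && X]orbC.
(* Each leftover vertex of [D] is a one-vertex path with two ends in [D]. There are
   [#|D| - #|Y| + 2 * #|Y|] such ends in all, against at most [#|D| + #|Y|] paths. *)
pose ql2 := ql1 ++ [seq [:: y] | y <- enum Y].
have fs (s : seq T) : flatten [seq [:: y] | y <- s] = s by elim: s => //= y s ->.
have pc2 : pcover r setT ql2.
  move: pc1 => /andP[/allP ok pe]; apply/andP; split.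
    rewrite all_cat; apply/andP; split.
      apply/allP => P /ok /andP[nP sP]; rewrite /gpath nP; apply: sub_sorted sP => u v euv.
      by rewrite /r euv.
    by apply/allP => P /mapP[y _ ->].
  rewrite flatten_cat fs; apply: (@perm_trans _ (enum (~: Y) ++ enum Y)).
    by rewrite perm_cat2r.
  apply: uniq_perm; rewrite ?cat_uniq ?enum_uniq //= ?andbT.
    by apply/hasPn => y; rewrite !mem_enum inE negbK.
  by move=> y; rewrite mem_cat !mem_enum !inE orNb.
have sl2 s : s \in S -> slots ql2 s = 0.
  move=> sS; rewrite /ql2 /slots big_cat /= [X in X + _](sl1 s sS) add0n big_map big_enum.
  rewrite big1 // => y /(subsetP YD) yD; rewrite ends1_cons /=.
  have -> // : (y == s) = false; apply/negbTE; apply: contraTneq yD => ->.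
  by move/(subsetP SD): sS; rewrite inE.
have le2 : size ql2 <= \sum_(P <- ql2) dends P.
  rewrite /ql2 big_cat size_cat size_map -cardE szE /= big_map big_enum.
  have -> : \sum_(y in Y) dends [:: y] = \sum_(y in Y) 2.
    by apply: eq_bigr => y /(subsetP YD) yD; rewrite /= yD.
  rewrite sum_nat_const; move: dE sz0; move: (\sum_(_ <- _) _) #|D| (size ql); rewrite /=.
  by move: #|_|; clear; lia.
have T0 : 0 < size ql2.
  move: pc2; case: (ql2) => [|//] /andP[_ /perm_size]; rewrite -cardE cardsT => /= h.
  by rewrite -h in T3.
have rDS u v : u \in D -> v \notin S -> u != v -> r u v.
  by move=> uD vS uv; rewrite /r uD vS uv orbT.
have [x [A [pcA xS lA]]] := join_all rsym rDS (Logic.eq_sym (prednK T0)) pc2 sl2 le2.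
apply: (@hamiltonian_closure _ e r) => //.
- by move=> u; rewrite /r eirr eqxx.
- by move=> u v euv; rewrite /r euv.
- move=> u v; rewrite /r; case: (e u v) => //= /andP[_ /orP[]/andP[h1 h2]] _; first exact: degD.
  by rewrite addnC; exact: degD.
move: pcA => /andP[/= /andP[/andP[_ sA] _]]; rewrite cats0 => pe.
exists (x :: A); split.
- by rewrite (perm_uniq pe) enum_uniq.
- by rewrite (perm_size pe) -cardE cardsT.
- by move=> u; rewrite (perm_mem pe) mem_enum inE.
rewrite /cycle rcons_path; apply/andP; split=> //.
apply: rDS => //.
have : uniq (x :: A) by rewrite (perm_uniq pe) enum_uniq.
move: T3; rewrite -cardsT cardE -(perm_size pe).
case: A {sA pe lA xS} => // a A _ /= /andP[xA _]; apply: contraNneq xA => <-; exact: mem_last.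
Qed.

End Assembly.

(* Delta >= 2n/3 + 12 is written as 3 * Delta >= 2 * n + 36 (exact, over nat). *)
Theorem theorem1 (T : finType) (e : rel T) :
  simple_graph e ->
  edge_critical e ->
  2 * #|T| + 36 <= 3 * max_deg e ->
  hamiltonian e.
Proof.
move=> [es ei] crit le.
have maxle : max_deg e <= #|T| by apply/bigmax_leqP => x _; exact: max_card.
pose D := max_vertices e; pose S := [set v | deg e v + max_deg e < #|T|].
(* Membership in [S] gives [deg e u + deg e w + 2 <= 2 * (#|T| - max_deg e)], and
   [2 * #|T| <= 3 * max_deg e] bounds the right side by [max_deg e]. *)
have small u w : u \in S -> w \in S -> deg e u + deg e w + 2 <= max_deg e.
  by rewrite !inE; move: le; move: (deg e u) (deg e w) (max_deg e) #|T|; clear; lia.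
have SD : S \subset ~: D.
  apply/subsetP => v; rewrite !inE => h; apply/eqP => E; move: h le; rewrite E.
  by move: (max_deg e) #|T|; clear; lia.
have cov : exists2 pl, pcover e (~: D) pl & size pl <= #|D|.
  by apply: critical_path_cover => //; move: le; move: (max_deg e) #|T|; clear; lia.
have [ql [mu [[pc sz me _] muE]]] := attach_paths es ei SD
  (small_vertices_indep es ei crit small) (small_expand es ei crit small) cov.
apply: (@hamiltonian_assembly T D S e mu es SD me ei _ ql) => //.
- move=> y x; rewrite !inE => /eqP ->; rewrite -leqNgt addnC //.
- by move: le maxle; move: (max_deg e) #|T|; clear; lia.
Qed.
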